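(* Let $E\subset\mathbb{C}$ be a closed set and let $w$ be an admissible weight on $E$. Let $\nu_1,\dots,\nu_m$ be positive compactly supported Borel measures on $\mathbb{C}$ with potentials $p_j(z)=\int\log|z-t|\,d\nu_j(t)$, such that $\nu_j(\mathbb{C})=\alpha_j$ and $\sum_{j=1}^m\alpha_j=1$. Then \[ \sum_{j=1}^m\sup_E(\alpha_j\log w+p_j) \le C_E^w(m)+\sup_E\left(\log w+\sum_{j=1}^m p_j\right) \le C_E^w+\sup_E\left(\log w+\sum_{j=1}^m p_j\right), \] where \[ C_E^w(m):=\sup_{c_1,\dots,c_m\in E}\int\log\max_{1\le k\le m} w(c_k)|z-c_k|\,d\mu_w(z)+F_w, \qquad C_E^w:=\int\log d_E^w(z)\,d\mu_w(z)+F_w . \] For each fixed $m\ge 2$, $C_E^w(m)$ cannot be replaced by a smaller value, and $C_E^w$ cannot be replaced by a smaller value independent of $m$.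
   Context: A weight $w:E\to[0,\infty)$ is admissible if $w$ is upper semicontinuous on $E$, the set $\{z\in E: w(z)>0\}$ has positive logarithmic capacity, and, if $E$ is unbounded, $|z|w(z)\to 0$ as $|z|\to\infty$, $z\in E$. The weighted equilibrium measure $\mu_w$ is the (unique) positive unit Borel measure with compact support $S_w\subset E$, and $F_w$ the (unique) constant, such that $\int\log|z-t|\,d\mu_w(t)+\log w(z)+F_w\ge 0$ for $z\in S_w$ and $\int\log|z-t|\,d\mu_w(t)+\log w(z)+F_w\le 0$ for quasi every $z\in E$ (except on a set of zero logarithmic capacity). The weighted farthest-point distance function is $d_E^w(z):=\sup_{t\in E}w(t)|z-t|$, $z\in\mathbb{C}$. Here $\log 0=-\infty$. *)

(* Defs.v *)
(* The complex plane C is modelled as R * R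
   (product topology = Euclidean topology, product sigma-algebra = Borel
   sigma-algebra of R^2); |z - t| is the Euclidean distance [cdist]. *)
From HB Require Import structures.
From mathcomp Require Import all_boot all_order all_algebra.
From mathcomp Require Import all_classical all_reals all_analysis.
Set Implicit Arguments.
Unset Strict Implicit.
Unset Printing Implicit Defensive.
Import Order.TTheory GRing.Theory Num.Theory.
Import numFieldNormedType.Exports.
Local Open Scope classical_set_scope.
Local Open Scope ring_scope.

Section PotentialTheory.
Context {R : realType}.

Definition cabs (z : R * R) : R := Num.sqrt (z.1 ^+ 2 + z.2 ^+ 2).
Definition cdist (z t : R * R) : R :=
  Num.sqrt ((z.1 - t.1) ^+ 2 + (z.2 - t.2) ^+ 2).

Definition elog (x : R) : \bar R := if x <= 0 then -oo%E else (ln x)%:E.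
Definition eelog (x : \bar R) : \bar R :=
  match x with
  | r%:E => elog r
  | +oo%E => +oo%E
  | -oo%E => -oo%E
  end.

Definition logpot (nu : {measure set (R * R) -> \bar R}) (z : R * R) : \bar R :=
  (\int[nu]_t elog (cdist z t))%E.

Definition log_energy (mu : {measure set (R * R) -> \bar R}) : \bar R :=
  (\int[mu]_z (\int[mu]_t (- elog (cdist z t))))%E.

Definition pos_log_cap (A : set (R * R)) : Prop :=
  exists K : set (R * R), [/\ compact K, K `<=` A &
    exists mu : {measure set (R * R) -> \bar R},
      [/\ mu setT = 1%E, mu (~` K) = 0%E & (log_energy mu < +oo)%E]].

Definition zero_log_cap (A : set (R * R)) : Prop := ~ pos_log_cap A.

Definition compact_supp (nu : {measure set (R * R) -> \bar R}) : Prop :=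
  exists K : set (R * R), compact K /\ nu (~` K) = 0%E.

Definition admissible (E : set (R * R)) (w : R * R -> R) : Prop :=
  [/\ (forall z, E z -> 0 <= w z),
      (forall z, E z -> forall eps : R, 0 < eps ->
         exists2 delta : R, 0 < delta &
           forall t, E t -> cdist t z < delta -> w t < w z + eps),
      pos_log_cap [set z | E z /\ 0 < w z] &
      ((~ exists M : R, forall z, E z -> cabs z <= M) ->
        forall eps : R, 0 < eps -> exists M : R,
          forall z, E z -> M < cabs z -> cabs z * w z < eps)].

(* (mu, F) is the weighted equilibrium pair (mu_w, F_w) of (E, w):
   mu is a unit positive Borel measure whose support is a compact subset S_w
   of E (we quantify over a compact S in E carrying mu, which is equivalent
   since the inequality on S implies it on the support), with
   U + log w + F >= 0 on S and <= 0 quasi everywhere on E. *)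
Definition weighted_equilibrium (E : set (R * R)) (w : R * R -> R)
    (mu : {measure set (R * R) -> \bar R}) (F : R) : Prop :=
  mu setT = 1%E /\
  (exists S : set (R * R), [/\ compact S, S `<=` E, mu (~` S) = 0%E &
     forall z, S z -> (0 <= logpot mu z + elog (w z) + F%:E)%E]) /\
  zero_log_cap [set z | E z /\ (0 < logpot mu z + elog (w z) + F%:E)%E].

Definition farthest_dist (E : set (R * R)) (w : R * R -> R) (z : R * R) : \bar R :=
  ereal_sup [set (w t * cdist z t)%:E | t in E].

Definition CEwm (E : set (R * R)) (w : R * R -> R)
    (mu : {measure set (R * R) -> \bar R}) (F : R) (m : nat) : \bar R :=
  (ereal_sup [set \int[mu]_z
        elog (\big[Num.max/0]_(k < m) (w (c k) * cdist z (c k)))%R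
      | c in [set c : 'I_m -> R * R | forall k, E (c k)]] + F%:E)%E.

Definition CEw (E : set (R * R)) (w : R * R -> R)
    (mu : {measure set (R * R) -> \bar R}) (F : R) : \bar R :=
  (\int[mu]_z eelog (farthest_dist E w z) + F%:E)%E.

Definition admissible_family (m : nat)
    (nu : 'I_m -> {measure set (R * R) -> \bar R}) (alpha : 'I_m -> R) : Prop :=
  [/\ forall j, compact_supp (nu j),
      forall j, nu j setT = (alpha j)%:E &
      \sum_(j < m) alpha j = 1].

Definition lhs_sum (E : set (R * R)) (w : R * R -> R) (m : nat)
    (nu : 'I_m -> {measure set (R * R) -> \bar R}) (alpha : 'I_m -> R) : \bar R :=
  (\sum_(j < m)
     ereal_sup [set (alpha j)%:E * elog (w z) + logpot (nu j) z | z in E])%E.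

Definition sup_prod (E : set (R * R)) (w : R * R -> R) (m : nat)
    (nu : 'I_m -> {measure set (R * R) -> \bar R}) : \bar R :=
  ereal_sup [set (elog (w z) + \sum_(j < m) logpot (nu j) z)%E | z in E].

End PotentialTheory.

(* Main.v *)
(* Upper bound.  Put nu = sum_j nu_j and let s be the supremum of log w + U^nu over E.  On S_w
   one has log w + U^mu + F >= 0, so U^nu <= U^mu + s + F there, and everywhere by the domination
   principle.  Integrating log|q| for a polynomial q turns this into a comparison of the two
   measures on log|q|; with q a suitable combination of the (w(c_k) (z - c_k))^n and n -> oo, it
   becomes the same comparison on log max_k w(c_k) |z - c_k|.  As each alpha_j log w(c_j) + U^{nu_j}(c_j)
   is at most the nu_j-integral of that function, the first inequality follows.

   Sharpness.  If U^mu + log w + F <= 0 held on all of E, it would suffice to cut mu along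
   the cells where a given k realises max_k w(c_k) |z - c_k|.  The set of points of E where
   U^mu + log w + F >= e > 0 is compact of capacity zero, hence carries a finitely supported
   probability measure whose potential is as negative as desired on it; mixing a little of this
   measure with mu removes the exceptional set.  Finally d_E^w is approximated on the compact S_w
   by finite maxima. *)

Require Import Defs.
From HB Require Import structures.
From mathcomp Require Import all_boot all_order all_algebra.
From mathcomp Require Import all_classical all_reals all_analysis.
From mathcomp Require Import ring lra measurable_realfun complex.
Import Order.TTheory GRing.Theory Num.Theory.
Import numFieldNormedType.Exports.
Local Open Scope classical_set_scope.
Local Open Scope ring_scope.
Set Implicit Arguments.
Unset Strict Implicit.
Unset Printing Implicit Defensive.

(** * The Euclidean plane *)

(** The loss in passing from the n-th power of the maximum to |q| is a constant that does not grow
    with n, so division by n removes it. Potentials are only semicontinuous and may be -oo. They are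
    handled through the kernels [lk d], whose potentials are real-valued Lipschitz functions that
    decrease to the true potential as d tends to 0; the Laplacian becomes a comparison of four
    values with the value at the centre. The supremum over E sees every point, whereas the
    equilibrium inequality may fail on a set of capacity zero; there [mu] alone gives no competitor,
    hence the perturbation. The point masses used for it come from Leja points: if their potentials
    could not be made very negative, a limit of their empirical measures would have finite energy.
    In the extended reals the sum of -oo and +oo is -oo, so integrals are added only for integrands
    bounded above on a compact carrier. *)

Section plane_geometry.
Context {R : realType}.
Implicit Types (z t u : R * R) (A K : set (R * R)).

Definition sqd z t : R := (z.1 - t.1) ^+ 2 + (z.2 - t.2) ^+ 2.

Lemma sqd_ge0 z t : 0 <= sqd z t.
Proof. by rewrite addr_ge0 // sqr_ge0. Qed.

Lemma cdist_ge0 z t : 0 <= cdist z t.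
Proof. exact: sqrtr_ge0. Qed.

Lemma cdist_sqr z t : cdist z t ^+ 2 = sqd z t.
Proof. by rewrite sqr_sqrtr // sqd_ge0. Qed.

Lemma cdistC z t : cdist z t = cdist t z.
Proof. by rewrite /cdist -sqrrN opprB -[in X in _ + X]sqrrN opprB. Qed.

Lemma sqdC z t : sqd z t = sqd t z.
Proof. by rewrite -!cdist_sqr cdistC. Qed.

Lemma cdist_triangle z t u : cdist z u <= cdist z t + cdist t u.
Proof.
rewrite -(@ler_pXn2r _ 2) ?nnegrE ?addr_ge0 ?cdist_ge0 //.
rewrite sqrrD !cdist_sqr.
suff : (z.1 - t.1) * (t.1 - u.1) + (z.2 - t.2) * (t.2 - u.2)
    <= cdist z t * cdist t u.
  by rewrite /sqd; lra.
apply: (le_trans (ler_norm _)).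
rewrite -(@ler_pXn2r _ 2) ?nnegrE ?mulr_ge0 ?cdist_ge0 //.
rewrite exprMn !cdist_sqr real_normK ?num_real // /sqd.
set a := z.1 - _; set b := z.2 - _; set c := t.1 - _; set d := t.2 - _.
rewrite -subr_ge0.
(* Lagrange's identity: the defect in Cauchy-Schwarz is a square. *)
have -> : (a ^+ 2 + b ^+ 2) * (c ^+ 2 + d ^+ 2) - (a * c + b * d) ^+ 2
   = (a * d - b * c) ^+ 2 by ring.
exact: sqr_ge0.
Qed.

Lemma cdistxx z : cdist z z = 0.
Proof. by rewrite /cdist !subrr expr0n addr0 sqrtr0. Qed.

Lemma cdist_eq0 z t : cdist z t = 0 -> z = t.
Proof.
move=> h; have : sqd z t = 0 by rewrite -cdist_sqr h expr0n.
rewrite /sqd => /eqP; rewrite paddr_eq0 ?sqr_ge0 // !sqrf_eq0 !subr_eq0.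
by case: z t {h} => [? ?] [? ?] /= /andP[/eqP -> /eqP ->].
Qed.

Lemma fst_le_cdist z t : `|z.1 - t.1| <= cdist z t.
Proof.
rewrite -(@ler_pXn2r _ 2) ?nnegrE ?cdist_ge0 // cdist_sqr.
by rewrite real_normK ?num_real // /sqd lerDl sqr_ge0.
Qed.

Lemma snd_le_cdist z t : `|z.2 - t.2| <= cdist z t.
Proof.
rewrite -(@ler_pXn2r _ 2) ?nnegrE ?cdist_ge0 // cdist_sqr.
by rewrite real_normK ?num_real // /sqd lerDr sqr_ge0.
Qed.

Lemma cdist_le_sum z t : cdist z t <= `|z.1 - t.1| + `|z.2 - t.2|.
Proof.
rewrite -(@ler_pXn2r _ 2) ?nnegrE ?cdist_ge0 ?addr_ge0 // cdist_sqr.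
rewrite sqrrD !real_normK ?num_real // /sqd.
have := mulr_ge0 (normr_ge0 (z.1 - t.1)) (normr_ge0 (z.2 - t.2)); lra.
Qed.

Lemma cabsE z : cabs z = cdist z (0, 0).
Proof. by rewrite /cabs /cdist /= !subr0. Qed.

(** Product neighbourhoods are boxes: the disc of radius [e] lies in the box of half-width [e] and
    contains the one of half-width [e / 2]. Everything topological is then phrased with [cdist]. *)
Lemma nbhs_cdistP z (P : set (R * R)) :
  nbhs z P <-> exists2 e : R, 0 < e & forall t, cdist t z < e -> P t.
Proof.
split.
  move=> /nbhs_ballP[e /= e0 he]; exists e => // t ht; apply: he.
  split; rewrite /ball /= distrC.
    exact: le_lt_trans (fst_le_cdist _ _) ht.
  exact: le_lt_trans (snd_le_cdist _ _) ht.
move=> [e e0 he]; apply/nbhs_ballP; exists (e / 2) => /=; first by rewrite divr_gt0.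
move=> t [/= h1 h2]; apply: he; apply: (le_lt_trans (cdist_le_sum _ _)).
rewrite (splitr e); apply: ltrD; rewrite distrC.
  exact: h1.
exact: h2.
Qed.

Lemma closed_cdistP A :
  closed A <-> forall z, (forall e : R, 0 < e -> exists2 t, A t & cdist t z < e) -> A z.
Proof.
split.
  move=> cA z hz; apply: cA => B /nbhs_cdistP[e e0 he].
  by have [t At tz] := hz e e0; exists t; split => //; apply: he.
move=> h z hz; apply: h => e e0.
have /hz[t [At tz]] : nbhs z [set t | cdist t z < e] by apply/nbhs_cdistP; exists e.
by exists t.
Qed.

Lemma continuous_cdistP (f : R * R -> R) z :
  (forall e : R, 0 < e -> exists2 d : R, 0 < d & forall t, cdist t z < d -> `|f t - f z| < e) ->
  {for z, continuous f}.
Proof.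
move=> h; apply/cvgrPdist_lt => e e0; have [d d0 hd] := h _ e0.
by apply/nbhs_cdistP; exists d => // t /hd; rewrite distrC.
Qed.

Lemma lipschitz_cdist_continuous (f : R * R -> R) (L : R) :
  (forall z t, f z - f t <= L * cdist z t) -> continuous f.
Proof.
move=> hL z; apply: continuous_cdistP => e e0.
have L0 : 0 < `|L| + 1 by have := normr_ge0 L; lra.
exists (e / (`|L| + 1)); first by rewrite divr_gt0.
move=> t; rewrite ltr_pdivlMr // => htz.
have h1 := hL t z; have h2 := hL z t; rewrite cdistC in h2.
have h3 : L * cdist t z <= cdist t z * (`|L| + 1).
  rewrite mulrC; apply: ler_wpM2l; first exact: cdist_ge0.
  by have := ler_norm L; lra.
by apply/ltr_normlP; split; lra.
Qed.

Lemma continuous_cdist z : continuous (cdist z).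
Proof.
apply: (@lipschitz_cdist_continuous _ 1) => t u; rewrite mul1r.
have := cdist_triangle z u t; rewrite (cdistC u t); lra.
Qed.

(** The sigma-algebra is the product one, so an open set is written as a countable union of boxes
    with rational centre and size. *)
Lemma measurable_open_plane A : open A -> measurable A.
Proof.
move=> oA.
pose r (q : rat) : R := ratr q.
pose B (q : rat * rat * rat) := [set t : R * R |
   (`]r q.1.1 - r q.2, r q.1.1 + r q.2[ `*` `]r q.1.2 - r q.2, r q.1.2 + r q.2[) t].
have -> : A = \bigcup_(q in [set q | B q `<=` A]) B q.
  apply/seteqP; split; last by move=> t [q /= h] /h.
  move=> z Az; have /nbhs_ballP[e /= e0 he] := oA _ Az.
  have [d] := @rat_in_itvoo R 0 (e / 2) (divr_gt0 e0 (ltr0Sn _ 1)).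
  rewrite in_itv /= => /andP[d0 de].
  have hd (x : R) : exists q : rat, `|x - r q| < r d.
    have [|q] := @rat_in_itvoo R (x - r d) (x + r d); first by rewrite /r; lra.
    rewrite in_itv /= => /andP[h1 h2]; exists q; apply/ltr_normlP.
    by rewrite /r in h1 h2 *; split; lra.
  have [q1 h1] := hd z.1; have [q2 h2] := hd z.2.
  move/ltr_normlP : (h1) => [h1a h1b]; move/ltr_normlP : (h2) => [h2a h2b].
  exists (q1, q2, d).
    move=> t [/=]; rewrite !in_itv /= => /andP[a1 a2] /andP[b1 b2].
    apply: he; split; rewrite /ball /=; apply/ltr_normlP; rewrite /r in h1a h1b h2a h2b a1 a2 b1 b2 de d0 *.
    - by split; lra.
    - by split; lra.
  by split; rewrite /= in_itv /=; apply/andP; split; lra.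
rewrite bigcup_mkcond; apply: countable_bigcupT_measurable => // q.
case: ifPn => _ //; apply: measurableX; exact: measurable_itv.
Qed.

Lemma measurable_closed_plane A : closed A -> measurable A.
Proof.
move=> cA; rewrite -(setCK A); apply: measurableC; apply: measurable_open_plane.
exact: closed_openC.
Qed.

Lemma hausdorff_plane : hausdorff_space (R * R)%type.
Proof. exact: (@norm_hausdorff R (R * R)%type). Qed.

Lemma compact_closed_plane K : compact K -> closed K.
Proof. by apply: compact_closed; exact: hausdorff_plane. Qed.

Lemma measurable_compact_plane K : compact K -> measurable K.
Proof. by move=> /compact_closed_plane; exact: measurable_closed_plane. Qed.

Lemma compact_bounded_plane K z : compact K ->
  exists2 B : R, 0 < B & forall t, K t -> cdist z t <= B.
Proof.
move=> cK; have [K0|/set0P[t0 Kt0]] := eqVneq K set0.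
  by exists 1 => // t; rewrite K0.
have [c _ hc] : exists2 c, c \in K & forall t, t \in K -> cdist z t <= cdist z c.
  apply: compact_EVT_max => //; first by exists t0.
  by apply: continuous_subspaceT; exact: continuous_cdist.
exists (cdist z c + 1); first by have := cdist_ge0 z c; lra.
by move=> t Kt; have := hc t (mem_set Kt); lra.
Qed.

Lemma bounded_closed_compact_plane K z (B : R) :
  closed K -> (forall t, K t -> cdist z t <= B) -> compact K.
Proof.
move=> cK hB.
apply: (@subclosed_compact _ _ (`[z.1 - B, z.1 + B]%classic `*` `[z.2 - B, z.2 + B]%classic)) => //.
  by apply: compact_setX; exact: segment_compact.
move=> t /hB h; have /ler_normlP[a1 a2] := le_trans (fst_le_cdist z t) h.
have /ler_normlP[b1 b2] := le_trans (snd_le_cdist z t) h.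
by split => /=; rewrite in_itv /=; apply/andP; split; lra.
Qed.

Lemma nearest_point K z : compact K -> K !=set0 ->
  exists2 a, K a & forall t, K t -> cdist z a <= cdist z t.
Proof.
move=> cK K0.
have [c cK' hc] : exists2 c, c \in K & forall t, t \in K -> cdist z c <= cdist z t.
  apply: compact_EVT_min => //.
  by apply: continuous_subspaceT; exact: continuous_cdist.
by exists c; [exact: set_mem | move=> t Kt; apply: hc; exact: mem_set].
Qed.

End plane_geometry.

(** * Smoothed potentials *)

Ltac nneg := repeat first [done | exact: sqr_ge0 | apply: exprn_ge0
  | apply: addr_ge0 | apply: mulr_ge0 | exact: ltW].

Section smoothed_kernel.
Context {R : realType}.
Implicit Types (z t u a : R * R) (d s : R).

(* The logarithmic kernel smoothed at scale [d]: it decreases to [log |z - t|] as [d] tends to 0. *)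
Definition lk d z t : R := ln (sqd z t + d ^+ 2) / 2.

Lemma sqdD_gt0 d z t : 0 < d -> 0 < sqd z t + d ^+ 2.
Proof. by move=> d0; rewrite ltr_wpDl ?sqd_ge0 ?exprn_gt0. Qed.

Lemma lkC d z t : lk d z t = lk d t z.
Proof. by rewrite /lk sqdC. Qed.

Lemma ln_sqr_half d : 0 < d -> ln (d ^+ 2) / 2 = ln d.
Proof. by move=> d0; rewrite lnXn // mulr2n; lra. Qed.

Lemma lk_ge d z t : 0 < d -> ln d <= lk d z t.
Proof.
move=> d0; rewrite -ln_sqr_half // ler_pM2r ?invr_gt0 // ler_ln ?posrE ?exprn_gt0 ?sqdD_gt0 //.
by rewrite lerDr sqd_ge0.
Qed.

Lemma lk_le d z t (x : R) : 0 < d -> d <= 1 -> cdist z t <= x -> lk d z t <= ln (x + 1).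
Proof.
move=> d0 d1 zt; have z0 := cdist_ge0 z t.
have x0 : 0 < x + 1 by lra.
rewrite -ln_sqr_half // ler_pM2r ?invr_gt0 // ler_ln ?posrE ?exprn_gt0 ?sqdD_gt0 //.
rewrite -cdist_sqr; nra.
Qed.

Lemma lk_ge_cdist d z t (x : R) : 0 < x -> x <= cdist z t -> ln x <= lk d z t.
Proof.
move=> x0 xz; rewrite -ln_sqr_half // ler_pM2r ?invr_gt0 // ler_ln ?posrE ?exprn_gt0 //.
  rewrite -cdist_sqr; have := sqr_ge0 d; nra.
rewrite -cdist_sqr; apply: ltr_pwDl; rewrite ?sqr_ge0 // exprn_gt0 //; lra.
Qed.

Lemma lk_mono d d' z t : 0 < d -> d <= d' -> lk d z t <= lk d' z t.
Proof.
move=> d0 dd'; have d'0 := lt_le_trans d0 dd'.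
by rewrite ler_pM2r ?invr_gt0 // ler_ln ?posrE ?sqdD_gt0 // lerD2l ler_sqr ?nnegrE // ltW.
Qed.

Lemma elog_cdist z t : 0 < cdist z t -> elog (cdist z t) = (ln (sqd z t) / 2)%:E.
Proof.
move=> zt; rewrite /elog leNgt zt /=; congr (_%:E).
by rewrite -cdist_sqr ln_sqr_half.
Qed.

Lemma elog_le_lk d z t : 0 < d -> (elog (cdist z t) <= (lk d z t)%:E)%E.
Proof.
move=> d0; have := cdist_ge0 z t; rewrite le_eqVlt => /orP[/eqP<-|zt].
  by rewrite /elog lexx leNye.
rewrite elog_cdist // lee_fin ler_pM2r ?invr_gt0 // ler_ln ?posrE ?sqdD_gt0 //.
  by rewrite lerDl sqr_ge0.
by rewrite -cdist_sqr exprn_gt0.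
Qed.

(** Convergence of the kernels as d tends to 0, stated through levels [y] above the limit so that
    the value -oo at z = t fits the same formula. *)
Lemma lk_lt_elog z t (y : R) : (elog (cdist z t) < y%:E)%E ->
  exists2 d0 : R, 0 < d0 <= 1 & forall d, 0 < d -> d <= d0 -> lk d z t < y.
Proof.
have := cdist_ge0 z t; rewrite le_eqVlt => /orP[/eqP zt0 _|zt].
  exists (Num.min 1 (expR y / 2)).
    by rewrite lt_min ltr01 divr_gt0 ?expR_gt0 //= ge_min lexx.
  move=> d d0; rewrite le_min => /andP[_ dy].
  have e0 := expR_gt0 y.
  rewrite /lk -cdist_sqr -zt0 expr0n add0r ln_sqr_half // -ltr_expR lnK ?posrE //.
  by apply: (le_lt_trans dy); rewrite ltr_pdivrMr // ltr_pMr // ltr1n.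
rewrite elog_cdist // lte_fin => hy.
have x0 : 0 < sqd z t by rewrite -cdist_sqr exprn_gt0.
set x := sqd z t in x0 hy *; set e := y - ln x / 2.
have e0 : 0 < e by rewrite subr_gt0.
have ex0 : 0 < e * x by rewrite mulr_gt0.
exists (Num.min 1 (e * x)); first by rewrite lt_min ltr01 ex0 ge_min lexx.
move=> d d0; rewrite le_min => /andP[d1 de].
rewrite /lk -/x.
have -> : x + d ^+ 2 = x * (1 + d ^+ 2 / x) by field; rewrite gt_eqF.
have q0 : 0 < d ^+ 2 / x by rewrite divr_gt0 ?exprn_gt0.
have q1 : 0 < 1 + d ^+ 2 / x by rewrite addr_gt0.
rewrite lnM ?posrE //.
have h1 : ln (1 + d ^+ 2 / x) <= d ^+ 2 / x by apply: le_ln1Dx; lra.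
have h2 : d ^+ 2 / x <= e by rewrite ler_pdivrMr //; nra.
by rewrite /e in h2 e0 *; lra.
Qed.

(** With r = |z - u|, moving from u to z multiplies [sqd + d ^+ 2] by at most (1 + r / d)^2, and ln
    (1 + x) <= x. *)
Lemma lk_lipschitz d z u t : 0 < d -> lk d z t - lk d u t <= cdist z u / d.
Proof.
move=> d0; set r := cdist z u; have r0 : 0 <= r := cdist_ge0 _ _.
have rd0 : 0 <= r / d by rewrite divr_ge0 // ltW.
have h : sqd z t + d ^+ 2 <= (sqd u t + d ^+ 2) * (1 + r / d) ^+ 2.
  have tri := cdist_triangle z u t; rewrite -/r in tri.
  rewrite -!cdist_sqr; have x0 := cdist_ge0 u t; have y0 := cdist_ge0 z t.
  set x := cdist u t in tri x0 *; set y := cdist z t in tri y0 *.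
  apply: (@le_trans _ _ ((r + x) ^+ 2 + d ^+ 2)); first nra.
  have rq : r = (r / d) * d by rewrite divfK // gt_eqF.
  set q := r / d in rd0 rq *; rewrite rq -subr_ge0.
  have -> : (x ^+ 2 + d ^+ 2) * (1 + q) ^+ 2 - ((q * d + x) ^+ 2 + d ^+ 2) =
     q * ((x - d) ^+ 2 + x ^+ 2 + d ^+ 2) + q ^+ 2 * x ^+ 2 by ring.
  by nneg.
have q1 : 0 < 1 + r / d by rewrite ltr_pwDl.
have lnh : ln (sqd z t + d ^+ 2) <= ln (sqd u t + d ^+ 2) + ln (1 + r / d) *+ 2.
  rewrite -lnXn // -lnM ?posrE ?sqdD_gt0 ?exprn_gt0 //.
  by rewrite ler_ln ?posrE ?mulr_gt0 ?sqdD_gt0 ?exprn_gt0.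
have : ln (1 + r / d) <= r / d by apply: le_ln1Dx; lra.
by rewrite /lk; rewrite mulr2n in lnh; lra.
Qed.

(** The quotient (x + 4 d^2) / (x + 4 d'^2) decreases in x; it is compared at x = |a - t|^2 and x =
    4 |z - t|^2. With [a] a nearest point of a set to [z], this carries the effect of smoothing from
    points of the set to points off it, at the price of doubled scales. *)
Lemma lk_diff_le d d' a z t : 0 < d' -> d' <= d -> cdist a t <= 2 * cdist z t ->
  lk d z t - lk d' z t <= lk (2 * d) a t - lk (2 * d') a t.
Proof.
move=> d'0 dd' h; have d0 := lt_le_trans d'0 dd'.
have hs : sqd a t <= 4 * sqd z t.
  rewrite -!cdist_sqr; have := cdist_ge0 a t; have := cdist_ge0 z t; nra.
have dd : d' ^+ 2 <= d ^+ 2 by nra.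
suff : ln (sqd z t + d ^+ 2) + ln (sqd a t + (2 * d') ^+ 2)
    <= ln (sqd a t + (2 * d) ^+ 2) + ln (sqd z t + d' ^+ 2) by rewrite /lk; lra.
have [p q] : 0 < 2 * d /\ 0 < 2 * d' by split; lra.
rewrite -!lnM ?posrE ?sqdD_gt0 // ler_ln ?posrE ?mulr_gt0 ?sqdD_gt0 //.
set x := sqd z t in hs *; set y := sqd a t in hs *; nra.
Qed.

(* Comparing [fourpt s f z] with [4 f z] replaces the sub- and superharmonicity of potentials. *)
Definition fourpt s (f : R * R -> R) z : R :=
  f (z.1 + s, z.2) + f (z.1 - s, z.2) + f (z.1, z.2 + s) + f (z.1, z.2 - s).

(** Opposite points pair up into differences of squares, so four logarithms become the logarithm of
    a product of two factors. *)
Lemma fourpt_lkE d s z t : 0 < d ->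
  let A := sqd z t + d ^+ 2 + s ^+ 2 in
  let x := z.1 - t.1 in let y := z.2 - t.2 in
  fourpt s (lk d ^~ t) z =
  ln ((A ^+ 2 - 4 * s ^+ 2 * x ^+ 2) * (A ^+ 2 - 4 * s ^+ 2 * y ^+ 2)) / 2
  /\ 0 < (A ^+ 2 - 4 * s ^+ 2 * x ^+ 2) * (A ^+ 2 - 4 * s ^+ 2 * y ^+ 2).
Proof.
move=> d0 A x y.
have e1 : sqd (z.1 + s, z.2) t + d ^+ 2 = A + 2 * s * x by rewrite /A /sqd /x /=; ring.
have e2 : sqd (z.1 - s, z.2) t + d ^+ 2 = A - 2 * s * x by rewrite /A /sqd /x /=; ring.
have e3 : sqd (z.1, z.2 + s) t + d ^+ 2 = A + 2 * s * y by rewrite /A /sqd /y /=; ring.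
have e4 : sqd (z.1, z.2 - s) t + d ^+ 2 = A - 2 * s * y by rewrite /A /sqd /y /=; ring.
have p1 := sqdD_gt0 (z.1 + s, z.2) t d0; have p2 := sqdD_gt0 (z.1 - s, z.2) t d0.
have p3 := sqdD_gt0 (z.1, z.2 + s) t d0; have p4 := sqdD_gt0 (z.1, z.2 - s) t d0.
rewrite /fourpt /lk e1 e2 e3 e4 in p1 p2 p3 p4 *.
have -> : (A ^+ 2 - 4 * s ^+ 2 * x ^+ 2) * (A ^+ 2 - 4 * s ^+ 2 * y ^+ 2) =
  (A + 2 * s * x) * (A - 2 * s * x) * (A + 2 * s * y) * (A - 2 * s * y) by ring.
split; last by rewrite !mulr_gt0.
rewrite (lnM (x := _ * _ * _)) ?posrE ?mulr_gt0 // (lnM (x := _ * _)) ?posrE ?mulr_gt0 //.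
rewrite lnM ?posrE ?mulr_gt0 //; lra.
Qed.

(** With b = |z - t|^2 + d^2, the Laplacian of [lk d] is 2 d^2 / b^2, so the four values exceed four
    times the centre value by about 2 s^2 d^2 / b^2. Half of this is kept; for s <= d the other half
    absorbs the only negative fourth-order term. *)
Lemma fourpt_lk_ge d s z t (B : R) : 0 < d -> 0 < s -> s <= d -> sqd z t + d ^+ 2 <= B ->
  4 * lk d z t + ln (1 + 2 * s ^+ 2 * d ^+ 2 / B ^+ 2) / 2 <= fourpt s (lk d ^~ t) z.
Proof.
move=> d0 s0 sd hB; have [-> P0] := fourpt_lkE s z t d0.
set x := z.1 - t.1 in P0 *; set y := z.2 - t.2 in P0 *; set b := sqd z t + d ^+ 2 in hB P0 *.
have b0 : 0 < b := sqdD_gt0 z t d0.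
have B0 : 0 < B := lt_le_trans b0 hB.
have q0 : 0 < 2 * s ^+ 2 * d ^+ 2 by rewrite !mulr_gt0 ?exprn_gt0.
have Q0 : 0 < 2 * s ^+ 2 * d ^+ 2 / B ^+ 2 by rewrite divr_gt0 ?exprn_gt0.
have Q2 : 0 < 1 + 2 * s ^+ 2 * d ^+ 2 / B ^+ 2 by rewrite addr_gt0.
have b4 : 0 < b ^+ 4 by rewrite exprn_gt0.
suff : ln (b ^+ 4 * (1 + 2 * s ^+ 2 * d ^+ 2 / B ^+ 2)) <=
  ln (((b + s ^+ 2) ^+ 2 - 4 * s ^+ 2 * x ^+ 2) * ((b + s ^+ 2) ^+ 2 - 4 * s ^+ 2 * y ^+ 2)).
  have -> : ln (b ^+ 4 * (1 + 2 * s ^+ 2 * d ^+ 2 / B ^+ 2)) =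
      ln b * 4 + ln (1 + 2 * s ^+ 2 * d ^+ 2 / B ^+ 2).
    by rewrite lnM ?posrE // lnXn // mulr_natr.
  by rewrite /lk -/b; lra.
rewrite ler_ln ?posrE //; last exact: mulr_gt0.
apply: (@le_trans _ _ (b ^+ 4 + 2 * s ^+ 2 * d ^+ 2 * b ^+ 2)).
  rewrite mulrDr mulr1 lerD2l.
  have -> : b ^+ 4 * (2 * s ^+ 2 * d ^+ 2 / B ^+ 2) =
     2 * s ^+ 2 * d ^+ 2 * b ^+ 2 * (b ^+ 2 / B ^+ 2) by field; rewrite gt_eqF.
  apply: ler_piMr; first by nneg.
  rewrite ler_pdivrMr ?exprn_gt0 // mul1r.
  by apply: lerXn2r; rewrite ?nnegrE // ltW.
rewrite -subr_ge0.
have -> : ((b + s ^+ 2) ^+ 2 - 4 * s ^+ 2 * x ^+ 2) * ((b + s ^+ 2) ^+ 2 - 4 * s ^+ 2 * y ^+ 2)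
   - (b ^+ 4 + 2 * s ^+ 2 * d ^+ 2 * b ^+ 2) =
   2 * s ^+ 2 * b ^+ 2 * (d ^+ 2 - s ^+ 2) + s ^+ 4 ^+ 2 + 16 * s ^+ 4 * (x ^+ 2 * y ^+ 2)
   + 8 * s ^+ 4 * d ^+ 2 * b + 4 * s ^+ 6 * d ^+ 2.
  rewrite /b /sqd -/x -/y; ring.
have ds : 0 <= d ^+ 2 - s ^+ 2 by rewrite subr_ge0 ler_sqr ?nnegrE // ltW.
by nneg.
Qed.

(** At distance at least r from t the unsmoothed logarithm is harmonic: smoothing causes the error
    in s^2 d^2, and the finite step s the one in s^4. *)
Lemma fourpt_lk_le d s z t (r : R) : 0 < d -> 0 < s -> s <= r -> r <= cdist z t ->
  fourpt s (lk d ^~ t) z <=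
  4 * lk d z t + (16 * s ^+ 2 * d ^+ 2 + 5 * s ^+ 4) / r ^+ 4 / 2.
Proof.
move=> d0 s0 sr hr; have r0 : 0 < r by lra.
have [-> P0] := fourpt_lkE s z t d0.
set x := z.1 - t.1 in P0 *; set y := z.2 - t.2 in P0 *; set b := sqd z t + d ^+ 2 in P0 *.
have b0 : 0 < b := sqdD_gt0 z t d0.
have rb : r ^+ 2 <= b.
  by rewrite /b -cdist_sqr; have := sqr_ge0 d; have := cdist_ge0 z t; nra.
have sb : s ^+ 2 <= b by nra.
set N := 16 * s ^+ 2 * d ^+ 2 + 5 * s ^+ 4.
have N0 : 0 < N by rewrite addr_gt0 ?mulr_gt0 ?exprn_gt0.
have Q0 : 0 < N / b ^+ 2 by rewrite divr_gt0 ?exprn_gt0.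
have Q2 : 0 < 1 + N / b ^+ 2 by rewrite addr_gt0.
have b4 : 0 < b ^+ 4 by rewrite exprn_gt0.
have Q1 : N / b ^+ 2 <= N / r ^+ 4.
  rewrite ler_pM2l // lef_pV2 ?posrE ?exprn_gt0 //.
  by rewrite (exprM r 2 2) ler_sqr ?nnegrE ?sqr_ge0 // ltW.
suff : ln (((b + s ^+ 2) ^+ 2 - 4 * s ^+ 2 * x ^+ 2) * ((b + s ^+ 2) ^+ 2 - 4 * s ^+ 2 * y ^+ 2))
   <= ln (b ^+ 4 * (1 + N / b ^+ 2)).
  have -> : ln (b ^+ 4 * (1 + N / b ^+ 2)) = ln b * 4 + ln (1 + N / b ^+ 2).
    by rewrite lnM ?posrE // lnXn // mulr_natr.
  have : ln (1 + N / b ^+ 2) <= N / b ^+ 2 by apply: le_ln1Dx; lra.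
  by rewrite /lk -/b; lra.
rewrite ler_ln ?posrE //; last exact: mulr_gt0.
have -> : b ^+ 4 * (1 + N / b ^+ 2) = b ^+ 4 + N * b ^+ 2 by field; rewrite gt_eqF.
have xy : 16 * (x ^+ 2 * y ^+ 2) <= 4 * b ^+ 2.
  have : x ^+ 2 + y ^+ 2 <= b by rewrite /b /sqd -/x -/y lerDl sqr_ge0.
  have : 4 * (x ^+ 2 * y ^+ 2) <= (x ^+ 2 + y ^+ 2) ^+ 2.
    by rewrite -subr_ge0; have := sqr_ge0 (x ^+ 2 - y ^+ 2); lra.
  have := sqr_ge0 x; have := sqr_ge0 y; nra.
have h1 : s ^+ 4 * (16 * (x ^+ 2 * y ^+ 2)) <= s ^+ 4 * (4 * b ^+ 2).
  by apply: ler_wpM2l; rewrite ?exprn_ge0 // ltW.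
have h2 : s ^+ 4 ^+ 2 <= s ^+ 4 * b ^+ 2.
  rewrite expr2; apply: ler_wpM2l; first by rewrite exprn_ge0 // ltW.
  by rewrite (exprM s 2 2) ler_sqr ?nnegrE ?sqr_ge0 // ltW.
have h3 : 4 * s ^+ 2 * d ^+ 2 * (b + s ^+ 2) ^+ 2 <= 16 * s ^+ 2 * d ^+ 2 * b ^+ 2.
  have -> : 16 * s ^+ 2 * d ^+ 2 * b ^+ 2 = 4 * s ^+ 2 * d ^+ 2 * (2 * b) ^+ 2 by ring.
  apply: ler_wpM2l; first by nneg.
  have s2 := sqr_ge0 s; apply: lerXn2r; rewrite ?nnegrE; lra.
have -> : ((b + s ^+ 2) ^+ 2 - 4 * s ^+ 2 * x ^+ 2) * ((b + s ^+ 2) ^+ 2 - 4 * s ^+ 2 * y ^+ 2)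
   = b ^+ 4 - 2 * s ^+ 4 * b ^+ 2 + s ^+ 4 ^+ 2 + 4 * s ^+ 2 * d ^+ 2 * (b + s ^+ 2) ^+ 2
     + s ^+ 4 * (16 * (x ^+ 2 * y ^+ 2)).
  rewrite /b /sqd -/x -/y; ring.
have : 0 <= s ^+ 4 * b ^+ 2 by rewrite mulr_ge0 ?exprn_ge0 ?(ltW s0) ?(ltW b0).
rewrite /N; lra.
Qed.

Lemma measurable_sqd z : measurable_fun setT (sqd z).
Proof.
apply: measurable_funD; apply: measurable_funX; apply: measurable_funB => //.
Qed.

Lemma measurable_lk d z : measurable_fun setT (lk d z).
Proof.
apply: measurable_funM => //; apply: measurableT_comp; first exact: measurable_ln.
by apply: measurable_funD => //; exact: measurable_sqd.
Qed.

Lemma measurable_elog : measurable_fun setT (@elog R).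
Proof.
apply: measurable_fun_if => //.
- by apply: measurable_fun_ler.
- by apply: measurable_funTS; apply/measurable_EFinP; exact: measurable_ln.
Qed.

Lemma measurable_cdist z : measurable_fun setT (cdist z).
Proof.
apply: (@measurableT_comp _ _ _ _ _ _ (@Num.sqrt R)).
  by apply: continuous_measurable_fun => x; exact: sqrt_continuous.
exact: measurable_sqd.
Qed.

Lemma measurable_elog_cdist z : measurable_fun setT (fun t => elog (cdist z t)).
Proof. apply: measurableT_comp; [exact: measurable_elog|exact: measurable_cdist]. Qed.

End smoothed_kernel.

(** * Integrals of functions that need not be integrable, and measures carried by a set *)

Section integration.
Context d (T : measurableType d) {R : realType}.
Variable nu : {measure set T -> \bar R}.
Implicit Types (D S : set T) (f g : T -> \bar R) (h : T -> R).

(** Goes through positive and negative parts, hence needs neither integrability nor a sign: the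
    integrands are often logarithms with the value -oo. *)
Lemma measurable_le_integral D f g : measurable D ->
  measurable_fun D f -> measurable_fun D g ->
  (forall t, D t -> (f t <= g t)%E) ->
  (\int[nu]_(t in D) f t <= \int[nu]_(t in D) g t)%E.
Proof.
move=> mD mf mg fg; rewrite integralE [leRHS]integralE.
apply: leeB; apply: ge0_le_integral => //.
- by apply: measurable_funepos.
- by apply: measurable_funepos.
- move=> t Dt; rewrite !funeposE ge_max le_max fg //=.
  by rewrite le_max lexx orbT.
- by apply: measurable_funeneg.
- by apply: measurable_funeneg.
- move=> t Dt; rewrite !funenegE ge_max le_max leeN2 fg //=.
  by rewrite le_max lexx orbT.
Qed.

Lemma integral_setI_conull D S f : measurable D -> measurable S -> nu (~` S) = 0%E ->
  measurable_fun D f ->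
  (\int[nu]_(t in D) f t = \int[nu]_(t in D `&` S) f t)%E.
Proof.
move=> mD mS S0 mf.
have DE : D = (D `&` S) `|` (D `&` ~` S) by rewrite -setIUr setUCr setIT.
rewrite [in LHS]DE integral_setU //.
- rewrite [X in (_ + X)%E]null_set_integral ?adde0 //.
  + by apply: measurableI => //; exact: measurableC.
  + by apply: measurable_funS mf => //; exact: subIsetl.
  + apply/eqP; rewrite eq_le measure_ge0 andbT -S0.
    by apply: le_measure; rewrite ?inE //; [apply: measurableI => //|]; exact: measurableC.
- exact: measurableI.
- by apply: measurableI => //; exact: measurableC.
- by rewrite -DE.
- by apply/disj_setPS => t [[_ a] [_ b]].
Qed.

(** If [f] has infinite integral, both sides are -oo: [f] is at most the negative part of h - f plus
    |h|, and the latter is integrable. *)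
Lemma integral_EFin_sub_ge0 D h f : measurable D ->
  nu.-integrable D (EFin \o h) -> measurable_fun D f -> (forall t, D t -> (0 <= f t)%E) ->
  (\int[nu]_(t in D) ((h t)%:E - f t) = (\int[nu]_(t in D) h t)%:E - \int[nu]_(t in D) f t)%E.
Proof.
move=> mD ih mf f0.
have hfin : (\int[nu]_(t in D) (h t)%:E)%E \is a fin_num by exact: integrable_fin_num.
have [fi|nfi] := pselect (nu.-integrable D f).
  by rewrite integralB // /Rintegral fineK.
have fy : (\int[nu]_(t in D) f t = +oo)%E.
  apply/eqP; rewrite -leye_eq leNgt; apply/negP => flt; apply: nfi.
  apply/integrableP; split => //; move: flt; rewrite (eq_integral f) //.
  by move=> t /set_mem Dt; rewrite gee0_abs // f0.
rewrite fy addeNy integralE.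
have mh : measurable_fun D (EFin \o h) by apply: measurable_int ih.
have mhf : measurable_fun D (fun t => (h t)%:E - f t)%E by apply: emeasurable_funB.
suff -> : (\int[nu]_(t in D) (fun t => (h t)%:E - f t)^\- t = +oo)%E by rewrite addeNy.
apply/eqP; rewrite -leye_eq -fy.
have habs : (\int[nu]_(t in D) `|(h t)%:E| < +oo)%E by have /integrableP[] := ih.
have : (\int[nu]_(t in D) f t <= \int[nu]_(t in D) ((fun t => (h t)%:E - f t)^\- t + `|(h t)%:E|))%E.
  apply: ge0_le_integral => //.
    apply: emeasurable_funD; first exact: measurable_funeneg.
    exact: measurableT_comp.
  move=> t Dt; rewrite funenegE; have := f0 t Dt; case: (f t) => [r| |] // r0.
    rewrite -EFinB /= -EFin_max -EFinD lee_fin.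
    have := ler_norm (h t).
    have : - (h t - r) <= Num.max (- (h t - r)) 0 by rewrite le_max lexx.
    lra.
rewrite ge0_integralD //; last 2 first.
- exact: measurable_funeneg.
- exact: measurableT_comp.
rewrite fy leye_eq => /eqP sy; rewrite leNgt; apply/negP => lty.
by have := lte_add_pinfty lty habs; rewrite sy ltxx.
Qed.

Section concentrated.
Variables (S : set T) (a : R).
Hypotheses (mS : measurable S) (S0 : nu (~` S) = 0%E) (nua : nu setT = a%:E).

Lemma ae_concentrated (P : T -> Prop) : (forall t, S t -> P t) -> {ae nu, forall t, P t}.
Proof.
move=> SP; exists (~` S); split => //; first exact: measurableC.
by move=> t nPt St; apply: nPt; exact: SP.
Qed.

Lemma measure_fin D : measurable D -> nu D \is a fin_num.
Proof.
move=> mD; rewrite ge0_fin_numE //; apply: (@le_lt_trans _ _ (nu setT)); last by rewrite nua ltry.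
by apply: le_measure; rewrite ?inE.
Qed.

Lemma fine_measure_le D : measurable D -> fine (nu D) <= a.
Proof.
move=> mD; rewrite -lee_fin fineK ?measure_fin // -nua.
by apply: le_measure; rewrite ?inE.
Qed.

Lemma concentrated_mass_ge0 : 0 <= a.
Proof. by rewrite -lee_fin -nua. Qed.

Lemma integrable_concentrated D h (B : R) : measurable D -> measurable_fun setT h ->
  (forall t, S t -> `|h t| <= B) -> nu.-integrable D (EFin \o h).
Proof.
move=> mD mh hB; apply: (@integrableS _ _ _ _ setT) => //.
apply/integrableP; split; first exact/measurable_EFinP.
apply: (@le_lt_trans _ _ (\int[nu]_t (`|B|%:E))%E).
  apply: ae_ge0_le_integral => //.
  - by apply: measurableT_comp => //; exact/measurable_EFinP.
  - apply: ae_concentrated => t St _; rewrite /= lee_fin.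
    by apply: (le_trans (hB _ St)); exact: ler_norm.
by rewrite integral_cst //= nua -EFinM ltry.
Qed.

Lemma le_Rintegral_concentrated D h1 h2 : measurable D ->
  nu.-integrable D (EFin \o h1) -> nu.-integrable D (EFin \o h2) ->
  (forall t, S t -> D t -> h1 t <= h2 t) ->
  \int[nu]_(t in D) h1 t <= \int[nu]_(t in D) h2 t.
Proof.
move=> mD i1 i2 h12; rewrite /Rintegral.
rewrite (@integral_setI_conull D S (EFin \o h1)) //; last exact: measurable_int i1.
rewrite (@integral_setI_conull D S (EFin \o h2)) //; last exact: measurable_int i2.
have mDS : measurable (D `&` S) by exact: measurableI.
apply: le_Rintegral => //; try by apply: (integrableS mD).
by move=> t [Dt St]; exact: h12.
Qed.

Lemma Rintegral_concentrated_le D h (c : R) : measurable D ->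
  nu.-integrable D (EFin \o h) -> (forall t, S t -> D t -> h t <= c) ->
  \int[nu]_(t in D) h t <= c * fine (nu D).
Proof.
move=> mD ih hc; rewrite -Rintegral_cst //; apply: le_Rintegral_concentrated => //.
by apply: (@integrable_concentrated _ _ `|c|).
Qed.

Lemma Rintegral_concentrated_ge D h (c : R) : measurable D ->
  nu.-integrable D (EFin \o h) -> (forall t, S t -> D t -> c <= h t) ->
  c * fine (nu D) <= \int[nu]_(t in D) h t.
Proof.
move=> mD ih hc; rewrite -Rintegral_cst //; apply: le_Rintegral_concentrated => //.
by apply: (@integrable_concentrated _ _ `|c|).
Qed.

End concentrated.

End integration.

(** * Potentials as decreasing limits of smoothed potentials *)

Section smoothed_potential.
Context {R : realType}.
Implicit Types (z t u : R * R) (d : R) (D : set (R * R)).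
Variables (nu : {measure set (R * R) -> \bar R}) (S : set (R * R)) (a : R).
Hypotheses (cS : compact S) (S0 : nu (~` S) = 0%E) (nua : nu setT = a%:E).

(** Integrating over [D] covers the restrictions of [nu] without introducing new measures. The value
    is real since [lk d z] is bounded on compact sets, which keeps the estimates within real
    arithmetic. *)
Definition Upot (nu : {measure set (R * R) -> \bar R}) D d z : R :=
  \int[nu]_(t in D) lk d z t.

Let mS : measurable S. Proof. exact: measurable_compact_plane. Qed.

Lemma integrable_lk D d z : measurable D -> 0 < d -> d <= 1 ->
  nu.-integrable D (EFin \o lk d z).
Proof.
move=> mD d0 d1; have [B B0 hB] := compact_bounded_plane z cS.
apply: (integrable_concentrated mS S0 nua (B := `|ln d| + ln (B + 1))) => //.
  exact: measurable_lk.
move=> t St; have h1 := lk_ge z t d0; have h2 := lk_le d0 d1 (hB _ St).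
have h3 : 0 <= ln (B + 1) by apply: ln_ge0; lra.
have h4 := ler_norm (- ln d); rewrite normrN in h4.
have h5 := normr_ge0 (ln d).
by apply/ler_normlP; split; lra.
Qed.

Lemma Upot_mono D d d' z : measurable D -> 0 < d -> d <= d' -> d' <= 1 ->
  Upot nu D d z <= Upot nu D d' z.
Proof.
move=> mD d0 dd' d'1.
apply: le_Rintegral => //; [apply: integrable_lk => //; lra|apply: integrable_lk => //; lra|].
by move=> t _; exact: lk_mono.
Qed.

Lemma Upot_ge D d z : measurable D -> 0 < d -> d <= 1 ->
  ln d * fine (nu D) <= Upot nu D d z.
Proof.
move=> mD d0 d1; apply: (Rintegral_concentrated_ge mS S0 nua) => //.
  exact: integrable_lk.
by move=> t _ _; exact: lk_ge.
Qed.

Lemma Upot_le D d z (B : R) : measurable D -> 0 < d -> d <= 1 ->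
  (forall t, S t -> cdist z t <= B) ->
  Upot nu D d z <= ln (B + 1) * fine (nu D).
Proof.
move=> mD d0 d1 hB; apply: (Rintegral_concentrated_le mS S0 nua) => //.
  exact: integrable_lk.
by move=> t St _; apply: lk_le => //; exact: hB.
Qed.

Lemma Upot_ge_far D d z (B : R) : measurable D -> 0 < d -> d <= 1 -> 0 < B ->
  (forall t, S t -> B <= cdist z t) ->
  ln B * fine (nu D) <= Upot nu D d z.
Proof.
move=> mD d0 d1 B0 hB; apply: (Rintegral_concentrated_ge mS S0 nua) => //.
  exact: integrable_lk.
by move=> t St _; apply: lk_ge_cdist => //; exact: hB.
Qed.

Lemma UpotB D d d' z u : measurable D -> 0 < d -> d <= 1 -> 0 < d' -> d' <= 1 ->
  Upot nu D d z - Upot nu D d' u = \int[nu]_(t in D) (lk d z t - lk d' u t).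
Proof.
by move=> mD d0 d1 d'0 d'1; rewrite RintegralB //; apply: integrable_lk.
Qed.

Lemma integrable_lkB D d d' z u : measurable D -> 0 < d -> d <= 1 -> 0 < d' -> d' <= 1 ->
  nu.-integrable D (EFin \o (fun t => lk d z t - lk d' u t)).
Proof.
move=> mD d0 d1 d'0 d'1.
have := integrableB mD (integrable_lk z mD d0 d1) (integrable_lk u mD d'0 d'1).
by apply: eq_integrable.
Qed.

Lemma Upot_lipschitz D d z u : measurable D -> 0 < d -> d <= 1 ->
  Upot nu D d z - Upot nu D d u <= a / d * cdist z u.
Proof.
move=> mD d0 d1; rewrite UpotB //.
apply: (@le_trans _ _ (cdist z u / d * fine (nu D))).
  apply: (Rintegral_concentrated_le mS S0 nua) => //; first exact: integrable_lkB.
  by move=> t _ _; exact: lk_lipschitz.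
have -> : a / d * cdist z u = cdist z u / d * a by ring.
apply: ler_wpM2l; first by rewrite divr_ge0 ?cdist_ge0 // ltW.
exact: (fine_measure_le nua).
Qed.

Lemma Upot_setU D D' d z : measurable D -> measurable D' -> [disjoint D & D'] ->
  0 < d -> d <= 1 -> Upot nu (D `|` D') d z = Upot nu D d z + Upot nu D' d z.
Proof.
move=> mD mD' DD' d0 d1; apply: Rintegral_setU => //.
by apply: integrable_lk => //; exact: measurableU.
Qed.

Let kdiff z t : \bar R := ((lk 1 z t)%:E - elog (cdist z t))%E.

Let kdiff_ge0 z t : (0 <= kdiff z t)%E.
Proof.
rewrite /kdiff; have := @elog_le_lk R 1 z t ltr01.
case: (elog _) => [r| |] //; last by rewrite /= leey.
by rewrite !lee_fin subr_ge0.
Qed.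

Let measurable_kdiff z : measurable_fun setT (kdiff z).
Proof.
apply: emeasurable_funB; last exact: measurable_elog_cdist.
by apply/measurable_EFinP; exact: measurable_lk.
Qed.

Let logpotE z : logpot nu z = ((Upot nu setT 1 z)%:E - \int[nu]_t kdiff z t)%E.
Proof.
rewrite -integral_EFin_sub_ge0 //; last exact: integrable_lk.
rewrite /logpot; apply: eq_integral => t _; rewrite /kdiff /elog.
by case: ifP => _ //; rewrite -!EFinB opprB addrC subrK.
Qed.

Lemma logpot_le_Upot d z : 0 < d -> d <= 1 -> (logpot nu z <= (Upot nu setT d z)%:E)%E.
Proof.
move=> d0 d1; rewrite /Upot /Rintegral fineK; last first.
  by apply: integrable_fin_num => //; exact: integrable_lk.
apply: measurable_le_integral => //.
- exact: measurable_elog_cdist.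
- by apply/measurable_EFinP; exact: measurable_lk.
- by move=> t _; exact: elog_le_lk.
Qed.

Lemma logpot_lty z : (logpot nu z < +oo)%E.
Proof. by apply: (le_lt_trans (logpot_le_Upot z ltr01 (lexx _))); exact: ltry. Qed.

Let dn n : R := n.+1%:R^-1.

Let dn_gt0 n : 0 < dn n. Proof. by rewrite invr_gt0. Qed.

Let dn_le1 n : dn n <= 1. Proof. by rewrite invf_le1 // ler1n. Qed.

(** Monotone convergence for the nonnegative functions [lk 1 z t - lk (dn n) z t], which increase to
    [kdiff z t]. Together with [logpot_le_Upot] it identifies the potential with the infimum of its
    smoothings. *)
Lemma le_logpot z (y : R) : (forall d, 0 < d -> d <= 1 -> y <= Upot nu setT d z) ->
  (y%:E <= logpot nu z)%E.
Proof.
move=> hy.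
pose g n t := (lk 1 z t - lk (dn n) z t)%:E.
have g0 n t : (0 <= g n t)%E by rewrite lee_fin subr_ge0 lk_mono.
have mg n : measurable_fun setT (g n).
  by apply/measurable_EFinP; apply: measurable_funB; exact: measurable_lk.
have ndg t : {homo g ^~ t : n m / (n <= m)%N >-> (n <= m)%E}.
  move=> n m nm; rewrite lee_fin lerB // lk_mono // lef_pV2 ?posrE // ler_nat.
  by rewrite ltnS.
have limg t : limn (g ^~ t) = kdiff z t.
  have -> : limn (g ^~ t) = ereal_sup (range (g ^~ t)).
    by apply/cvg_lim => //; apply: ereal_nondecreasing_cvgn; exact: ndg.
  apply/eqP; rewrite eq_le; apply/andP; split.
    apply: ge_ereal_sup => _ [n _ <-]; rewrite /g /kdiff.
    have := @elog_le_lk R (dn n) z t (dn_gt0 n).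
    case: (elog _) => [r| |] //; last by rewrite /= leey.
    by rewrite !lee_fin => ?; rewrite lerB.
  apply/lee_subgt0Pr => e e0.
  have key (x : R) : (elog (cdist z t) < x%:E)%E -> ((lk 1 z t - x)%:E <= ereal_sup (range (g ^~ t)))%E.
    move=> /lk_lt_elog[r /andP[r0 r1] hr].
    have [n] := ltr_add_invr r0; rewrite add0r => /ltW nr.
    apply: (@le_trans _ _ (g n t)); last by apply: ereal_sup_ubound; exists n.
    by rewrite lee_fin lerB // ltW // hr.
  have : forall x : R, (elog (cdist z t) < x%:E)%E -> (kdiff z t - e%:E <= (lk 1 z t - x)%:E)%E ->
     (kdiff z t - e%:E <= ereal_sup (range (g ^~ t)))%E.
    by move=> x /key h1 h2; exact: le_trans h1.
  case E : (elog (cdist z t)) key => [r| |] key h.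
  - apply: (h (r + e)); first by rewrite lte_fin ltrDl.
    by rewrite /kdiff E -!EFinB lee_fin; lra.
  - by have := @elog_le_lk R 1 z t ltr01; rewrite E.
  (* Here t = z: every real level is allowed, so the supremum is infinite, as [kdiff] is. *)
  - suff -> : ereal_sup (range (g ^~ t)) = +oo%E by rewrite leey.
    apply/eqyP => x x0.
    by have := key (lk 1 z t - x) (ltNyr _); rewrite opprB addrC subrK.
have cvg := @cvg_monotone_convergence _ _ _ nu setT measurableT g mg (fun n t _ => g0 n t) (fun t _ => ndg t).
have intg n : (\int[nu]_t g n t)%E = (Upot nu setT 1 z - Upot nu setT (dn n) z)%:E.
  rewrite UpotB // /Rintegral fineK //.
  by apply: integrable_fin_num => //; exact: integrable_lkB.
have : (\int[nu]_t kdiff z t <= (Upot nu setT 1 z - y)%:E)%E.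
  have -> : (\int[nu]_t kdiff z t = \int[nu]_t (fun t => limn (g ^~ t)) t)%E.
    by apply: eq_integral => t _; rewrite limg.
  apply: (cvge_le _ cvg).
  by apply: nearW => n; rewrite intg lee_fin lerB // hy.
rewrite logpotE.
have : (0 <= \int[nu]_t kdiff z t)%E by apply: integral_ge0 => t _.
case: (integral _ _ _) => [r| |] //.
by rewrite -EFinB !lee_fin => _; lra.
Qed.

End smoothed_potential.

(** * The domination principle *)

Section fourpt_potential.
Context {R : realType}.
Implicit Types (z t u : R * R) (d s : R) (D : set (R * R)).
Variables (nu : {measure set (R * R) -> \bar R}) (S : set (R * R)) (a : R).
Hypotheses (cS : compact S) (S0 : nu (~` S) = 0%E) (nua : nu setT = a%:E).

Let mS : measurable S. Proof. exact: measurable_compact_plane. Qed.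

Lemma integrable_fourpt_lk D d s z : measurable D -> 0 < d -> d <= 1 ->
  nu.-integrable D (EFin \o (fun t => fourpt s (lk d ^~ t) z)).
Proof.
move=> mD d0 d1.
have i1 := integrable_lk cS S0 nua (z.1 + s, z.2) mD d0 d1.
have i2 := integrable_lk cS S0 nua (z.1 - s, z.2) mD d0 d1.
have i3 := integrable_lk cS S0 nua (z.1, z.2 + s) mD d0 d1.
have i4 := integrable_lk cS S0 nua (z.1, z.2 - s) mD d0 d1.
exact: (integrableD mD (integrableD mD (integrableD mD i1 i2) i3) i4).
Qed.

Lemma fourpt_Upot D d s z : measurable D -> 0 < d -> d <= 1 ->
  fourpt s (Upot nu D d) z = \int[nu]_(t in D) fourpt s (lk d ^~ t) z.
Proof.
move=> mD d0 d1.
have i1 := integrable_lk cS S0 nua (z.1 + s, z.2) mD d0 d1.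
have i2 := integrable_lk cS S0 nua (z.1 - s, z.2) mD d0 d1.
have i3 := integrable_lk cS S0 nua (z.1, z.2 + s) mD d0 d1.
have i4 := integrable_lk cS S0 nua (z.1, z.2 - s) mD d0 d1.
have i12 := integrableD mD i1 i2; have i123 := integrableD mD i12 i3.
by rewrite /fourpt !RintegralD.
Qed.

Lemma fourpt_Upot_ge d s z (B : R) : 0 < d -> d <= 1 -> 0 < s -> s <= d -> 0 < B ->
  (forall t, S t -> sqd z t + d ^+ 2 <= B) ->
  4 * Upot nu setT d z + ln (1 + 2 * s ^+ 2 * d ^+ 2 / B ^+ 2) / 2 * a
    <= fourpt s (Upot nu setT d) z.
Proof.
move=> d0 d1 s0 sd B0 hB; rewrite fourpt_Upot //.
have i1 := integrable_lk cS S0 nua z measurableT d0 d1.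
set q := ln _ / 2.
have i2 : nu.-integrable setT (EFin \o (fun=> q)).
  by apply: (integrable_concentrated mS S0 nua (B := `|q|)).
have -> : 4 * Upot nu setT d z + q * a = \int[nu]_t (4 * lk d z t + q).
  rewrite RintegralD //.
    by rewrite RintegralZl // Rintegral_cst // nua.
  exact: (integrableZl measurableT 4 i1).
apply: (le_Rintegral_concentrated mS S0) => //.
- exact: (integrableD measurableT (integrableZl measurableT 4 i1) i2).
- exact: integrable_fourpt_lk.
- by move=> t St _; apply: fourpt_lk_ge => //; exact: hB.
Qed.

Lemma fourpt_Upot_le D d s z (r : R) : measurable D -> 0 < d -> d <= 1 -> 0 < s -> s <= r ->
  (forall t, D t -> r <= cdist z t) ->
  fourpt s (Upot nu D d) z <=
  4 * Upot nu D d z + (16 * s ^+ 2 * d ^+ 2 + 5 * s ^+ 4) / r ^+ 4 / 2 * fine (nu D).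
Proof.
move=> mD d0 d1 s0 sr hr; rewrite fourpt_Upot //.
have i1 := integrable_lk cS S0 nua z mD d0 d1.
set q := _ / r ^+ 4 / 2.
have i2 : nu.-integrable D (EFin \o (fun=> q)).
  by apply: (integrable_concentrated mS S0 nua (B := `|q|)).
have -> : 4 * Upot nu D d z + q * fine (nu D) = \int[nu]_(t in D) (4 * lk d z t + q).
  rewrite RintegralD //.
    by rewrite RintegralZl // Rintegral_cst.
  exact: (integrableZl mD 4 i1).
apply: (le_Rintegral_concentrated mS S0) => //.
- exact: integrable_fourpt_lk.
- exact: (integrableD mD (integrableZl mD 4 i1) i2).
- by move=> t _ Dt; apply: fourpt_lk_le => //; exact: hr.
Qed.

End fourpt_potential.

(** The inequality ln (1 + y) <= y at y = - x / (1 + x). *)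
Lemma ln1D_ge_half {R : realType} (x : R) : 0 <= x -> x <= 1 -> x / 2 <= ln (1 + x).
Proof.
move=> x0 x1; have p : 0 < 1 + x by lra.
rewrite -[1 + x]invrK lnV ?posrE ?invr_gt0 //.
have -> : (1 + x)^-1 = 1 + (- (x / (1 + x))) by field; rewrite gt_eqF.
have h2 : x / (1 + x) < 1 by rewrite ltr_pdivrMr //; lra.
have h : ln (1 + - (x / (1 + x))) <= - (x / (1 + x)) by apply: le_ln1Dx; lra.
have : x / 2 <= x / (1 + x) by apply: ler_wpM2l => //; rewrite lef_pV2 ?posrE; lra.
lra.
Qed.

(** * A maximum principle for differences of smoothed potentials *)

Section maximum_principle.
Context {R : realType}.
Implicit Types (z t u : R * R) (d s : R) (D : set (R * R)).
Variables (mu nu : {measure set (R * R) -> \bar R}) (S A : set (R * R)).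
Variables (R0 d1 tau d0 G : R).
Hypotheses (cS : compact S) (muS : mu (~` S) = 0%E) (mu1 : mu setT = 1%E).
Hypotheses (nuS : nu (~` S) = 0%E) (nu1 : nu setT = 1%E).
Hypotheses (SR0 : forall t, S t -> cdist (0, 0) t <= R0) (R01 : 1 <= R0).
Hypotheses (mA : measurable A) (AS : A `<=` S) (muA : 0 < fine (mu A)).
Hypotheses (d10 : 0 < d1) (d11 : d1 <= 1) (tau0 : 0 < tau) (tau1 : tau < 1) (d00 : 0 < d0).

(** The two masses are 1 - tau and 1. The deficit makes [h] tend to -oo at infinity like - tau ln
    |z|, so a large value of [h] can only occur in a bounded region. *)
Let h d2 z : R := (1 - tau) * Upot nu setT d1 z - (fine (mu A))^-1 * Upot mu A d2 z.

Hypothesis near_le : forall d2, 0 < d2 -> d2 <= d1 / 2 ->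
  forall z a, A a -> cdist z a <= d0 -> h d2 z <= G.

Let mA1 : fine (mu A) <= 1.
Proof. exact: (fine_measure_le mu1). Qed.

(** For |z| = r > 2 R0 + 1 the carrier lies at distance between r / 2 and 2 r - 1 from z, whence h
    <= 2 ln 2 - tau ln r; the second entry brings this below [G]. *)
Let R1 : R := Num.max (2 * R0 + 1) (expR ((2 * ln 2 - G) / tau)).

Let h_far d2 z : 0 < d2 -> d2 <= 1 -> R1 < cdist (0, 0) z -> h d2 z <= G.
Proof.
move: R01 d10 d11 tau0 tau1 d00 muA => R01' d10' d11' tau0' tau1' d00' muA'.
move=> d20 d21; rewrite gt_max => /andP[rR rG]; set r := cdist (0, 0) z in rR rG *.
have r0 : 0 < r by lra.
have lnr : (2 * ln 2 - G) / tau <= ln r.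
  by rewrite -(expRK (_ / _)) ler_ln ?posrE ?expR_gt0 // ltW.
rewrite ler_pdivrMr // in lnr.
have l2 : 0 <= ln (2 : R) by apply: ln_ge0; lra.
have h1 : Upot nu setT d1 z <= ln 2 + ln r.
  rewrite -lnM ?posrE //.
  apply: (@le_trans _ _ (ln ((r + R0) + 1))).
    have := Upot_le cS nuS nu1 (z := z) (B := r + R0) measurableT d10 d11.
    rewrite nu1 mulr1; apply => t St.
    have := cdist_triangle z (0, 0) t; rewrite (cdistC z (0, 0)) -/r.
    by have := SR0 St; lra.
  rewrite ler_ln ?posrE; lra.
have h2 : (ln r - ln 2) * fine (mu A) <= Upot mu A d2 z.
  rewrite -ln_div ?posrE //; apply: (Upot_ge_far cS muS mu1) => //.
    by rewrite divr_gt0.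
  move=> t St; have := cdist_triangle (0, 0) t z; rewrite (cdistC t z) -/r.
  by have := SR0 St; lra.
have h3 : ln r - ln 2 <= (fine (mu A))^-1 * Upot mu A d2 z.
  by rewrite mulrC ler_pdivlMr.
have h4 : (1 - tau) * Upot nu setT d1 z <= (1 - tau) * (ln 2 + ln r).
  by apply: ler_wpM2l => //; lra.
have h5 : 0 <= tau * ln 2 by rewrite mulr_ge0 // ltW.
rewrite /h; lra.
Qed.

(* The four-point mean of the smoothed potential of [nu] exceeds its centre value by a
   positive amount, uniformly on bounded sets, while away from [A] the potential of
   [mu] restricted to [A] is harmonic up to a much smaller error: an almost maximal
   point of [h] must lie close to [A]. *)
Lemma Upot_maximum_principle : exists2 e : R, 0 < e <= 1 &
  forall d2 z, 0 < d2 -> d2 <= e -> h d2 z <= G.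
Proof.
move: R01 d10 d11 tau0 tau1 d00 muA => R01' d10' d11' tau0' tau1' d00' muA'.
have R10 : 0 < R1 by rewrite lt_max; apply/orP; left; lra.
(* An upper bound for [sqd z t + d1 ^+ 2] when |z| <= R1 and t is in S; the gain of the four-point
   sum is then at least [g * s ^+ 2 / 2]. *)
pose B := (R1 + R0) ^+ 2 + 1.
have B2 : 2 <= B.
  rewrite /B; have : 1 <= R1 + R0 by lra.
  by move: (R1 + R0) => w w1; nra.
have B0 : 0 < B by lra.
pose g := (1 - tau) * d1 ^+ 2 / B ^+ 2.
have g0 : 0 < g by rewrite divr_gt0 ?mulr_gt0 ?exprn_gt0 //; lra.
(* If s^2 and d2^2 are at most q, the error of the near-harmonic term is at most 21 / 128 of
   [g * s ^+ 2], below the quarter allowed for it. *)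
pose q := g * d0 ^+ 4 / 64.
have q0 : 0 < q by apply: divr_gt0 => //; apply: mulr_gt0 => //; exact: exprn_gt0.
have small_sqr (x : R) : 0 < x -> x <= Num.min 1 q -> x ^+ 2 <= q.
  move=> x0; rewrite le_min => /andP[x1 xq].
  by rewrite expr2; apply: (le_trans _ xq); rewrite ler_piMl // ltW.
pose e := Num.min (d1 / 2) (Num.min 1 q).
have e0 : 0 < e by rewrite !lt_min divr_gt0 // ltr01 q0.
exists e.
  by rewrite e0 /= !ge_min; apply/orP; left; lra.
move=> d2 z1 d20; rewrite le_min => /andP[d2d1 d2q].
have d21 : d2 <= 1 by lra.
rewrite leNgt; apply/negP => hz1.
pose H := sup (range (h d2)).
have hub : has_ubound (range (h d2)).
  exists (Num.max G ((1 - tau) * ln ((R1 + R0) + 1) - ln d2)).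
  move=> _ [z _ <-]; rewrite le_max.
  have [rz|rz] := ltP R1 (cdist (0, 0) z); first by rewrite h_far.
  apply/orP; right; apply: lerB.
    apply: ler_wpM2l; first lra.
    have := Upot_le cS nuS nu1 (z := z) (B := R1 + R0) measurableT d10 d11.
    rewrite nu1 mulr1; apply => t St.
    have := cdist_triangle z (0, 0) t; rewrite (cdistC z (0, 0)).
    by have := SR0 St; lra.
  by rewrite mulrC ler_pdivlMr //; apply: (Upot_ge cS muS mu1).
have hle z : h d2 z <= H by apply: ub_le_sup => //; exists z.
pose s := Num.min d0 (Num.min d1 (Num.min 1 q)).
have s0 : 0 < s by rewrite !lt_min d00 d10 ltr01.
have [sd0 sd1 sq] : [/\ s <= d0, s <= d1 & s ^+ 2 <= q].
  split; [by rewrite ge_min lexx|by rewrite /s !ge_min lexx orbT|].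
  by apply: small_sqr => //; rewrite /s ge_min; apply/orP; right; rewrite ge_min lexx orbT.
(* The supremum need not be attained; a point within [th] of it suffices, since 4 th is only a
   sixteenth of [g * s ^+ 2] while a net gain of a quarter remains. *)
pose th := g * s ^+ 2 / 64.
have th0 : 0 < th by apply: divr_gt0 => //; apply: mulr_gt0 => //; exact: exprn_gt0.
have [z0 z0G z0H] : exists2 z0, G < h d2 z0 & H - th < h d2 z0.
  have [zz1|zz1] := leP (h d2 z1) (H - th); last by exists z1.
  have : has_sup (range (h d2)) by split => //; exists (h d2 z1); exists z1.
  move=> /(sup_adherent th0)[_ [z0 _ <-] hz0]; exists z0 => //.
  by apply: lt_trans hz1 _; exact: le_lt_trans hz0.
have z0R : cdist (0, 0) z0 <= R1.
  by rewrite leNgt; apply/negP => /(h_far d20 d21); rewrite leNgt z0G.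
have z0A t : A t -> d0 <= cdist z0 t.
  move=> At; rewrite leNgt; apply/negP => /ltW /(near_le d20 d2d1 At).
  by rewrite leNgt z0G.
have fle : fourpt s (h d2) z0 <= 4 * H.
  rewrite /fourpt; have := hle (z0.1 + s, z0.2); have := hle (z0.1 - s, z0.2).
  have := hle (z0.1, z0.2 + s); have := hle (z0.1, z0.2 - s); lra.
have fE : fourpt s (h d2) z0 = (1 - tau) * fourpt s (Upot nu setT d1) z0
   - (fine (mu A))^-1 * fourpt s (Upot mu A d2) z0.
  by rewrite /fourpt /h; ring.
have F1 := fourpt_Upot_ge cS nuS nu1 (z := z0) d10 d11 s0 sd1 B0.
have {}F1 := F1 _; rewrite mulr1 in F1.
have {}F1 : 4 * Upot nu setT d1 z0 + ln (1 + 2 * s ^+ 2 * d1 ^+ 2 / B ^+ 2) / 2 <=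
   fourpt s (Upot nu setT d1) z0.
  apply: F1 => t St; rewrite /B lerD //; last by rewrite -(expr1n _ 2) ler_sqr ?nnegrE // ltW.
  rewrite -cdist_sqr ler_sqr ?nnegrE ?cdist_ge0 //; last lra.
  have := cdist_triangle z0 (0, 0) t; rewrite (cdistC z0 (0, 0)).
  by have := SR0 St; lra.
have F2 := fourpt_Upot_le cS muS mu1 mA d20 d21 s0 sd0 z0A.
set x := 2 * s ^+ 2 * d1 ^+ 2 / B ^+ 2 in F1.
have x0 : 0 <= x by apply: divr_ge0; nneg.
have x1 : x <= 1.
  rewrite /x ler_pdivrMr ?exprn_gt0 // mul1r.
  have : s ^+ 2 <= 1 by rewrite -(expr1n _ 2) ler_sqr ?nnegrE //; lra.
  have : d1 ^+ 2 <= 1 by rewrite -(expr1n _ 2) ler_sqr ?nnegrE //; lra.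
  have := sqr_ge0 s; have := sqr_ge0 d1; nra.
have lnx := ln1D_ge_half x0 x1.
have F3 : (1 - tau) * (4 * Upot nu setT d1 z0) + g * s ^+ 2 / 2 <= (1 - tau) * fourpt s (Upot nu setT d1) z0.
  have -> : g * s ^+ 2 / 2 = (1 - tau) * (x / 4) by rewrite /g /x; field; rewrite gt_eqF.
  rewrite -mulrDr; apply: ler_wpM2l; lra.
set y := (16 * s ^+ 2 * d2 ^+ 2 + 5 * s ^+ 4) / d0 ^+ 4 / 2 in F2.
have F4 : (fine (mu A))^-1 * fourpt s (Upot mu A d2) z0 <=
    4 * ((fine (mu A))^-1 * Upot mu A d2 z0) + y.
  have -> : 4 * ((fine (mu A))^-1 * Upot mu A d2 z0) + y =
     (fine (mu A))^-1 * (4 * Upot mu A d2 z0 + y * fine (mu A)).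
    by field; rewrite gt_eqF.
  by apply: ler_wpM2l => //; rewrite invr_ge0 ltW.
have F5 : y <= g * s ^+ 2 / 4.
  have d2s : d2 ^+ 2 <= q by exact: small_sqr.
  have s2 := sqr_ge0 s.
  rewrite /y ler_pdivrMr // ler_pdivrMr ?exprn_gt0 //.
  have qE : g * d0 ^+ 4 = 64 * q by rewrite /q; field.
  have -> : g * s ^+ 2 / 4 * 2 * d0 ^+ 4 = s ^+ 2 / 2 * (64 * q) by rewrite -qE; field.
  have -> : s ^+ 4 = s ^+ 2 * s ^+ 2 by rewrite -exprD.
  nra.
have F6 : 4 * th <= g * s ^+ 2 / 16 by rewrite /th; lra.
have F7 : 0 < g * s ^+ 2 by apply: mulr_gt0 => //; exact: exprn_gt0.
have : 4 * h d2 z0 + g * s ^+ 2 / 4 <= 4 * H.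
  apply: (le_trans _ fle); rewrite fE /h; lra.
lra.
Qed.

End maximum_principle.

Section domination.
Context {R : realType}.
Implicit Types (z t u : R * R) (d s : R) (D : set (R * R)).

Lemma closed_lipschitz_le (f g : R * R -> R) (Lf Lg : R) :
  (forall z t, f z - f t <= Lf * cdist z t) -> (forall z t, g z - g t <= Lg * cdist z t) ->
  closed [set z | f z <= g z].
Proof.
move=> hf hg; apply/closed_cdistP => z hz; apply/ler_addgt0Pr => e e0.
pose L := `|Lf| + `|Lg| + 1.
have L0 : 0 < L by rewrite /L; have := normr_ge0 Lf; have := normr_ge0 Lg; lra.
have [t /= ft tz] := hz (e / L) (divr_gt0 e0 L0).
rewrite ltr_pdivlMr // in tz.
have h1 := hf z t; have h2 := hg t z; rewrite cdistC in h1.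
have c0 := cdist_ge0 t z.
have h3 : Lf * cdist t z <= `|Lf| * cdist t z by rewrite ler_wpM2r // ler_norm.
have h4 : Lg * cdist t z <= `|Lg| * cdist t z by rewrite ler_wpM2r // ler_norm.
by rewrite /L in tz; lra.
Qed.

Variables (mu nu : {measure set (R * R) -> \bar R}) (S T : set (R * R)).
Hypotheses (cS : compact S) (muS : mu (~` S) = 0%E) (mu1 : mu setT = 1%E).
Hypotheses (cT : compact T) (nuT : nu (~` T) = 0%E) (nu1 : nu setT = 1%E).

Let mS : measurable S. Proof. exact: measurable_compact_plane. Qed.

(** A scale whose value is within [e] of the infimum; shrinking the scale further then loses at most
    [e]. *)
Lemma Upot_near_inf z (C : R) : (forall d, 0 < d -> d <= 1 -> C <= Upot mu setT d z) ->
  forall e : R, 0 < e -> exists2 d' : R, 0 < d' <= 1 &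
  forall d, 0 < d -> d <= 1 -> Upot mu setT d' z <= Upot mu setT d z + e.
Proof.
move=> hC e e0; pose V := [set Upot mu setT d z | d in [set d | 0 < d <= 1]].
have iV : has_inf V.
  split; first by exists (Upot mu setT 1 z); exists 1 => //=; rewrite ltr01 lexx.
  by exists C => _ [d /andP[d0 d1] <-]; exact: hC.
have [_ [d' /= hd' <-] h] := inf_adherent e0 iV; exists d' => // d d0 d1.
apply: (le_trans (ltW h)); rewrite lerD2r; apply: ge_inf; first exact: iV.2.
by exists d => //=; rewrite d0 d1.
Qed.

Lemma concentrated_setU : mu (~` (S `|` T)) = 0%E /\ nu (~` (S `|` T)) = 0%E.
Proof.
have mT : measurable T by exact: measurable_compact_plane.
have mC : measurable (~` (S `|` T)) by apply: measurableC; exact: measurableU.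
split; apply/eqP; rewrite eq_le measure_ge0 andbT.
  rewrite -muS; apply: le_measure; rewrite ?inE //; first exact: measurableC.
  by apply: subsetC; exact: subsetUl.
rewrite -nuT; apply: le_measure; rewrite ?inE //; first exact: measurableC.
by apply: subsetC; exact: subsetUr.
Qed.

Lemma logpot_off_support z : ~ S z -> exists C : R,
  forall d, 0 < d -> d <= 1 -> C <= Upot mu setT d z.
Proof.
move=> nSz.
have : exists2 r : R, 0 < r & forall t, S t -> r <= cdist z t.
  apply: contrapT => h; apply: nSz.
  have /closed_cdistP := compact_closed_plane cS; apply => e e0.
  apply: contrapT => h'; apply: h; exists e => // t St.
  by rewrite leNgt; apply/negP => zt; apply: h'; exists t => //; rewrite cdistC.
move=> [r r0 hr]; exists (ln r) => d d0 d1.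
by have := Upot_ge_far cS muS mu1 measurableT d0 d1 r0 hr; rewrite mu1 mulr1.
Qed.

End domination.

(* On the closed sets [G n] the smoothed potentials of [mu] are uniformly close to their limit
   and the hypothesis holds up to [e] after smoothing.  As [mu (G n)] tends to 1, the maximum
   principle applies to the potential of [nu] minus that of [mu] restricted to [G n]. *)
Theorem domination_principle {R : realType} (mu nu : {measure set (R * R) -> \bar R})
    (S T : set (R * R)) (c C0 : R) :
  compact S -> mu (~` S) = 0%E -> mu setT = 1%E ->
  compact T -> nu (~` T) = 0%E -> nu setT = 1%E ->
  (forall z, S z -> ((- C0)%:E <= logpot mu z)%E) ->
  (forall z, S z -> (logpot nu z <= logpot mu z + c%:E)%E) ->
  forall z, (logpot nu z <= logpot mu z + c%:E)%E.
Proof.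
move=> cS muS mu1 cT nuT nu1 hC0 hc zs; have mS := measurable_compact_plane cS.
have UC0 z d : S z -> 0 < d -> d <= 1 -> - C0 <= Upot mu setT d z.
  move=> Sz d0 d1; rewrite -lee_fin; apply: (le_trans (hC0 _ Sz)).
  exact: (logpot_le_Upot cS muS mu1).
have [C1 hC1] : exists C1 : R, forall d, 0 < d -> d <= 1 -> C1 <= Upot mu setT d zs.
  have [Sz|nSz] := pselect (S zs); last exact: (logpot_off_support cS muS mu1).
  by exists (- C0) => d; exact: UC0.
suff key (e : R) : 0 < e -> (logpot nu zs <= logpot mu zs + c%:E + (10 * e)%:E)%E.
  apply/lee_addgt0Pr => e e0.
  have := key (e / 10) (divr_gt0 e0 (ltr0Sn _ 9)).
  by have -> : 10 * (e / 10) = e by field.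
move=> e0.
have [dz /andP[dz0 dz1] hdz] := Upot_near_inf hC1 e0.
have cST : compact (S `|` T) by exact: compactU.
have [muST nuST] := concentrated_setU cS muS cT nuT.
have [R0' R0'0 hR0'] := compact_bounded_plane (0, 0) cST.
pose R0 := R0' + 1; have R01 : 1 <= R0 by rewrite /R0; lra.
have hR0 t : (S `|` T) t -> cdist (0, 0) t <= R0 by move=> /hR0'; rewrite /R0; lra.
pose L := ln (2 * R0 + 1); have L0 : 0 <= L by apply: ln_ge0; lra.
pose rz := cdist (0, 0) zs; have rz0 : 0 <= rz by exact: cdist_ge0.
pose L' := ln (rz + R0 + 1); have L'0 : 0 <= L' by apply: ln_ge0; lra.
(* Collects all quantities that will be multiplied by [eta], the bound for the mass of [mu] outside
   [A], so that their total effect is at most e; the summand 2 e gives eta <= 1 / 2. *)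
pose Q := 3 * L + 2 * `|C0| + `|ln dz| + 2 * L' + 2 * e.
have nC0 := normr_ge0 C0; have nlz := normr_ge0 (ln dz).
have Q0 : 2 * e <= Q by rewrite /Q; lra.
pose eta := e / Q.
have Qp : 0 < Q by lra.
have eta0 : 0 < eta by rewrite divr_gt0.
have etaQ : eta * Q = e by rewrite divfK // gt_eqF.
have eta2 : eta <= 1 / 2 by rewrite ler_pdivrMr //; lra.
pose dn n : R := n.+1%:R^-1.
have dn0 n : 0 < dn n by rewrite invr_gt0.
have dn1 n : dn n <= 1 by rewrite invf_le1 // ler1n.
(* All scales d are imposed at once: each condition is closed because smoothed potentials are
   Lipschitz, so the uncountable intersection is closed, hence measurable. *)
pose G n := S `&` \bigcap_(d in [set d : R | 0 < d <= 1])
  ([set z | Upot nu setT (dn n) z - c - e <= Upot mu setT d z] `&`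
   [set z | Upot mu setT (dn n) z - e <= Upot mu setT d z]).
have cG n : closed (G n).
  apply: closedI; first exact: compact_closed_plane.
  apply: closed_bigI => d /= /andP[d0 d1]; apply: closedI.
    apply: (closed_lipschitz_le (Lf := 1 / dn n) (Lg := 1 / d)).
    - move=> z t; have := Upot_lipschitz cT nuT nu1 z t measurableT (dn0 n) (dn1 n); lra.
    - move=> z t; exact: (Upot_lipschitz cS muS mu1).
  apply: (closed_lipschitz_le (Lf := 1 / dn n) (Lg := 1 / d)).
  - move=> z t; have := Upot_lipschitz cS muS mu1 z t measurableT (dn0 n) (dn1 n); lra.
  - move=> z t; exact: (Upot_lipschitz cS muS mu1).
have mG n : measurable (G n) by exact: measurable_closed_plane.
have GS : \bigcup_n G n = S.
  apply/seteqP; split; first by move=> z [n _ []].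
  move=> z Sz.
  have [d1 /andP[d10 d11] hd1] := Upot_near_inf (fun d => @UC0 z d Sz) e0.
  have [d2 /andP[d20 d21] hd2] : exists2 d2 : R, 0 < d2 <= 1 & forall d, 0 < d -> d <= 1 ->
      Upot nu setT d2 z - c - e <= Upot mu setT d z.
    pose e2 := e / 2; have e20 : 0 < e2 by rewrite divr_gt0.
    have [d3 /andP[d30 d31] hd3] := Upot_near_inf (fun d => @UC0 z d Sz) e20.
    apply: contrapT => nex.
    have : ((Upot mu setT d3 z + c + e2)%:E <= logpot nu z)%E.
      apply: (le_logpot cT nuT nu1) => d d0 d1'.
      rewrite leNgt; apply/negP => lt; apply: nex; exists d; first by rewrite d0 d1'.
      by move=> d' d'0 d'1; have := hd3 _ d'0 d'1; rewrite /e2 in lt *; lra.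
    move=> h; have := le_trans h (hc _ Sz).
    have : (logpot mu z <= (Upot mu setT d3 z)%:E)%E by exact: (logpot_le_Upot cS muS mu1).
    have := hC0 _ Sz; case: (logpot mu z) => [r| |] //.
    by rewrite -EFinD !lee_fin; lra.
  have [n1] := ltr_add_invr d10; rewrite add0r => /ltW hn1.
  have [n2] := ltr_add_invr d20; rewrite add0r => /ltW hn2.
  exists (maxn n1 n2) => //; split => // d /= /andP[d0 d1']; split => /=.
    have : Upot nu setT (dn (maxn n1 n2)) z <= Upot nu setT d2 z.
      apply: (Upot_mono cT nuT nu1) => //; apply: le_trans hn2.
      by rewrite lef_pV2 ?posrE // ler_nat ltnS leq_maxr.
    by have := hd2 _ d0 d1'; lra.
  have : Upot mu setT (dn (maxn n1 n2)) z <= Upot mu setT d1 z.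
    apply: (Upot_mono cS muS mu1) => //; apply: le_trans hn1.
    by rewrite lef_pV2 ?posrE // ler_nat ltnS leq_maxl.
  by have := hd1 _ d0 d1'; lra.
have muSE : mu S = 1%E.
  have : mu (S `|` ~` S) = (mu S + mu (~` S))%E.
    by apply: measureU => //; [exact: measurableC|exact: setICr].
  by rewrite setUv mu1 muS adde0.
have [n hn] : exists n, ((1 - eta)%:E <= mu (G n))%E.
  have ndG : nondecreasing_seq G.
    move=> n m nm; apply/subsetPset => z [Sz hz]; split => // d hd.
    have [/= h1 h2] := hz d hd.
    have dnm : dn m <= dn n by rewrite lef_pV2 ?posrE // ler_nat ltnS.
    split => /=.
      by have := Upot_mono cT nuT nu1 z measurableT (dn0 m) dnm (dn1 n); lra.
    by have := Upot_mono cS muS mu1 z measurableT (dn0 m) dnm (dn1 n); lra.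
  have cvg : mu (G n) @[n --> \oo] --> mu (\bigcup_n G n).
    by apply: nondecreasing_cvg_mu => //; exact: bigcup_measurable.
  apply: contrapT => nex; have : (mu S <= (1 - eta)%:E)%E.
    rewrite -GS; apply: (cvge_le _ cvg).
    apply: nearW => n; rewrite leNgt; apply/negP => lt; apply: nex; exists n.
    exact: ltW.
  by rewrite muSE lee_fin; lra.
pose A := G n; pose d1 := dn n.
have [d10 d11] : 0 < d1 /\ d1 <= 1 by split; [exact: dn0|exact: dn1].
have AS : A `<=` S by move=> z [].
have mA : measurable A by exact: mG.
have cA : compact A by apply: (subclosed_compact _ cS AS); exact: cG.
pose mA' := fine (mu A).
have muAE : mu A = mA'%:E by rewrite fineK // (measure_fin mu1).
have mA1 : mA' <= 1 by exact: (fine_measure_le mu1).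
have mAe : 1 - eta <= mA' by rewrite -lee_fin -muAE.
have mA0 : 0 < mA' by lra.
have muCA : fine (mu (~` A)) = 1 - mA'.
  have : mu setT = (mu A + mu (~` A))%E.
    rewrite -(setUv A).
    by apply: measureU => //; [exact: measurableC|exact: setICr].
  rewrite mu1 muAE -(fineK (measure_fin mu1 (measurableC mA))) -EFinD => -[]; lra.
have A0 : A !=set0.
  apply/set0P/negP => /eqP A0; move: mA0; rewrite /mA' A0 measure0 /= ltxx //.
have USplit d z : 0 < d -> d <= 1 ->
    Upot mu setT d z = Upot mu A d z + Upot mu (~` A) d z.
  move=> d0 d1'; rewrite -(setUv A) (Upot_setU cS muS mu1) //; first exact: measurableC.
  by apply/disj_setPS => t [].
have kap : (mA'^-1 - 1) <= 2 * eta.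
  rewrite lerBlDr -[mA'^-1]mul1r ler_pdivrMr //; clear -mAe mA1 eta2 eta0 mA0; nra.
have kap0 : 1 <= mA'^-1 by rewrite invf_ge1.
(* On [A], restricting [mu] to [A] and dividing by the mass lowers the potential by at most e: the
   part left out contributes at most L eta, and the restricted potential is at least - (|C0| +
   L). *)
have onA z d2 : A z -> 0 < d2 -> d2 <= 1 ->
    Upot mu setT d2 z - e <= mA'^-1 * Upot mu A d2 z.
  move=> Az d20 d21; have Sz := AS _ Az.
  have W : Upot mu (~` A) d2 z <= L * (1 - mA').
    rewrite -muCA; apply: (Upot_le cS muS mu1) => //; first exact: measurableC.
    move=> t St; have := cdist_triangle z (0, 0) t; rewrite (cdistC z (0, 0)).
    have := hR0 _ (or_introl Sz : (S `|` T) z); have := hR0 _ (or_introl St : (S `|` T) t); clear; lra.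
  have := USplit _ z d20 d21; have := UC0 _ _ Sz d20 d21.
  set V := Upot mu A d2 z; set U := Upot mu setT d2 z => h1 h2.
  have V1 : - (`|C0| + L) <= V.
    have := ler_norm C0; have : L * (1 - mA') <= L by clear -L0 mA0; nra.
    clear -h1 h2 W; lra.
  have h3 : (mA'^-1 - 1) * - (`|C0| + L) <= (mA'^-1 - 1) * V by clear -V1 kap0; apply: ler_wpM2l => //; lra.
  have h4 : (mA'^-1 - 1) * (`|C0| + L) <= 2 * eta * (`|C0| + L) by clear -kap nC0 L0; apply: ler_wpM2r => //; lra.
  have h5 : L * (1 - mA') <= L * eta by clear -L0 mAe; apply: ler_wpM2l => //; lra.
  have h6 : eta * (3 * L + 2 * `|C0|) <= e.
    rewrite -etaQ; apply: ler_wpM2l; first exact: ltW.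
    by rewrite /Q; clear -nlz L'0 e0; lra.
  clear -h1 h2 W h3 h4 h5 h6; lra.
(* Small enough that the factor 1 - tau costs at most e both near [A], where the potential of [nu]
   is at least ln d1, and at the point [zs]. *)
pose tau := e / (`|ln d1| + `|Upot nu setT d1 zs| + 1 + e).
have nl1 := normr_ge0 (ln d1); have nU := normr_ge0 (Upot nu setT d1 zs).
have tp : 0 < `|ln d1| + `|Upot nu setT d1 zs| + 1 + e by lra.
have tau0 : 0 < tau by rewrite divr_gt0.
have tau1 : tau < 1 by rewrite ltr_pdivrMr //; lra.
have tauE : tau * (`|ln d1| + `|Upot nu setT d1 zs| + 1 + e) = e by rewrite divfK // gt_eqF.
have tau_l : tau * `|ln d1| <= e by rewrite -[leRHS]tauE ler_pM2l //; lra.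
have tau_u : tau * `|Upot nu setT d1 zs| <= e by rewrite -[leRHS]tauE ler_pM2l //; lra.
(* The potentials smoothed at d1 and d1 / 2 have Lipschitz constants 1 / d1 and 2 / d1, so they vary
   by e / 5 and 2 e / 5 over this distance. *)
pose d0 := e * d1 / 5.
have d00 : 0 < d0 by rewrite divr_gt0 ?mulr_gt0.
have near_le d2 : 0 < d2 -> d2 <= d1 / 2 -> forall z a, A a -> cdist z a <= d0 ->
   (1 - tau) * Upot nu setT d1 z - (fine (mu A))^-1 * Upot mu A d2 z <= c + 6 * e.
  move=> d20 d2d1 z a' Aa' za'; rewrite -/mA'.
  (* For t in [A] the nearest point satisfies |a - t| <= 2 |z - t|. By [lk_diff_le] the uniform
     convergence known on [A] therefore holds at z too, as in the continuity principle for
     potentials. *)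
  have [a Aa ha] := nearest_point z cA A0.
  have za : cdist z a <= d0 by apply: le_trans (ha _ Aa') za'.
  pose del := d1 / 2; have del0 : 0 < del by rewrite divr_gt0.
  have del1 : del <= 1 by rewrite /del; clear -d11 d10; lra.
  have d21 : d2 <= 1 by clear -d2d1 d11 d10; lra.
  have [_ hA] := Aa.
  have dd2 : 0 < 2 * d2 <= 1 by apply/andP; clear -d20 d2d1 d11; split; lra.
  have [_ /= hU] := hA _ dd2; move/andP : dd2 => [dd20 dd21].
  have [|/= hN _] := hA d2; first by rewrite /= d20 d21.
  have e2 : 2 * del = d1 by rewrite /del; field.
  have D1 : Upot mu A del z - Upot mu A d2 z <= Upot mu A d1 a - Upot mu A (2 * d2) a.
    rewrite !(UpotB cS muS mu1) //.
    apply: (le_Rintegral_concentrated mS muS) => //; try exact: (integrable_lkB cS muS mu1).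
    move=> t _ At; rewrite -e2; apply: lk_diff_le => //.
    have := cdist_triangle a z t; rewrite (cdistC a z); have := ha _ At; clear; lra.
  have D2 : Upot mu (~` A) (2 * d2) a <= Upot mu (~` A) d1 a.
    by apply: (Upot_mono cS muS mu1) => //; [exact: measurableC|clear -d2d1; lra].
  have D3 := USplit _ a d10 d11; have D4 := USplit _ a dd20 dd21.
  have D5 := Upot_lipschitz cS muS mu1 a z mA del0 del1.
  have D6 : Upot mu A d2 a <= Upot mu A del a by apply: (Upot_mono cS muS mu1).
  have D7 := Upot_lipschitz cT nuT nu1 z a measurableT d10 d11.
  have D8 := onA _ _ Aa d20 d21.
  have E1 : 1 / d1 * cdist z a <= e / 5.
    apply: (@le_trans _ _ (1 / d1 * d0)); first by apply: ler_wpM2l => //; rewrite divr_ge0 // ltW.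
    by rewrite /d0; rewrite le_eqVlt; apply/orP; left; apply/eqP; field; rewrite gt_eqF.
  have E2 : 1 / del * cdist a z <= 2 * e / 5.
    apply: (@le_trans _ _ (1 / del * d0)).
      by rewrite cdistC; apply: ler_wpM2l => //; rewrite divr_ge0 // ltW.
    by rewrite /d0 /del; rewrite le_eqVlt; apply/orP; left; apply/eqP; field; rewrite gt_eqF.
  have D9 : mA'^-1 * Upot mu A d2 a <= mA'^-1 * (Upot mu A d2 z + (7 * e / 5)).
    apply: ler_wpM2l; [by clear -kap0; lra|].
    rewrite -/d1 in hU; clear -hU D1 D2 D3 D4 D5 D6 E2; lra.
  have D10 : mA'^-1 * (7 * e / 5) <= 2 * (7 * e / 5) by clear -e0 kap eta2; apply: ler_wpM2r; lra.
  have D11 : (1 - tau) * Upot nu setT d1 z <= (1 - tau) * (Upot nu setT d1 a + e / 5).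
    by clear -tau1 D7 E1; apply: ler_wpM2l; lra.
  have D12 : - (tau * Upot nu setT d1 a) <= e.
    have : ln d1 <= Upot nu setT d1 a.
      by have := Upot_ge cT nuT nu1 a measurableT d10 d11; rewrite nu1 mulr1.
    move=> h; have : tau * (- Upot nu setT d1 a) <= tau * `|ln d1|.
      by apply: ler_wpM2l; [exact: ltW|have := ler_norm (- ln d1); rewrite normrN; clear -h; lra].
    clear -tau_l; lra.
  have D13 : 0 <= tau * (e / 5) by rewrite mulr_ge0 // ltW // divr_gt0.
  rewrite -/d1 in hN; clear -hN D8 D9 D10 D11 D12 D13; lra.
have SR : forall t, (S `|` T) t -> cdist (0, 0) t <= R0 by exact: hR0.
have [e3 /andP[e30 e31] hmp] := Upot_maximum_principle cST muST mu1 nuST nu1 SR R01 mA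
  mA0 d10 d11 tau0 tau1 d00 near_le.
have fin : forall d2, 0 < d2 -> d2 <= 1 -> Upot nu setT d1 zs - c - 10 * e <= Upot mu setT d2 zs.
  suff small d2 : 0 < d2 -> d2 <= Num.min e3 dz ->
      Upot nu setT d1 zs - c - 10 * e <= Upot mu setT d2 zs.
    move=> d2 d20 d21; have [le|lt] := leP d2 (Num.min e3 dz); first exact: small.
    have m0 : 0 < Num.min e3 dz by rewrite lt_min e30 dz0.
    apply: (le_trans (small _ m0 (lexx _))).
    by apply: (Upot_mono cS muS mu1) => //; exact: ltW.
  move=> d20; rewrite le_min => /andP[d2e d2z]; have d21 : d2 <= 1 by clear -d2e e31; lra.
  have H := hmp _ zs d20 d2e; rewrite -/mA' in H.
  (* From scale dz to d2 the whole potential drops by at most e and its part over [A] does not rise,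
     so the part over the complement drops by at most e. *)
  have W1 : Upot mu (~` A) dz zs - Upot mu (~` A) d2 zs <= e.
    have := hdz _ d20 d21; have := USplit _ zs d20 d21; have := USplit _ zs dz0 dz1.
    have := Upot_mono cS muS mu1 zs mA d20 d2z dz1; clear; lra.
  have W2 : - (eta * `|ln dz|) <= Upot mu (~` A) dz zs.
    have := Upot_ge cS muS mu1 zs (measurableC mA) dz0 dz1; rewrite muCA.
    have : - `|ln dz| * (1 - mA') <= ln dz * (1 - mA').
      apply: ler_wpM2r; first by clear -mA1; lra.
      by have := ler_norm (- ln dz); rewrite normrN; clear; lra.
    have : `|ln dz| * (1 - mA') <= `|ln dz| * eta by apply: ler_wpM2l => //; clear -mAe; lra.
    clear; lra.
  have V1 : Upot mu A d2 zs <= L'.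
    have := Upot_le cS muS mu1 (z := zs) (B := rz + R0) mA d20 d21.
    rewrite -/mA' -/L' => V1; apply: (@le_trans _ _ (L' * mA')).
      apply: V1 => t St; have := cdist_triangle zs (0, 0) t; rewrite (cdistC zs (0, 0)) -/rz.
      have := hR0 _ (or_introl St : (S `|` T) t); clear; lra.
    by clear -L'0 mA1 mA0; nra.
  have V2 : (mA'^-1 - 1) * Upot mu A d2 zs <= 2 * eta * L'.
    apply: (@le_trans _ _ ((mA'^-1 - 1) * L')); first by clear -kap0 V1; apply: ler_wpM2l => //; lra.
    exact: ler_wpM2r.
  have V3 := USplit _ zs d20 d21.
  have E1 : eta * (`|ln dz| + 2 * L') <= e.
    rewrite -[leRHS]etaQ; apply: ler_wpM2l; first exact: ltW.
    by rewrite /Q; clear -L0 nC0 e0; lra.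
  have E2 : tau * Upot nu setT d1 zs <= e.
    apply: le_trans tau_u; apply: ler_wpM2l; first exact: ltW.
    exact: ler_norm.
  clear -e0 H W1 W2 V2 V3 E1 E2; lra.
have := le_logpot cS muS mu1 fin.
have := logpot_le_Upot cT nuT nu1 zs d10 d11.
case: (logpot nu zs) => [r| |] //; case: (logpot mu zs) => [r'| |] //; rewrite ?leNye ?leey //.
by rewrite -!EFinD !lee_fin; clear; lra.
Qed.

(** * Comparison of two measures on the logarithm of a maximum *)

Section log_average.
Context {R : realType}.

(** Layer-cake estimate: - log f is at most ln 2 times the number of k with f < 2^-k. Each such set
    lies in an interval of length 8 / 2^k, and these lengths sum to 16. *)
Lemma integral_log_le (f : R -> R) : measurable_fun setT f ->
  (forall s, 0 <= f s <= 1) ->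
  (forall k : nat, exists u : R, forall s, 0 <= s <= 1 -> f s < 2 ^- k -> `|s - u| < 4 * 2 ^- k) ->
  (\int[lebesgue_measure]_(s in `[0%R, 1%R]) (- elog (f s)) <= (16 * ln 2)%:E)%E.
Proof.
move=> mf f01 hu.
have L0 : 0 < ln (2 : R) by apply: ln_gt0; lra.
pose A k := [set s | f s < 2 ^- k].
have mA k : measurable (A k).
  rewrite -[A k]setTI; apply: measurable_fun_ltr => //; exact: measurable_cst.
pose g (k : nat) s : \bar R := (ln 2 * \1_(A k) s)%:E.
have g0 k s : (0 <= g k s)%E.
  by rewrite lee_fin mulr_ge0 // ltW.
have mg k : measurable_fun setT (g k).
  by apply/measurable_EFinP; apply: measurable_funM => //; exact: measurable_indic.
have mlog : measurable_fun setT (fun s => - elog (f s))%E.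
  by apply: measurableT_comp => //; apply: measurableT_comp => //; exact: measurable_elog.
have log_ltE k s : ((k%:R * ln 2)%:E < - elog (f s))%E -> f s < 2 ^- k.
  rewrite /elog; have /andP[fs0 _] := f01 s.
  case: ifPn => [f0 _|]; first by apply: (le_lt_trans f0); rewrite invr_gt0 exprn_gt0.
  rewrite -ltNge => fp; rewrite -EFinN lte_fin mulr_natl -lnXn // ltrNr.
  rewrite -lnV ?posrE ?exprn_gt0 // ltr_ln ?posrE ?invr_gt0 ?exprn_gt0 //.
have part n s : (Order.min (- elog (f s)) (n%:R * ln 2)%:E <= \sum_(0 <= k < n) g k s)%E.
  elim: n => [|n IH].
    rewrite big_nil mul0r ge_min; apply/orP; right; exact: lexx.
  rewrite big_nat_recr //=.
  have [le|lt] := leP (- elog (f s))%E (n%:R * ln 2)%:E.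
    apply: (@le_trans _ _ (Order.min (- elog (f s)) (n%:R * ln 2)%:E)%E).
      by rewrite (min_idPl le) ge_min lexx.
    by rewrite -[leLHS]adde0; apply: leeD.
  have As : A n s by exact: log_ltE.
  rewrite /g indicE mem_set // mulr1.
  apply: (@le_trans _ _ (n.+1%:R * ln 2)%:E); first by rewrite ge_min lexx orbT.
  rewrite -natr1 mulrDl mul1r EFinD; apply: leeD => //.
  by apply: le_trans IH; rewrite le_min lexx (ltW lt).
have maj s : (- elog (f s) <= \sum_(0 <= k <oo) g k s)%E.
  have ps n : (\sum_(0 <= k < n) g k s <= \sum_(0 <= k <oo) g k s)%E.
    by apply: nneseries_lim_ge.
  have tot0 : (0 <= \sum_(0 <= k <oo) g k s)%E by apply: nneseries_ge0.
  case E : (\sum_(0 <= k <oo) g k s)%E ps tot0 => [r| |] ps // r0; last by rewrite leey.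
  rewrite leNgt; apply/negP => lt.
  pose n := (Num.truncn (r / ln 2)).+1.
  have hn : r < n%:R * ln 2.
    by rewrite -ltr_pdivrMr //; exact: truncnS_gt.
  have := le_trans (part n s) (ps n); rewrite leNgt lt_min lt /=.
  by rewrite lte_fin hn.
apply: (@le_trans _ _ (\int[lebesgue_measure]_(s in `[0%R, 1%R]) \sum_(0 <= k <oo) g k s)%E).
  apply: measurable_le_integral => //; first exact: measurable_funTS.
  apply: ge0_emeasurable_sum; first by move=> k s _ _; exact: g0.
  by move=> k _; apply: measurable_funTS; exact: mg.
rewrite integral_nneseries //; last by move=> k; apply: measurable_funTS; exact: mg.
have gi k : (\int[lebesgue_measure]_(s in `[0%R, 1%R]) g k s <= (ln 2 * (8 * 2 ^- k))%:E)%E.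
  rewrite /g.
  under eq_integral do rewrite EFinM.
  rewrite ge0_integralZl_EFin //; last 2 first.
  - by apply/measurable_EFinP; apply: measurable_funTS; apply: measurable_indic; exact: mA.
  - exact: ltW.
  rewrite integral_indic; [|exact: measurable_itv|exact: mA].
  rewrite [leRHS]EFinM; apply: lee_wpmul2l; first by rewrite lee_fin ltW.
  have [u hk] := hu k.
  apply: (@le_trans _ _ (lebesgue_measure `]u - 4 * 2 ^- k, u + 4 * 2 ^- k[%classic)).
    apply: le_measure; rewrite ?inE; [by apply: measurableI; [exact: mA|exact: measurable_itv]|exact: measurable_itv|].
    move=> s [As] /=; rewrite !in_itv /= => /hk /(_ As) /ltr_normlP[].
    by move=> h1 h2; apply/andP; split; lra.
  rewrite lebesgue_measure_itv /=.
  case: ifP => _; last by rewrite lee_fin mulr_ge0 // invr_ge0 exprn_ge0.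
  by rewrite -EFinB lee_fin; lra.
apply: lime_le; first by apply: is_cvg_nneseries => k _ _; apply: integral_ge0 => s _; exact: g0.
apply: nearW => n.
apply: (@le_trans _ _ (\sum_(0 <= k < n) (ln 2 * (8 * 2 ^- k))%:E)%E).
  by apply: lee_sum => k _; exact: gi.
rewrite sumEFin lee_fin -mulr_sumr mulrC; apply: ler_wpM2r; first exact: ltW.
rewrite -mulr_sumr.
have -> : \sum_(0 <= k < n) 2 ^- k = 2 - 2 * 2 ^- n :> R.
  elim: n => [|n IH]; first by rewrite big_nil expr0 invr1; lra.
  by rewrite big_nat_recr //= IH exprS invfM; field; rewrite expf_eq0 pnatr_eq0 andbF.
have : 0 < 2 ^- n :> R by rewrite invr_gt0 exprn_gt0.
move: (2 ^- n) => x x0; lra.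
Qed.

End log_average.

(** * Linearity of the integral for integrands bounded above *)

Section integral_bounded_above.
Context d (T : measurableType d) {R : realType}.
Variable nu : {measure set T -> \bar R}.
Implicit Types (D : set T) (f g : T -> \bar R).
Variables (S : set T) (a : R).
Hypotheses (mS : measurable S) (S0 : nu (~` S) = 0%E) (nua : nu setT = a%:E).

Let restrict f : measurable_fun setT f -> (\int[nu]_t f t = \int[nu]_(t in S) f t)%E.
Proof. by move=> mf; rewrite (@integral_setI_conull _ _ _ _ setT S) // setTI. Qed.

(** Reduces an integrand that may take the value -oo to the nonnegative function B - f, for which
    the integral is additive. *)
Lemma integral_ubE f (B : R) : measurable_fun setT f -> (forall t, S t -> (f t <= B%:E)%E) ->
  (\int[nu]_t f t = (\int[nu]_(t in S) B)%:E - \int[nu]_(t in S) (B%:E - f t))%E.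
Proof.
move=> mf fB; rewrite restrict // -integral_EFin_sub_ge0 //.
- apply: eq_integral => t /set_mem St; have := fB _ St.
  by case: (f t) => [r| |] // _; rewrite -!EFinB opprB addrC subrK.
- exact: (integrable_concentrated mS S0 nua (B := `|B|)).
- by apply: measurable_funTS; exact: emeasurable_funB.
- move=> t St; have := fB _ St; case: (f t) => [r| |] //; last by rewrite /= leey.
  by rewrite lee_fin -EFinB lee_fin subr_ge0.
Qed.

Lemma integralD_ub f g (B B' : R) : measurable_fun setT f -> measurable_fun setT g ->
  (forall t, S t -> (f t <= B%:E)%E) -> (forall t, S t -> (g t <= B'%:E)%E) ->
  (\int[nu]_t (f t + g t) = \int[nu]_t f t + \int[nu]_t g t)%E.
Proof.
move=> mf mg fB gB.
have f0 t : S t -> (0 <= B%:E - f t)%E.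
  move=> St; have := fB _ St; case: (f t) => [r| |] //; last by rewrite /= leey.
  by rewrite lee_fin -EFinB lee_fin subr_ge0.
have g0 t : S t -> (0 <= B'%:E - g t)%E.
  move=> St; have := gB _ St; case: (g t) => [r| |] //; last by rewrite /= leey.
  by rewrite lee_fin -EFinB lee_fin subr_ge0.
rewrite (integral_ubE mf fB) (integral_ubE mg gB).
rewrite (@integral_ubE (fun t => f t + g t)%E (B + B')); first last.
- by move=> t St; rewrite EFinD leeD ?fB ?gB.
- exact: emeasurable_funD.
have -> : (\int[nu]_(t in S) ((B + B')%:E - (f t + g t)) =
    \int[nu]_(t in S) (B%:E - f t) + \int[nu]_(t in S) (B'%:E - g t))%E.
  rewrite -ge0_integralD //.
  - apply: eq_integral => t /set_mem St; have := fB _ St; have := gB _ St.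
    case: (f t) => [r| |] //; case: (g t) => [r'| |] // _ _.
    by rewrite -!EFinD; congr (_%:E); lra.
  - by apply: measurable_funTS; exact: emeasurable_funB.
  - by apply: measurable_funTS; exact: emeasurable_funB.
rewrite !Rintegral_cst //.
have p : (0 <= \int[nu]_(t in S) (B%:E - f t))%E by exact: integral_ge0.
have q : (0 <= \int[nu]_(t in S) (B'%:E - g t))%E by exact: integral_ge0.
case: (integral _ _ _) p => [r| |] // _; case: (integral _ _ _) q => [r'| |] // _.
by rewrite -!EFinD; congr (_%:E); lra.
Qed.

Lemma integral_sum_ub (I : Type) (s : seq I) (f : I -> T -> \bar R) :
  (forall i, measurable_fun setT (f i)) ->
  (forall i, exists B : R, forall t, S t -> (f i t <= B%:E)%E) ->
  (\int[nu]_t (\sum_(i <- s) f i t) = \sum_(i <- s) \int[nu]_t f i t)%E.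
Proof.
move=> mf fB; elim: s => [|i s IH].
  by under eq_integral do rewrite big_nil; rewrite integral0 big_nil.
under eq_integral do rewrite big_cons.
have [B hB] := fB i.
have [B' hB'] : exists B' : R, forall t, S t -> (\sum_(j <- s) f j t <= B'%:E)%E.
  elim: s {IH} => [|j s [B' IH]]; first by exists 0 => t _; rewrite big_nil.
  have [Bj hBj] := fB j; exists (Bj + B') => t St.
  by rewrite big_cons EFinD leeD ?hBj ?IH.
rewrite (integralD_ub (mf i) _ hB hB') ?IH ?big_cons //.
exact: emeasurable_sum.
Qed.

Lemma integral_ub_le f (B : R) : measurable_fun setT f -> (forall t, S t -> (f t <= B%:E)%E) ->
  (\int[nu]_t f t <= (B * a)%:E)%E.
Proof.
move=> mf fB; rewrite restrict //.
apply: (@le_trans _ _ (\int[nu]_(t in S) (cst B%:E) t)%E).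
  by apply: measurable_le_integral => //; exact: measurable_funTS.
rewrite integral_cst //.
suff -> : nu S = a%:E by rewrite EFinM.
have : nu (S `|` ~` S) = (nu S + nu (~` S))%E.
  by apply: measureU => //; [exact: measurableC|exact: setICr].
by rewrite setUv nua S0 adde0.
Qed.

End integral_bounded_above.

(** * Averaging the logarithm of |a + s b| over s in [0, 1] *)

Section averaging.
Context {R : realType}.
Implicit Types (a b : R * R).

Definition cdisp (s : R) a b : R * R := (a.1 + s * b.1, a.2 + s * b.2).

Lemma cabs_ge0 a : 0 <= cabs a. Proof. exact: sqrtr_ge0. Qed.

Lemma cabs_triangle a b : cabs (a.1 + b.1, a.2 + b.2) <= cabs a + cabs b.
Proof.
rewrite !cabsE; apply: (le_trans (cdist_triangle _ b _)); rewrite lerD2r.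
by rewrite /cdist /= !addrK !subr0.
Qed.

Lemma cabs_scale s a : cabs (s * a.1, s * a.2) = `|s| * cabs a.
Proof. by rewrite /cabs /= !exprMn -mulrDr sqrtrM ?sqr_ge0 // sqrtr_sqr. Qed.

Lemma cabs_cdisp_le s a b : cabs (cdisp s a b) <= cabs a + `|s| * cabs b.
Proof. by rewrite -cabs_scale; exact: (cabs_triangle a (s * b.1, s * b.2)). Qed.

Lemma cabs_cdisp_ge s a b : `|cabs a - `|s| * cabs b| <= cabs (cdisp s a b).
Proof.
have h1 := cabs_cdisp_le (- s) (cdisp s a b) b.
have h2 : cabs (s * b.1, s * b.2) <= cabs (cdisp s a b) + cabs a.
  have := cabs_cdisp_le (-1) (cdisp s a b) a; rewrite normrN1 mul1r.
  by rewrite /cdisp /= !mulN1r !(addrAC _ _ (- _)) !subrr !add0r.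
rewrite cabs_scale in h2; rewrite normrN in h1.
have e : cdisp (- s) (cdisp s a b) b = a.
  by rewrite /cdisp /= !mulNr !addrK; case: a {h1 h2}.
by rewrite e in h1; apply/ler_normlP; split; lra.
Qed.

(** From |a + s b| >= ||a| - s |b||: if |b| >= m / 2, a small value forces s close to |a| / |b|. If
    |b| < m / 2 and r <= 1 / 4, then m = |a| or m = c and no small value occurs; for r > 1 / 4 the
    whole of [0, 1] lies within 4 r of 1 / 2. *)
Lemma small_cdisp_interval a b (c r : R) : 0 <= c -> 0 < r ->
  let m := Num.max (Num.max (cabs a) (cabs b)) c in 0 < m ->
  exists u : R, forall s, 0 <= s <= 1 ->
    Num.max (cabs (cdisp s a b)) c < r * (2 * m) -> `|s - u| < 4 * r.
Proof.
move=> c0 r0 m m0; have a0 := cabs_ge0 a; have b0 := cabs_ge0 b.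
have am : cabs a <= m by rewrite !le_max lexx.
have bm : cabs b <= m by rewrite !le_max lexx orbT.
have wide : 1 / 4 < r -> exists u : R, forall s, 0 <= s <= 1 ->
    Num.max (cabs (cdisp s a b)) c < r * (2 * m) -> `|s - u| < 4 * r.
  by move=> r4; exists (1 / 2) => s /andP[s0 s1] _; apply/ltr_normlP; split; lra.
have [/wide //|r4] := ltP (1 / 4) r.
have [bb|bb] := leP (m / 2) (cabs b).
  exists (cabs a / cabs b) => s /andP[s0 s1]; rewrite gt_max => /andP[h _].
  have b1 : 0 < cabs b by lra.
  have := cabs_cdisp_ge s a b; rewrite (ger0_norm s0) => h1.
  have h2 : `|cabs a - s * cabs b| < 4 * r * cabs b by apply: (le_lt_trans h1); nra.
  have -> : s - cabs a / cabs b = - (cabs a - s * cabs b) / cabs b.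
    by field; rewrite gt_eqF.
  by rewrite normrM normrN normfV (gtr0_norm b1) ltr_pdivrMr.
exists 0 => s /andP[s0 s1]; rewrite gt_max => /andP[h1 h2]; exfalso.
have cm : c < m by nra.
have ma : m = cabs a.
  apply/eqP; rewrite eq_le am andbT.
  have : m <= Num.max (Num.max (cabs a) (cabs b)) c by [].
  rewrite !le_max => /orP[/orP[//|]|]; lra.
have := cabs_cdisp_ge s a b; rewrite (ger0_norm s0) => /(le_trans (ler_norm _)) h3.
have : s * cabs b <= cabs b by nra.
nra.
Qed.

Lemma measurable_cabs : measurable_fun setT (@cabs R).
Proof.
have -> : @cabs R = cdist (0, 0) by apply/funext => z; rewrite cabsE cdistC.
exact: measurable_cdist.
Qed.

Lemma elog_le (x y : R) : x <= y -> (elog x <= elog y)%E.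
Proof.
move=> xy; rewrite /elog; case: ifPn => [|]; first by rewrite leNye.
rewrite -ltNge => x0; rewrite ifF; last by rewrite leNgt (lt_le_trans x0 xy).
by rewrite lee_fin ler_ln ?posrE // (lt_le_trans x0).
Qed.

Lemma elogM (x y : R) : 0 < x -> elog (x * y) = ((ln x)%:E + elog y)%E.
Proof.
move=> x0; rewrite /elog pmulr_rle0 //; case: ifPn => //.
by rewrite -ltNge => y0; rewrite lnM ?posrE // EFinD.
Qed.

(** Where M t > 0, the mean over s of the drop from log (2 M t) to the logarithm on the right is at
    most 16 ln 2. By Tonelli the mean of its [nu]-integral is at most 16 ln 2 times the mass, so
    some s does not exceed this by more than 1. The function [c] stands for the terms still to be
    combined. *)
Lemma exists_log_average d (T : measurableType d) (nu : {measure set T -> \bar R})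
    (S : set T) (mass B : R) (f g : T -> R * R) (c : T -> R) :
  measurable S -> nu (~` S) = 0%E -> nu setT = mass%:E ->
  measurable_fun setT f -> measurable_fun setT g -> measurable_fun setT c ->
  (forall t, 0 <= c t) ->
  let M t := Num.max (Num.max (cabs (f t)) (cabs (g t))) (c t) in
  (forall t, S t -> M t <= B) ->
  exists2 s : R, 0 <= s <= 1 &
    (\int[nu]_t elog (M t) <=
     \int[nu]_t elog (Num.max (cabs (cdisp s (f t) (g t))) (c t)) + (16 * ln 2 * mass + 1)%:E)%E.
Proof.
move=> mS S0 nua mf mg mc c0 M MB.
have mf1 : measurable_fun setT (fun t => (f t).1) by exact: (measurableT_comp measurable_fst mf).
have mf2 : measurable_fun setT (fun t => (f t).2) by exact: (measurableT_comp measurable_snd mf).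
have mg1 : measurable_fun setT (fun t => (g t).1) by exact: (measurableT_comp measurable_fst mg).
have mg2 : measurable_fun setT (fun t => (g t).2) by exact: (measurableT_comp measurable_snd mg).
have mM : measurable_fun setT M.
  apply: measurable_maxr => //; apply: measurable_maxr.
    exact: (measurableT_comp measurable_cabs mf).
  exact: (measurableT_comp measurable_cabs mg).
pose N s t := Num.max (cabs (cdisp s (f t) (g t))) (c t).
have N0 s t : 0 <= N s t by rewrite le_max c0 orbT.
have M0 t : 0 <= M t by rewrite le_max c0 orbT.
have NM s t : 0 <= s <= 1 -> N s t <= 2 * M t.
  move=> /andP[s0 s1]; have fM : cabs (f t) <= M t by rewrite !le_max lexx.
  have gM : cabs (g t) <= M t by rewrite !le_max lexx orbT.
  have cM : c t <= M t by rewrite !le_max lexx orbT.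
  rewrite ge_max; apply/andP; split; last by have := M0 t; lra.
  have := cabs_cdisp_le s (f t) (g t); rewrite (ger0_norm s0).
  have := cabs_ge0 (g t); nra.
(* As 2 M bounds N for s in [0, 1], this is the drop of the logarithm there. The value 0 where M
   vanishes is harmless: log M is -oo at such points. *)
pose G (p : R * T) : \bar R := if M p.2 <= 0 then 0%E else
  (maxe 0 ((ln (2 * M p.2))%:E - elog (N p.1 p.2)))%E.
have G0 p : (0 <= G p)%E.
  by rewrite /G; case: ifPn => // _; rewrite le_max lexx.
have m1 (h : T -> R) : measurable_fun setT h -> measurable_fun setT (fun p : R * T => h p.2).
  by move=> mh; exact: (measurableT_comp mh measurable_snd).
have mN : measurable_fun setT (fun p : R * T => N p.1 p.2).
  apply: measurable_maxr; last exact: (m1 _ mc).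
  rewrite /cdisp; apply: (measurableT_comp measurable_cabs); apply: measurable_fun_pair.
    apply: measurable_funD; [exact: (m1 _ mf1)|apply: measurable_funM => //; exact: (m1 _ mg1)].
  apply: measurable_funD; [exact: (m1 _ mf2)|apply: measurable_funM => //; exact: (m1 _ mg2)].
have mG : measurable_fun setT G.
  apply: measurable_fun_if => //.
    by apply: measurable_fun_ler => //; exact: (m1 _ mM).
  apply: measurable_funTS; apply: measurable_maxe => //.
  apply: emeasurable_funB.
    apply/measurable_EFinP; apply: (measurableT_comp (@measurable_ln R)).
    by apply: measurable_funM => //; exact: (m1 _ mM).
  exact: (measurableT_comp measurable_elog mN).
have Gs s t : (elog (M t) - G (s, t) <= elog (N s t))%E.
  rewrite /G /=; case: ifPn => [Mt|].
    by rewrite {1}/elog Mt /= leNye.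
  rewrite -ltNge => Mt; rewrite {1}/elog ifF; last by rewrite leNgt Mt.
  have lM : ln (M t) <= ln (2 * M t) by rewrite ler_ln ?posrE; lra.
  case: (elog (N s t)) => [r| |] /=; [|by rewrite leey|by rewrite (max_idPr (leey _)) leNye].
  rewrite -EFinB -EFin_max -EFinB lee_fin.
  have : ln (2 * M t) - r <= Num.max 0 (ln (2 * M t) - r) by rewrite le_max lexx orbT.
  lra.
pose K := 16 * ln 2 * mass + 1.
have [s s01 hs] : exists2 s : R, 0 <= s <= 1 & (\int[nu]_t G (s, t) <= K%:E)%E.
  apply: contrapT => nex.
  have nufin : (nu setT < +oo)%E by rewrite nua ltry.
  (* The same measure, equipped with the finiteness that Tonelli's theorem asks for. *)
  pose nu' := mfrestr measurableT nufin.
  have nuE (h : T -> \bar R) : (\int[nu']_t h t = \int[nu]_t h t)%E.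
    by apply: eq_measure_integral => A mA _; rewrite -[RHS](congr1 nu (setIT A)).
  pose H (p : R * T) : \bar R := if p.1 \in `[0, 1] then G p else 0%E.
  have H0 p : (0 <= H p)%E by rewrite /H; case: ifP.
  have mH : measurable_fun setT H.
    apply: measurable_fun_if => //; last exact: measurable_funTS.
    apply: (measurable_fun_bool true) => /=.
    rewrite setTI [X in measurable X](_ : _ = `[0, 1]%classic `*` setT); last first.
      by apply/seteqP; split => p /=; [move=> h; split => //|move=> []].
    by apply: measurableX => //; exact: measurable_itv.
  have := @fubini_tonelli _ _ _ _ R (@lebesgue_measure R) nu' H mH H0.
  have lhs : (K%:E <= \int[lebesgue_measure]_s \int[nu']_t H (s, t))%E.
    rewrite [X in (_ <= X)%E](_ : _ = \int[lebesgue_measure]_(s in `[0%R, 1%R]) \int[nu]_t G (s, t))%E; last first.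
      rewrite [RHS]integral_mkcond; apply: eq_integral => s _ /=.
      rewrite nuE patchE; have [h|h] := boolP (s \in `[0, 1]).
        rewrite ifT; last exact/mem_set.
        by apply: eq_integral => t _; rewrite /H /= h.
      rewrite ifF; last by apply/negP => /set_mem; exact/negP.
      rewrite (eq_integral (cst 0%E)) ?integral0 // => t _.
      by rewrite /H /= (negbTE h).
    apply: (@le_trans _ _ (\int[lebesgue_measure]_(s in `[0%R, 1%R]) (cst K%:E) s)%E).
      by rewrite integral_cst //= lebesgue_measure_itv /= lte_fin ltr01 oppr0 adde0 mule1.
    apply: measurable_le_integral => //.
      apply: measurable_funTS.
      have := @measurable_fun_fubini_tonelli_F _ _ _ _ R nu' G mG G0.
      by apply: eq_measurable_fun => s _; rewrite /fubini_F nuE.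
    move=> s /=; rewrite in_itv /= => s01; apply: ltW; rewrite ltNge; apply/negP => le.
    by apply: nex; exists s.
  have rhs : (\int[nu']_t \int[lebesgue_measure]_s H (s, t) <= (16 * ln 2 * mass)%:E)%E.
    have inner t : (\int[lebesgue_measure]_s H (s, t) <= (16 * ln 2)%:E)%E.
      have l2 : 0 <= ln (2 : R) by apply: ln_ge0; lra.
      have -> : (\int[lebesgue_measure]_s H (s, t) =
          \int[lebesgue_measure]_(s in `[0%R, 1%R]) G (s, t))%E.
        rewrite [RHS]integral_mkcond; apply: eq_integral => s _ /=.
        rewrite /H patchE /=; have [h|h] := boolP (s \in `[0, 1]).
          by rewrite ifT //; exact/mem_set.
        by rewrite ifF //; apply/negP => /set_mem; exact/negP.
      have [Mt|Mt] := leP (M t) 0.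
        rewrite (eq_integral (cst 0%E)) => [|s _]; last by rewrite /G /= Mt.
        by rewrite integral0 lee_fin; lra.
      have p : 0 < 2 * M t by rewrite mulr_gt0.
      have mNt : measurable_fun setT (fun s => N s t).
        exact: (measurableT_comp mN (pair2_measurable t)).
      have mNt' : measurable_fun setT (fun s => Num.min 1 (N s t / (2 * M t))).
        by apply: measurable_minr => //; apply: measurable_funM.
      apply: (@le_trans _ _ (\int[lebesgue_measure]_(s in `[0%R, 1%R])
          (- elog (Num.min 1 (N s t / (2 * M t)))%R))%E).
        apply: measurable_le_integral => //.
        - apply: measurable_funTS; exact: (measurableT_comp mG (pair2_measurable t)).
        - apply: measurable_funTS; apply: measurableT_comp => //.
          exact: (measurableT_comp measurable_elog mNt').
        - move=> s /=; rewrite in_itv /= => s01; rewrite /G /= ifF; last by rewrite leNgt Mt.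
          have q1 : N s t / (2 * M t) <= 1 by rewrite ler_pdivrMr // mul1r NM.
          rewrite (min_idPr q1).
          have p' : 2 * M t != 0 by rewrite gt_eqF.
          have -> : elog (N s t) = ((ln (2 * M t))%:E + elog (N s t / (2 * M t)))%E.
            by rewrite -elogM // mulrC divfK.
          have : (elog (N s t / (2 * M t)) <= 0)%E.
            by have := elog_le q1; rewrite [elog 1]/elog ifF ?ln1 // leNgt ltr01.
          case: (elog (N s t / _)) => [r| |] //=; last by rewrite leey.
          by rewrite lee_fin => r0; rewrite ge_max; apply/andP; split; rewrite lee_fin; lra.
      apply: integral_log_le => //.
        move=> s; rewrite le_min ler01 /= divr_ge0 ?N0 ?(ltW p) //=.
        by rewrite ge_min lexx.
      move=> k; have k0 : 0 < 2 ^- k :> R by rewrite invr_gt0 exprn_gt0.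
      have k1 : 2 ^- k <= 1 :> R by rewrite invf_le1 ?exprn_gt0 // exprn_ege1 // ler1n.
      have [u hu] := small_cdisp_interval (c0 t) k0 Mt; exists u => s s01.
      rewrite gt_min ltNge k1 /= ltr_pdivrMr // => h.
      by apply: hu.
    apply: (@le_trans _ _ (\int[nu']_t (cst (16 * ln 2)%:E) t)%E).
      apply: measurable_le_integral => //.
      exact: (@measurable_fun_fubini_tonelli_G _ _ _ _ R (@lebesgue_measure R) H mH H0).
    by rewrite nuE integral_cst // nua -EFinM.
  by move=> E; move: lhs; rewrite E => /le_trans /(_ rhs); rewrite lee_fin /K; lra.
exists s => //.
have mGs : measurable_fun setT (fun t => G (s, t)).
  exact: (measurableT_comp mG (pair1_measurable s)).
have melM : measurable_fun setT (fun t => elog (M t)).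
  exact: (measurableT_comp measurable_elog mM).
have melN : measurable_fun setT (fun t => elog (N s t)).
  apply: (measurableT_comp measurable_elog).
  exact: (measurableT_comp mN (pair1_measurable s)).
have h1 : (\int[nu]_t elog (M t) - \int[nu]_t G (s, t) <= \int[nu]_t elog (N s t))%E.
  rewrite -integral_ge0N //.
  rewrite -(@integralD_ub _ _ _ nu S mass mS S0 nua _ _ (ln (`|B| + 1)) 0) //.
  - by apply: measurable_le_integral => //; apply: emeasurable_funB.
  - exact: measurableT_comp.
  - move=> t St; have : M t <= `|B| + 1.
      by apply: (le_trans (MB _ St)); have := ler_norm B; lra.
    move=> /elog_le /le_trans; apply; rewrite /elog ifF // leNgt.
    by have := normr_ge0 B => ?; apply/negbF; lra.
  - by move=> t _; rewrite oppe_le0.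
have : (0 <= \int[nu]_t G (s, t))%E by exact: integral_ge0.
move: h1 hs; rewrite -/(N s) -/K.
case: (integral _ _ (fun t => G (s, t))) => [r| |] //.
case: (integral _ _ (fun t => elog (M t))) => [r1| |]; case: (integral _ _ _) => [r2| |] //=;
  rewrite ?leey ?leNye // -?EFinD -?EFinB !lee_fin; lra.
Qed.

End averaging.

(** * Complex polynomials as functions on the plane *)

Section complex_polynomials.
Context {R : realType}.
Implicit Types (z t : R * R) (p q a : {poly R[i]}) (n : nat).

Definition cz z : R[i] := Complex z.1 z.2.
Definition pc (x : R[i]) : R * R := (complex.Re x, complex.Im x).
Definition pval p z : R * R := pc p.[cz z].

Lemma cabs_pc (x : R[i]) : cabs (pc x) = ComplexField.Normc.normc x.
Proof. by case: x. Qed.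

Lemma cabs_pcM (x y : R[i]) : cabs (pc (x * y)) = cabs (pc x) * cabs (pc y).
Proof. by rewrite !cabs_pc ComplexField.Normc.normcM. Qed.

Lemma cabs_pcX (x : R[i]) n : cabs (pc (x ^+ n)) = cabs (pc x) ^+ n.
Proof.
elim: n => [|n IH]; last by rewrite !exprS cabs_pcM IH.
by rewrite !expr0 cabs_pc ComplexField.Normc.normc1.
Qed.

Lemma cabs_pcD (x y : R[i]) : cabs (pc (x + y)) <= cabs (pc x) + cabs (pc y).
Proof. by case: x y => [x1 x2] [y1 y2]; exact: (cabs_triangle (x1, x2) (y1, y2)). Qed.

Lemma cabs_pc_cdist z (x : R[i]) : cabs (pc (cz z - x)) = cdist z (pc x).
Proof. by case: x. Qed.

Lemma cabs_pc_real (s : R) : 0 <= s -> cabs (pc (Complex s 0)) = s.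
Proof. by move=> s0; rewrite /cabs /= expr0n addr0 sqrtr_sqr ger0_norm. Qed.

Lemma pval_cdisp (s : R) p a z : cdisp s (pval p z) (pval a z) = pval (p + (Complex s 0) *: a) z.
Proof.
rewrite /pval hornerD hornerZ; case: p.[_] => x1 x2; case: a.[_] => y1 y2.
by rewrite /pc /cdisp /= !mul0r subr0 addr0.
Qed.

Lemma measurable_pval p : measurable_fun setT (pval p).
Proof.
elim/poly_ind: p => [|p c IH].
  have -> : pval 0 = cst (0, 0) by apply/funext => z; rewrite /pval horner0.
  exact: measurable_cst.
have m1 : measurable_fun setT (fun z => (pval p z).1) by exact: (measurableT_comp measurable_fst IH).
have m2 : measurable_fun setT (fun z => (pval p z).2) by exact: (measurableT_comp measurable_snd IH).
have -> : pval (p * 'X + c%:P) = fun z =>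
   ((pval p z).1 * z.1 - (pval p z).2 * z.2 + complex.Re c,
    (pval p z).1 * z.2 + (pval p z).2 * z.1 + complex.Im c).
  apply/funext => z; rewrite /pval !hornerE; case: p.[_] => x1 x2; case: c => y1 y2 /=.
  by rewrite /pc /=.
apply: measurable_fun_pair.
  apply: measurable_funD => //; apply: measurable_funB; apply: measurable_funM => //.
by apply: measurable_funD => //; apply: measurable_funD; apply: measurable_funM.
Qed.

Lemma bounded_pval p (T : set (R * R)) : compact T ->
  exists B : R, forall z, T z -> cabs (pval p z) <= B.
Proof.
move=> cT; have [D D0 hD] := compact_bounded_plane (0, 0) cT.
elim/poly_ind: p => [|p c [B IH]].
  by exists 0 => z _; rewrite /pval horner0 cabs_pc ComplexField.Normc.normc0.
exists (`|B| * D + cabs (pc c)) => z Tz; rewrite /pval !hornerE.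
apply: (le_trans (cabs_pcD _ _)); rewrite lerD2r cabs_pcM.
have -> : cabs (pc (cz z)) = cdist (0, 0) z by rewrite cdistC -cabsE.
apply: ler_pM; rewrite ?cdist_ge0 ?hD ?cabs_ge0 //.
by apply: (le_trans (IH _ Tz)); exact: ler_norm.
Qed.

Lemma cabs_pval_factor p : p != 0 ->
  exists2 A : R, 0 < A & exists2 r : seq (R * R), size r = (size p).-1 &
    forall z, cabs (pval p z) = A * \prod_(t <- r) cdist z t.
Proof.
move=> p0; have [r pE] := closed_field_poly_normal p.
have l0 : lead_coef p != 0 by rewrite lead_coef_eq0.
exists (cabs (pc (lead_coef p))).
  rewrite lt_neqAle cabs_ge0 andbT eq_sym cabs_pc; apply: contra l0 => /eqP.
  by move=> /ComplexField.Normc.eq0_normc ->.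
exists (map pc r).
  by rewrite size_map [in RHS]pE size_scale // size_prod_XsubC.
move=> z; rewrite {1}pE /pval hornerZ cabs_pcM; congr (_ * _).
rewrite big_map horner_prod; elim: r {pE} => [|x r IH].
  by rewrite !big_nil cabs_pc ComplexField.Normc.normc1.
by rewrite !big_cons cabs_pcM IH hornerXsubC cabs_pc_cdist.
Qed.

Lemma elog_prod (I : Type) (r : seq I) (f : I -> R) : (forall i, 0 <= f i) ->
  elog (\prod_(i <- r) f i) = (\sum_(i <- r) elog (f i))%E.
Proof.
move=> f0; elim: r => [|i r IH]; first by rewrite !big_nil /elog ifF ?ln1 // leNgt ltr01.
rewrite !big_cons; have := f0 i; rewrite le_eqVlt => /orP[/eqP <-|fi].
  rewrite mul0r [in RHS]/elog lexx [in LHS]/elog lexx.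
  by case: (\sum_(_ <- _) _)%E.
by rewrite elogM // IH [in RHS]/elog ifF // leNgt fi.
Qed.

Lemma elogX (x : R) n : 0 <= x -> elog (x ^+ n) = (\sum_(i < n) elog x)%E.
Proof.
by move=> x0; rewrite -(@elog_prod _ _ (fun=> x)) // prodr_const card_ord.
Qed.

(** In the order of [R[i]], comparison with 0 also asserts that the coefficient is real. Adding
    nonnegative real multiples of [monic_like] polynomials to a [pos_lead] one cannot cancel the
    leading term, so the degree stays exactly [n]. *)
Definition monic_like n p := (size p <= n.+1)%N && (0 <= p`_n).
Definition pos_lead n p := (size p <= n.+1)%N && (0 < p`_n).

Lemma pos_lead_size n p : pos_lead n p -> p != 0 /\ (size p).-1 = n.
Proof.
move=> /andP[sz c0].
have szn : (n < size p)%N by rewrite ltnNge; apply/negP => h; move: c0; rewrite nth_default // ltxx.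
have -> : size p = n.+1 by apply/eqP; rewrite eqn_leq sz szn.
split => //; apply/eqP => p0; move: c0; rewrite p0 coef0 ltxx //.
Qed.

End complex_polynomials.

(** * From logarithms of polynomials to the logarithm of a maximum *)

Section log_max_comparison.
Context {R : realType}.
Implicit Types (z t : R * R) (p q a : {poly R[i]}) (n : nat).

Section average.
Variables (nu : {measure set (R * R) -> \bar R}) (T : set (R * R)).
Hypotheses (cT : compact T) (nuT : nu (~` T) = 0%E) (nu1 : nu setT = 1%E).
Let mT : measurable T. Proof. exact: measurable_compact_plane. Qed.

Definition maxval (l : seq {poly R[i]}) z : R := \big[Num.max/0]_(a <- l) cabs (pval a z).

Lemma maxval_ge0 l z : 0 <= maxval l z.
Proof.
rewrite /maxval; elim: l => [|a l IH]; first by rewrite big_nil.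
by rewrite big_cons le_max IH orbT.
Qed.

Lemma measurable_maxval l : measurable_fun setT (maxval l).
Proof.
elim: l => [|a l IH].
  have -> : maxval [::] = cst 0 by apply/funext => z; rewrite /maxval big_nil.
  exact: measurable_cst.
have -> : maxval (a :: l) = (cabs \o pval a) \max maxval l.
  by apply/funext => z; rewrite /maxval big_cons.
apply: measurable_maxr => //.
exact: (measurableT_comp measurable_cabs (measurable_pval a)).
Qed.

Lemma bounded_maxval l : exists B : R, forall z, T z -> maxval l z <= B.
Proof.
elim: l => [|a l [B IH]]; first by exists 0 => z _; rewrite /maxval big_nil.
have [B' hB'] := bounded_pval a cT; exists (Num.max B' B) => z Tz.
rewrite /maxval big_cons ge_max !le_max hB' //=.
by rewrite IH // orbT.
Qed.

(* The coefficients of [q] are chosen one at a time in [0, 1]: for each [z] the mean over [s] in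
   [0, 1] of [log |p z + s (a z)|] is at least [log (max |p z| |a z|)] minus a constant, so some
   [s] is good for the [nu]-integral. *)
Lemma exists_poly_average n l p : pos_lead n p -> all (monic_like n) l ->
  exists2 q, pos_lead n q &
   (forall z, cabs (pval q z) <= cabs (pval p z) + \sum_(a <- l) cabs (pval a z)) /\
   (\int[nu]_z elog (Num.max (cabs (pval p z)) (maxval l z)) <=
    \int[nu]_z elog (cabs (pval q z)) + ((size l)%:R * (16 * ln 2 + 1))%:E)%E.
Proof.
elim: l p => [|a l IH] p gp.
  move=> _; exists p => //; split; first by move=> z; rewrite big_nil addr0.
  rewrite mul0r adde0; rewrite le_eqVlt; apply/orP; left; apply/eqP.
  apply: eq_integral => z _; rewrite /maxval big_nil (max_idPl _) //.
  exact: cabs_ge0.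
move=> /= /andP[ga gl].
have [Bp hBp] := bounded_pval p cT; have [Ba hBa] := bounded_pval a cT.
have [Bl hBl] := bounded_maxval l.
have [|s /andP[s0 s1] hs] := @exists_log_average R _ _ nu T 1 (Num.max (Num.max Bp Ba) Bl)
    (pval p) (pval a) (maxval l) mT nuT nu1 (measurable_pval p) (measurable_pval a)
    (measurable_maxval l) (maxval_ge0 l).
  move=> z Tz /=; rewrite !ge_max !le_max hBp // hBa // hBl // !orbT //.
pose p' := p + (Complex s 0) *: a.
have gp' : pos_lead n p'.
  move/andP: gp => [sp cp]; move/andP: ga => [sa ca].
  apply/andP; split.
    rewrite (leq_trans (size_polyD _ _)) // geq_max sp /=.
    exact: leq_trans (size_scale_leq _ _) sa.
  rewrite coefD coefZ; apply: ltr_pwDl => //; apply: mulr_ge0 => //.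
  by rewrite lecE /= eqxx.
have [q gq [hq1 hq2]] := IH p' gp' gl; exists q => //; split.
  move=> z; apply: (le_trans (hq1 z)); rewrite big_cons addrA lerD2r.
  rewrite /p' -pval_cdisp; apply: (le_trans (cabs_cdisp_le _ _ _)).
  by rewrite lerD2l (ger0_norm s0) ler_piMl ?cabs_ge0.
have -> : ((size (a :: l))%:R * (16 * ln 2 + 1))%:E =
   ((size l)%:R * (16 * ln 2 + 1))%:E + (16 * ln 2 * 1 + 1)%:E :> \bar R.
  by rewrite -EFinD /= -natr1; congr (_%:E); ring.
rewrite addeA.
apply: (le_trans _ (leeD hq2 (lexx _))).
apply: le_trans (le_trans hs _).
  rewrite le_eqVlt; apply/orP; left; apply/eqP; apply: eq_integral => z _.
  by rewrite /maxval big_cons maxA.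
apply: leeD => //; rewrite le_eqVlt; apply/orP; left; apply/eqP; apply: eq_integral => z _.
by rewrite pval_cdisp.
Qed.

(** The constant and the roots depend on [q] only. For two unit measures the constant therefore
    cancels and the comparison is made root by root, at the cost of the domination constant for each
    of the n roots. *)
Lemma integral_elog_poly n q : pos_lead n q ->
  exists2 A : R, 0 < A & exists2 r : seq (R * R), size r = n &
   forall (mu : {measure set (R * R) -> \bar R}) (S : set (R * R)),
     compact S -> mu (~` S) = 0%E -> mu setT = 1%E ->
     (\int[mu]_z elog (cabs (pval q z)) = (ln A)%:E + \sum_(t <- r) logpot mu t)%E.
Proof.
move=> /pos_lead_size[q0 szq]; have [A A0 [r szr hr]] := cabs_pval_factor q0.
exists A => //; exists r; first by rewrite szr.
move=> mu S cS muS mu1; have mS := measurable_compact_plane cS.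
have -> : (\int[mu]_z elog (cabs (pval q z)) =
    \int[mu]_z ((ln A)%:E + \sum_(t <- r) elog (cdist t z)))%E.
  apply: eq_integral => z _; rewrite hr elogM // elog_prod; last by move=> t; exact: cdist_ge0.
  by under eq_bigr do rewrite cdistC.
have B t : exists B : R, forall z, S z -> (elog (cdist t z) <= B%:E)%E.
  have [B B0 hB] := compact_bounded_plane t cS; exists (ln B) => z Sz.
  by apply: (le_trans (elog_le (hB _ Sz))); rewrite /elog ifF // leNgt B0.
have [B' hB'] : exists B' : R, forall z, S z -> (\sum_(t <- r) elog (cdist t z) <= B'%:E)%E.
  elim: r {szr hr} => [|j r [B' IH]]; first by exists 0 => t _; rewrite big_nil.
  have [Bj hBj] := B j; exists (Bj + B') => t St.
  by rewrite big_cons EFinD leeD ?hBj ?IH.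
rewrite (integralD_ub mS muS mu1 (B := ln A) (B' := B')) //; last first.
  by apply: emeasurable_sum => t; exact: measurable_elog_cdist.
rewrite integral_cst // mu1 mule1; congr (_ + _)%E.
rewrite (integral_sum_ub mS muS mu1) // => t; exact: measurable_elog_cdist.
Qed.

End average.

Variables (mu nu : {measure set (R * R) -> \bar R}) (S T : set (R * R)).
Hypotheses (cS : compact S) (muS : mu (~` S) = 0%E) (mu1 : mu setT = 1%E).
Hypotheses (cT : compact T) (nuT : nu (~` T) = 0%E) (nu1 : nu setT = 1%E).

Lemma integral_elog_poly_le n q (c : R) : pos_lead n q ->
  (forall z, (logpot nu z <= logpot mu z + c%:E)%E) ->
  (\int[nu]_z elog (cabs (pval q z)) <= \int[mu]_z elog (cabs (pval q z)) + (n%:R * c)%:E)%E.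
Proof.
move=> gq dom; have [A A0 [r szr hr]] := integral_elog_poly gq.
rewrite (hr _ _ cS muS mu1) (hr _ _ cT nuT nu1) -addeA; apply: leeD => //.
rewrite -szr; elim: r {szr hr} => [|t r IH]; first by rewrite !big_nil mul0r adde0.
rewrite !big_cons; apply: (le_trans (leeD (dom t) IH)).
by rewrite /= -natr1 mulrDl mul1r (addrC _ c) EFinD addeACA.
Qed.

Lemma bigmaxX n (I : Type) (r : seq I) (f : I -> R) : (0 < n)%N -> (forall i, 0 <= f i) ->
  \big[Num.max/0]_(i <- r) (f i ^+ n) = (\big[Num.max/0]_(i <- r) f i) ^+ n.
Proof.
move=> n0 f0; elim: r => [|i r IH]; first by rewrite !big_nil expr0n gtn_eqF.
have M0 : 0 <= \big[Num.max/0]_(j <- r) f j.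
  by elim: r {IH} => [|j r IH]; rewrite ?big_nil // big_cons le_max f0.
rewrite !big_cons IH; set x := f i; set y := \big[_/_]_(_ <- _) _.
have [xy|xy] := leP x y.
  by apply/max_idPr; apply: lerXn2r; rewrite ?nnegrE ?f0.
by apply/max_idPl; apply: lerXn2r; rewrite ?nnegrE ?f0 // ltW.
Qed.

(** With M the maximum, the n-th powers give the inequality multiplied by n up to the constant [K]:
    the m averaging steps cost 16 ln 2 + 1 each, and |q| <= (m + 1) M^n costs ln (m + 1). If no
    weight is positive, the left side is -oo. *)
Theorem integral_log_max_le m (w : 'I_m -> R) (c : 'I_m -> R * R) (C : R) :
  (forall k, 0 <= w k) -> (forall z, (logpot nu z <= logpot mu z + C%:E)%E) ->
  (\int[nu]_z elog (\big[Num.max/0]_(k < m) (w k * cdist z (c k)))%R <=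
   \int[mu]_z elog (\big[Num.max/0]_(k < m) (w k * cdist z (c k)))%R + C%:E)%E.
Proof.
move=> w0 dom.
pose M z := \big[Num.max/0]_(k < m) (w k * cdist z (c k)).
have M0 z : 0 <= M z.
  rewrite /M; elim: (index_enum _) => [|j r IH]; rewrite ?big_nil // big_cons le_max.
  by rewrite mulr_ge0 ?cdist_ge0.
have [[k0 wk0]|nw] := pselect (exists k, 0 < w k); last first.
  have -> : (\int[nu]_z elog (M z) = -oo)%E.
    rewrite (eq_integral (cst -oo%E)) => [|z _]; first by rewrite integral_cst // nu1 mule1.
    rewrite /elog ifT //; have : \big[Num.max/0]_(k < m) (w k * cdist z (c k)) <= 0.
      rewrite /M; elim: (index_enum _) => [|j r IH]; rewrite ?big_nil // big_cons ge_max IH andbT.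
      have -> : w j = 0 by apply/eqP; rewrite eq_le w0 andbT leNgt; apply/negP => h; apply: nw; exists j.
      by rewrite mul0r.
    by [].
  exact: leNye.
pose a n k : {poly R[i]} := (Complex (w k) 0) ^+ n *: ('X - (cz (c k))%:P) ^+ n.
have aE n k z : cabs (pval (a n k) z) = (w k * cdist z (c k)) ^+ n.
  rewrite /pval hornerZ horner_exp hornerXsubC cabs_pcM !cabs_pcX cabs_pc_real //.
  by rewrite cabs_pc_cdist exprMn; congr (_ * cdist _ _ ^+ _); case: (c k).
have cf n k : (a n k)`_n = Complex (w k ^+ n) 0 /\ (size (a n k) <= n.+1)%N.
  have sz : size (('X - (cz (c k))%:P) ^+ n : {poly R[i]}) = n.+1.
    by rewrite size_exp_XsubC.
  split; last by rewrite -[X in (_ <= X)%N]sz size_scale_leq.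
  rewrite coefZ; have /monicP := monic_exp n (monicXsubC (cz (c k))).
  rewrite lead_coefE sz /= => ->; rewrite mulr1.
  by rewrite -[Complex (w k) 0]/((w k)%:C)%C -rmorphXn.
have mlike n k : monic_like n (a n k).
  have [e1 e2] := cf n k; rewrite /monic_like e2 e1 lecE /= eqxx /=.
  exact: exprn_ge0.
have plead n : pos_lead n (a n k0).
  have [e1 e2] := cf n k0; rewrite /pos_lead e2 e1 ltcE /= eqxx /=.
  exact: exprn_gt0.
have mM : measurable_fun setT M.
  have -> : M = maxval [seq a 1 k | k <- index_enum 'I_m].
    apply/funext => z; rewrite /M /maxval big_map; apply: eq_bigr => k _.
    by rewrite aE expr1.
  exact: measurable_maxval.
have MB (S' : set (R * R)) : compact S' -> exists B : R, forall z, S' z -> (elog (M z) <= B%:E)%E.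
  move=> cS'; have [B hB] := bounded_maxval cS' [seq a 1 k | k <- index_enum 'I_m].
  exists (ln (`|B| + 1)) => z Sz.
  have : M z <= `|B| + 1.
    have -> : M z = maxval [seq a 1 k | k <- index_enum 'I_m] z.
      by rewrite /M /maxval big_map; apply: eq_bigr => k _; rewrite aE expr1.
    by apply: (le_trans (hB _ Sz)); have := ler_norm B; lra.
  move=> /elog_le /le_trans; apply; rewrite /elog ifF // leNgt.
  by have := normr_ge0 B => ?; apply/negbF; lra.
have melM : measurable_fun setT (fun z => elog (M z)).
  exact: (measurableT_comp measurable_elog mM).
pose K := m%:R * (16 * ln 2 + 1) + ln (m.+1%:R) : R.
(* The n-fold sum stands for multiplication by n, so that the value -oo needs no separate treatment
   yet. *)
have main n : (0 < n)%N ->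
  (\sum_(i < n) \int[nu]_z elog (M z) <= \sum_(i < n) \int[mu]_z elog (M z) + (n%:R * C + K)%:E)%E.
  move=> n0; set l := [seq a n k | k <- index_enum 'I_m].
  have [|q gq [hq1 hq2]] := exists_poly_average cT nuT nu1 (l := l) (plead n).
    by rewrite all_map; apply/allP => k _ /=; exact: mlike.
  have maxE z : Num.max (cabs (pval (a n k0) z)) (maxval l z) = M z ^+ n.
    have -> : maxval l z = M z ^+ n.
      rewrite /maxval /l big_map /M -bigmaxX // => [|k]; last by rewrite mulr_ge0 ?cdist_ge0.
      by apply: eq_bigr => k _; rewrite aE.
    apply/max_idPr; rewrite aE; apply: lerXn2r; rewrite ?nnegrE ?mulr_ge0 ?cdist_ge0 //.
    exact: (le_bigmax _ (fun k => w k * cdist z (c k)) k0).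
  have qle z : cabs (pval q z) <= m.+1%:R * M z ^+ n.
    apply: (le_trans (hq1 z)); rewrite -natr1 mulrDl mul1r addrC; apply: lerD.
      rewrite /l big_map; apply: (@le_trans _ _ (\sum_(k < m) M z ^+ n)).
        apply: ler_sum => k _; rewrite aE; apply: lerXn2r; rewrite ?nnegrE ?mulr_ge0 ?cdist_ge0 //.
        exact: (le_bigmax _ (fun k => w k * cdist z (c k)) k).
      by rewrite sumr_const card_ord mulr_natl.
    by rewrite -maxE le_max lexx.
  have sumE (rho : {measure set (R * R) -> \bar R}) (S' : set (R * R)) :
     compact S' -> rho (~` S') = 0%E -> rho setT = 1%E ->
     (\int[rho]_z elog (M z ^+ n) = \sum_(i < n) \int[rho]_z elog (M z))%E.
    move=> cS' r0 r1.
    rewrite -(integral_sum_ub (measurable_compact_plane cS') r0 r1) //; last by move=> _; exact: MB.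
    by apply: eq_integral => z _; rewrite elogX.
  rewrite -(sumE nu T) // -(sumE mu S) //.
  have -> : (\int[nu]_z elog (M z ^+ n) = \int[nu]_z elog (Num.max (cabs (pval (a n k0) z)) (maxval l z)))%E.
    by apply: eq_integral => z _; rewrite maxE.
  apply: (le_trans hq2).
  have h1 := integral_elog_poly_le gq dom.
  have h2 : (\int[mu]_z elog (cabs (pval q z)) <= (ln m.+1%:R)%:E + \int[mu]_z elog (M z ^+ n))%E.
    have mMn : measurable_fun setT (fun z => elog (M z ^+ n)).
      by apply: (measurableT_comp measurable_elog); exact: measurable_funX.
    have [B hB] : exists B : R, forall z, S z -> (elog (M z ^+ n) <= B%:E)%E.
      have [B hB] := MB _ cS; exists (n%:R * B) => z Sz.
      rewrite elogX //; apply: (@le_trans _ _ (\sum_(i < n) B%:E)%E).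
        by apply: lee_sum => i _; exact: hB.
      by rewrite sumEFin sumr_const card_ord lee_fin mulr_natl.
    apply: (@le_trans _ _ (\int[mu]_z ((ln m.+1%:R)%:E + elog (M z ^+ n)))%E).
      apply: measurable_le_integral => //.
      - apply: (measurableT_comp measurable_elog).
        exact: (measurableT_comp measurable_cabs (measurable_pval q)).
      - exact: emeasurable_funD.
      - by move=> z _; rewrite -elogM //; exact: elog_le.
    rewrite (integralD_ub (measurable_compact_plane cS) muS mu1 (B := ln m.+1%:R) (B' := B)) //.
    by rewrite integral_cst // mu1 mule1.
  apply: (le_trans (leeD h1 (lexx _))); apply: (le_trans (leeD (leeD h2 (lexx _)) (lexx _))).
  have -> : size l = m by rewrite size_map [index_enum _]unlock -enumT size_enum_ord.
  rewrite addeAC -addeA addeC /K -addeA.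
  case: (integral _ _ _) => [x| |]; rewrite ?leNye ?leey //.
  by rewrite -!EFinD lee_fin; lra.
have fin_u (rho : {measure set (R * R) -> \bar R}) (S' : set (R * R)) :
     compact S' -> rho (~` S') = 0%E -> rho setT = 1%E -> (\int[rho]_z elog (M z) < +oo)%E.
  move=> cS' r0 r1; have [B hB] := MB _ cS'.
  have := integral_ub_le (measurable_compact_plane cS') r0 r1 melM hB.
  by move=> /le_lt_trans; apply; exact: ltry.
rewrite -/(M) in main *.
have := fin_u _ _ cS muS mu1; have := fin_u _ _ cT nuT nu1.
move: main.
change (fun z => elog (\big[Num.max/0]_(k < m) (w k * cdist z (c k)))) with (fun z => elog (M z)).
case: (integral nu _ _) => [x| |] //; last by rewrite leNye.
case: (integral mu _ _) => [y| |] //; last first.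
  move=> /(_ 1%N erefl); rewrite !big_ord_recl !big_ord0 adde0 /=; done.
move=> main _ _; rewrite -EFinD lee_fin leNgt; apply/negP => lt.
have e0 : 0 < x - y - C by lra.
pose n := (Num.truncn (`|K| / (x - y - C))).+1.
have hn : `|K| < n%:R * (x - y - C).
  by rewrite -ltr_pdivrMr //; exact: truncnS_gt.
have := main n erefl; rewrite !sumEFin !sumr_const !card_ord -EFinD lee_fin.
rewrite -[x *+ n]mulr_natl -[y *+ n]mulr_natl; have := ler_norm K; lra.
Qed.

End log_max_comparison.

(** * The upper bound *)

Section extended_sums.
Context {R : realType}.
Local Open Scope ereal_scope.

(** The delicate case is b = +oo: one value of [f] other than -oo forces X = +oo, and otherwise the
    supremum is -oo and absorbs [b]. *)
Lemma ereal_sup_add_le (T : Type) (D : set T) (f : T -> \bar R) (b X : \bar R) :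
  (forall z, D z -> f z + b <= X) -> ereal_sup [set f z | z in D] + b <= X.
Proof.
case: b => [b| |] h.
- rewrite -leeBrDr //; apply: ge_ereal_sup => _ [z Dz <-].
  by rewrite leeBrDr //; exact: h.
- have [[z Dz fz]|nex] := pselect (exists2 z, D z & f z != -oo).
    by have := h _ Dz; rewrite addey // leye_eq => /eqP ->; rewrite leey.
  suff -> : ereal_sup [set f z | z in D] = -oo by rewrite leNye.
  apply/eqP; rewrite -leeNy_eq; apply: ge_ereal_sup => _ [z Dz <-].
  by rewrite leeNy_eq; apply/eqP; apply: contrapT => /eqP fz; apply: nex; exists z.
- by rewrite addeNy leNye.
Qed.

(** The suprema are opened one at a time; [b] carries, through the induction, the ones not yet
    opened. *)
Lemma sum_ereal_sup_le (T : Type) (D : set T) m (f : 'I_m -> T -> \bar R) (b X : \bar R) :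
  (forall c : 'I_m -> T, (forall k, D (c k)) -> \sum_(k < m) f k (c k) + b <= X) ->
  \sum_(k < m) ereal_sup [set f k z | z in D] + b <= X.
Proof.
elim: m f b => [|m IH] f b h.
  rewrite big_ord0; have := h (fun i : 'I_0 => let: Ordinal _ hi := i in match notF hi with end).
  by rewrite big_ord0; apply; case.
rewrite big_ord_recl [_ + \sum_(_ < _) _]addeC -addeA.
apply: (IH (fun k => f (lift ord0 k))) => c' hc'.
rewrite addeCA; apply: ereal_sup_add_le => z Dz.
pose c (k : 'I_m.+1) := if unlift ord0 k is Some j then c' j else z.
have : \sum_(k < m.+1) f k (c k) + b <= X.
  by apply: h => k; rewrite /c; case: unliftP.
rewrite big_ord_recl /c unlift_none -addeA.
by under eq_bigr do rewrite liftK.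
Qed.

End extended_sums.

(** * The sum of the measures of a family *)

Section finite_sum_of_measures.
Context {R : realType} (m : nat).
Variables (nu : 'I_m -> {measure set (R * R) -> \bar R}) (alpha : 'I_m -> R).
Hypothesis adm : admissible_family nu alpha.

(** [msum] takes a sequence indexed by nat, so the family is continued by the zero measure. *)
Let nuf (k : nat) : {measure set (R * R) -> \bar R} :=
  if insub k is Some j then nu j else mzero.

Definition family_sum : {measure set (R * R) -> \bar R} := msum nuf m.

Lemma family_sumE A : family_sum A = (\sum_(j < m) nu j A)%E.
Proof. by apply: eq_bigr => j _; rewrite /nuf valK. Qed.

Lemma family_sum_mass : family_sum setT = 1%E.
Proof.
have [_ h s] := adm; rewrite family_sumE -[1%E]/(1%:E) -s -sumEFin.
by apply: eq_bigr => j _; exact: h.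
Qed.

Lemma family_sum_support : exists2 T : set (R * R), compact T &
  family_sum (~` T) = 0%E /\ forall j, nu j (~` T) = 0%E.
Proof.
have [hK _ _] := adm.
have /choice[K hK'] : forall j, exists K, compact K /\ nu j (~` K) = 0%E by exact: hK.
pose T := \big[setU/set0]_(j < m) K j.
have cT : compact T.
  rewrite /T; elim: (index_enum _) => [|j r IH]; first by rewrite big_nil; exact: compact0.
  by rewrite big_cons; apply: compactU => //; have [] := hK' j.
have z j : nu j (~` T) = 0%E.
  apply/eqP; rewrite eq_le measure_ge0 andbT.
  have [cK K0] := hK' j; rewrite -K0; apply: le_measure; rewrite ?inE.
  - by apply: measurableC; exact: measurable_compact_plane.
  - by apply: measurableC; exact: measurable_compact_plane.
  - by apply: subsetC; rewrite /T (bigD1 j) //=; exact: subsetUl.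
exists T => //; split => //.
by rewrite family_sumE big1.
Qed.

Lemma integral_family_sum (T : set (R * R)) (f : R * R -> \bar R) (B : R) :
  compact T -> (forall j, nu j (~` T) = 0%E) -> measurable_fun setT f ->
  (forall t, T t -> (f t <= B%:E)%E) ->
  (\int[family_sum]_t f t = \sum_(j < m) \int[nu j]_t f t)%E.
Proof.
move=> cT T0 mf fB; have [_ hal _] := adm.
have mT := measurable_compact_plane cT.
have T0' : family_sum (~` T) = 0%E by rewrite family_sumE big1.
rewrite (integral_ubE mT T0' family_sum_mass mf fB).
have -> : (\sum_(j < m) \int[nu j]_t f t = \sum_(j < m)
   ((\int[nu j]_(t in T) B)%:E - \int[nu j]_(t in T) (B%:E - f t)))%E.
  by apply: eq_bigr => j _; rewrite (integral_ubE mT (T0 j) (hal j) mf fB).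
have f0 t : T t -> (0 <= B%:E - f t)%E.
  move=> Tt; have := fB _ Tt; case: (f t) => [r| |] //; last by rewrite /= leey.
  by rewrite lee_fin -EFinB lee_fin subr_ge0.
rewrite ge0_integral_measure_sum //; last by apply: measurable_funTS; exact: emeasurable_funB.
have -> : (\sum_(n < m) \int[nuf n]_(x in T) (B%:E - f x) =
    \sum_(j < m) \int[nu j]_(t in T) (B%:E - f t))%E.
  by apply: eq_bigr => j _; rewrite /nuf valK.
have -> : (\int[family_sum]_(t in T) B)%:E = (\sum_(j < m) (\int[nu j]_(t in T) B)%:E)%E.
  rewrite Rintegral_cst // EFinM fineK; last exact: (measure_fin family_sum_mass).
  rewrite family_sumE ge0_sume_distrr //; apply: eq_bigr => j _.
  by rewrite Rintegral_cst // EFinM fineK // (measure_fin (hal j)).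
elim: (index_enum _) => [|j r IH]; first by rewrite !big_nil sube0.
rewrite !big_cons -IH.
set I := (\int[nu j]_(t in T) (B%:E - f t))%E.
set J := (\sum_(j <- r) \int[nu j]_(t in T) (B%:E - f t))%E.
have I0 : (0 <= I)%E by exact: integral_ge0.
have J0 : (0 <= J)%E by apply: sume_ge0 => i _; exact: integral_ge0.
rewrite sumEFin; case: I I0 => [x| |] // _; case: J J0 => [y| |] // _.
by rewrite -!EFinD; congr (_%:E); lra.
Qed.

End finite_sum_of_measures.

Lemma measurable_continuous_plane {R : realType} (f : R * R -> R) :
  continuous f -> measurable_fun setT f.
Proof.
move=> cf; apply: (measurability _ (RGenOInfty.measurableE R)) => //.
move=> /= _ [_ [a ->] <-]; rewrite setTI; apply: measurable_open_plane.
apply: open_comp; first by move=> x _; exact: cf.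
by rewrite set_itvE; exact: open_gt.
Qed.

(** * Consequences of admissibility *)

Section admissible_weight.
Context {R : realType}.
Variables (E : set (R * R)) (w : R * R -> R).
Hypotheses (cE : closed E) (adm : admissible E w).

Lemma weight_ge0 z : E z -> 0 <= w z.
Proof. by have [h _ _ _] := adm; exact: h. Qed.

Lemma weight_bounded_compact K : compact K -> K `<=` E ->
  exists W : R, forall z, K z -> w z <= W.
Proof.
move=> /compact_near_coveringP ncK KE; have [_ usc _ _] := adm.
have := ncK R (pinfty_nbhs R) (fun W z => E z -> w z <= W) _.
case.
  move=> z Kz; have [d d0 hd] := usc _ (KE _ Kz) 1 ltr01.
  exists ([set t | cdist t z < d], [set W | w z + 1 <= W]) => /=.
    split; first by apply/nbhs_cdistP; exists d.
    by apply: nbhs_pinfty_ge; exact: num_real.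
  move=> [t W] /= [tz hW] Et; apply: le_trans hW; apply: ltW; exact: hd.
move=> W0 [_ hW]; exists (W0 + 1) => z Kz; apply: (hW (W0 + 1)) => //; last exact: KE.
by rewrite ltrDl.
Qed.

(** Upper semicontinuity bounds [w] on the part of E in a disc, and the decay of |z| w z bounds the
    rest when E is unbounded. This one estimate bounds both [w] and w t |z - t| for z in the disc of
    radius [R0], hence makes the farthest distance finite. *)
Lemma weight_growth (R0 : R) : 0 <= R0 ->
  exists2 W : R, 0 < W & forall z, E z -> w z * (cabs z + R0) <= W.
Proof.
move=> R00; have [_ _ _ gr] := adm.
have [M hM] : exists M : R, forall z, E z -> M < cabs z -> cabs z * w z < 1.
  have [[M hM]|nb] := pselect (exists M : R, forall z, E z -> cabs z <= M); last exact: gr.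
  by exists M => z Ez; rewrite ltNge hM.
pose M' := `|M| + 1; have M'1 : 1 <= M' by rewrite /M'; have := normr_ge0 M; lra.
pose K := E `&` [set z | cabs z <= M'].
have cK : compact K.
  apply: (@bounded_closed_compact_plane _ _ (0, 0) M').
    apply: closedI => //.
    apply/closed_cdistP => z hz /=; apply/ler_addgt0Pr => e e0.
    have [t /= ht tz] := hz e e0.
    rewrite !cabsE in ht *; have := cdist_triangle z t (0, 0); rewrite (cdistC z t); lra.
  by move=> t [_ /=]; rewrite cabsE cdistC.
have [W hW] : exists W : R, forall z, K z -> w z <= W.
  by apply: weight_bounded_compact => // z [].
have W0 : 0 <= `|W| * (M' + R0) by apply: mulr_ge0 => //; lra.
exists (1 + R0 + `|W| * (M' + R0)); first lra.
move=> z Ez; have w0 := weight_ge0 Ez; have c0 := cabs_ge0 z.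
have [zM|zM] := leP (cabs z) M'.
  have : w z <= `|W| by apply: (le_trans (hW _ (conj Ez zM))); exact: ler_norm.
  by have := normr_ge0 W; nra.
have : cabs z * w z < 1 by apply: hM => //; rewrite /M' in zM; have := ler_norm M; lra.
nra.
Qed.

Lemma weight_bounded : exists2 W : R, 0 < W & forall z, E z -> w z <= W.
Proof.
have [W W0 hW] := weight_growth (ler01 : 0 <= 1 :> R); exists W => // z Ez.
by have := hW _ Ez; have := cabs_ge0 z; have := weight_ge0 Ez; nra.
Qed.

Lemma weighted_dist_le z : exists B : R, forall t, E t -> w t * cdist z t <= B.
Proof.
have [W W0 hW] := weight_growth (cabs_ge0 z); exists W => t Et.
apply: (le_trans _ (hW _ Et)); apply: ler_wpM2l; first exact: weight_ge0.
have := cdist_triangle z (0, 0) t; rewrite !cabsE (cdistC (0, 0) t); lra.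
Qed.

Hypothesis E0 : E !=set0.

Definition fdist z : R := fine (farthest_dist E w z).

Lemma farthest_distE z : farthest_dist E w z = (fdist z)%:E.
Proof.
rewrite fineK // fin_numE; have [B hB] := weighted_dist_le z.
have le : (farthest_dist E w z <= B%:E)%E.
  by apply: ge_ereal_sup => _ [t Et <-]; rewrite lee_fin hB.
have [t0 Et0] := E0.
have ge : ((w t0 * cdist z t0)%:E <= farthest_dist E w z)%E.
  by apply: ereal_sup_ubound; exists t0.
by rewrite gt_eqF ?(lt_le_trans (ltNyr _) ge) // lt_eqF // (le_lt_trans le (ltry _)).
Qed.

Lemma fdist_ge z t : E t -> w t * cdist z t <= fdist z.
Proof.
move=> Et; rewrite -lee_fin -farthest_distE; apply: ereal_sup_ubound.
by exists t.
Qed.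

Lemma fdist_le z (x : R) : (forall t, E t -> w t * cdist z t <= x) -> fdist z <= x.
Proof.
move=> h; rewrite -lee_fin -farthest_distE; apply: ge_ereal_sup => _ [t Et <-].
by rewrite lee_fin h.
Qed.

Lemma fdist_ge0 z : 0 <= fdist z.
Proof.
have [t Et] := E0; apply: le_trans (fdist_ge z Et).
by rewrite mulr_ge0 ?weight_ge0 ?cdist_ge0.
Qed.

Lemma continuous_fdist : continuous fdist.
Proof.
have [W W0 hW] := weight_bounded.
apply: (@lipschitz_cdist_continuous _ _ W) => z u.
rewrite lerBlDl; apply: fdist_le => t Et; have w0 := weight_ge0 Et.
apply: (@le_trans _ _ (w t * cdist u t + w t * cdist z u)).
  rewrite -mulrDr; apply: ler_wpM2l => //.
  by have := cdist_triangle z u t; lra.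
apply: lerD; first exact: fdist_ge.
by apply: ler_wpM2r; [exact: cdist_ge0|exact: hW].
Qed.

Lemma eelog_farthest z : eelog (farthest_dist E w z) = elog (fdist z).
Proof. by rewrite farthest_distE. Qed.

Lemma measurable_elog_fdist : measurable_fun setT (fun z => elog (fdist z)).
Proof.
apply: (measurableT_comp measurable_elog); apply: measurable_continuous_plane.
exact: continuous_fdist.
Qed.

Definition wmax m (c : 'I_m -> R * R) z : R := \big[Num.max/0]_(k < m) (w (c k) * cdist z (c k)).

Lemma wmax_ge m (c : 'I_m -> R * R) z k : w (c k) * cdist z (c k) <= wmax c z.
Proof. exact: (le_bigmax _ (fun k => w (c k) * cdist z (c k)) k). Qed.

Lemma wmax_le m (c : 'I_m -> R * R) z (x : R) : 0 <= x ->
  (forall k, w (c k) * cdist z (c k) <= x) -> wmax c z <= x.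
Proof. by move=> x0 h; apply/bigmax_leP; split. Qed.

Lemma wmax_ge0 m (c : 'I_m -> R * R) z : (forall k, E (c k)) -> 0 <= wmax c z.
Proof.
move=> Ec; rewrite /wmax; elim: (index_enum _) => [|k r IH]; first by rewrite big_nil.
by rewrite big_cons le_max IH orbT.
Qed.

Lemma wmax_le_fdist m (c : 'I_m -> R * R) z : (forall k, E (c k)) -> wmax c z <= fdist z.
Proof. by move=> Ec; apply: wmax_le; [exact: fdist_ge0|move=> k; exact: fdist_ge]. Qed.

Lemma continuous_wmax m (c : 'I_m -> R * R) : (forall k, E (c k)) -> continuous (wmax c).
Proof.
move=> Ec; have [W W0 hW] := weight_bounded.
apply: (@lipschitz_cdist_continuous _ _ W) => z u.
rewrite lerBlDl; apply: wmax_le.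
  by rewrite addr_ge0 ?wmax_ge0 // mulr_ge0 ?cdist_ge0 // ltW.
move=> k; have w0 := weight_ge0 (Ec k).
apply: (@le_trans _ _ (w (c k) * cdist u (c k) + w (c k) * cdist z u)).
  rewrite -mulrDr; apply: ler_wpM2l => //.
  by have := cdist_triangle z u (c k); lra.
apply: lerD; first exact: wmax_ge.
by apply: ler_wpM2r; [exact: cdist_ge0|exact: hW].
Qed.

Lemma measurable_elog_wmax m (c : 'I_m -> R * R) : (forall k, E (c k)) ->
  measurable_fun setT (fun z => elog (wmax c z)).
Proof.
move=> Ec; apply: (measurableT_comp measurable_elog).
by apply: measurable_continuous_plane; exact: continuous_wmax.
Qed.

Lemma elog_fdist_bounded K : compact K ->
  exists B : R, forall z, K z -> (elog (fdist z) <= B%:E)%E.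
Proof.
move=> cK; have [B B0 hB] := compact_bounded_plane (0, 0) cK.
have [W W0 hW] := weight_growth (ltW B0).
exists (ln W) => z Kz; have : fdist z <= W.
  apply: fdist_le => t Et; apply: (le_trans _ (hW _ Et)).
  apply: ler_wpM2l; first exact: weight_ge0.
  have := cdist_triangle z (0, 0) t; rewrite !cabsE (cdistC (0, 0) t) (cdistC z (0, 0)).
  by have := hB _ Kz; lra.
by move=> /elog_le /le_trans; apply; rewrite /elog ifF // leNgt W0.
Qed.

End admissible_weight.

(** * The two inequalities *)

Section inequalities.
Context {R : realType}.
Variables (E : set (R * R)) (w : R * R -> R).
Variables (mu : {measure set (R * R) -> \bar R}) (F : R).
Hypotheses (cE : closed E) (adm : admissible E w) (eqm : weighted_equilibrium E w mu F).

Lemma equilibrium_mass : mu setT = 1%E. Proof. by have [] := eqm. Qed.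

(** Either w z = 0 or an infinite potential would make the left side of the equilibrium inequality
    -oo, so both are excluded on S; unit mass makes S nonempty. *)
Lemma equilibrium_support : exists S : set (R * R), [/\ compact S, S `<=` E, mu (~` S) = 0%E,
  S !=set0 & forall z, S z -> [/\ 0 < w z, logpot mu z \is a fin_num &
     (- ((ln (w z) + F)%:E) <= logpot mu z)%E]].
Proof.
have [mu1 [[S [cS SE S0 hS]] _]] := eqm; exists S; split => //.
  apply/set0P/negP => /eqP Se; move: S0; rewrite Se setC0 mu1 => /eqP.
  by rewrite eqe oner_eq0.
move=> z Sz; have := hS _ Sz; have := logpot_lty cS S0 mu1 z.
rewrite /elog; case: ifPn => [w0|]; first by case: (logpot mu z).
rewrite -ltNge => w0; case: (logpot mu z) => [r| |] //= _.
by rewrite -!EFinD !lee_fin => h; split => //; rewrite lerNl; lra.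
Qed.

Lemma weight_domain_nonempty : E !=set0.
Proof. by have [S [_ SE _ [z Sz] _]] := equilibrium_support; exists z; exact: SE. Qed.

Lemma CEwm_le_CEw m : (CEwm E w mu F m <= CEw E w mu F)%E.
Proof.
have E0 := weight_domain_nonempty.
apply: leeD => //; apply: ge_ereal_sup => _ [c /= Ec <-].
have -> : (\int[mu]_z eelog (farthest_dist E w z) = \int[mu]_z elog (fdist E w z))%E.
  by apply: eq_integral => z _; rewrite eelog_farthest.
apply: measurable_le_integral => //.
- exact: (measurable_elog_wmax cE adm Ec).
- exact: (measurable_elog_fdist cE adm E0).
- by move=> z _; apply: elog_le; exact: wmax_le_fdist.
Qed.

Lemma CEw_lty : (CEw E w mu F < +oo)%E.
Proof.
have E0 := weight_domain_nonempty; have [S [cS SE S0 _ _]] := equilibrium_support.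
have [B hB] := elog_fdist_bounded cE adm E0 cS.
rewrite lte_add_pinfty ?ltry //.
have -> : (\int[mu]_z eelog (farthest_dist E w z) = \int[mu]_z elog (fdist E w z))%E.
  by apply: eq_integral => z _; rewrite eelog_farthest.
apply: le_lt_trans (ltry (B * 1)).
apply: (integral_ub_le (measurable_compact_plane cS) S0 equilibrium_mass) => //.
exact: (measurable_elog_fdist cE adm E0).
Qed.

(** Taking all c_k equal to one point z0 of S gives ln w(z0) plus the potential at z0, which is at
    least - F. With [CEw_lty] this makes the constant a real number, which matters when the supremum
    of the product is infinite. *)
Lemma CEwm_gtNy m : (0 < m)%N -> (-oo < CEwm E w mu F m)%E.
Proof.
move=> m0; have [S [cS SE S0 [z0 Sz0] hS]] := equilibrium_support.
have [w0 fz h] := hS _ Sz0.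
have : ((- F)%:E <= ereal_sup [set \int[mu]_z
        elog (\big[Num.max/0]_(k < m) (w (c k) * cdist z (c k)))%R
      | c in [set c : 'I_m -> R * R | forall k, E (c k)]])%E.
  apply: (@le_trans _ _ (\int[mu]_z elog (w z0 * cdist z0 z))%E); last first.
    apply: ereal_sup_ubound; exists (fun=> z0) => /=; first by move=> _; exact: SE.
    apply: eq_integral => z _; congr elog; case: m m0 => // m _.
    apply/eqP; rewrite eq_le; apply/andP; split.
      by apply: (wmax_le (c := fun=> z0)) => [|k]; rewrite ?mulr_ge0 ?cdist_ge0 ?(ltW w0) // cdistC.
    by rewrite (cdistC z0); exact: (wmax_ge w (fun _ : 'I_m.+1 => z0) z ord0).
  have -> : (\int[mu]_z elog (w z0 * cdist z0 z) = \int[mu]_z ((ln (w z0))%:E + elog (cdist z0 z)))%E.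
    by apply: eq_integral => z _; rewrite elogM.
  have [B B0 hB] := compact_bounded_plane z0 cS.
  rewrite (integralD_ub (measurable_compact_plane cS) S0 equilibrium_mass (B := ln (w z0)) (B' := ln B)) //.
  - rewrite integral_cst // equilibrium_mass mule1 -/(logpot mu z0).
    move: h fz; case: (logpot mu z0) => [r| |] // ; rewrite -EFinN -EFinD !lee_fin; lra.
  - exact: measurable_elog_cdist.
  - by move=> t St; apply: (le_trans (elog_le (hB _ St))); rewrite /elog ifF // leNgt B0.
rewrite /CEwm; case: (ereal_sup _) => [r| |] // _; exact: ltNyr.
Qed.

(** The left side is the [nu]-integral of log (w(c_j) |z - c_j|), one of the functions under the
    maximum. For zero mass, the convention that 0 times -oo is 0 makes both sides vanish. *)
Lemma weighted_term_le (nu : {measure set (R * R) -> \bar R}) (T : set (R * R)) (a : R)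
    m (c : 'I_m -> R * R) j :
  compact T -> nu (~` T) = 0%E -> nu setT = a%:E -> (forall k, E (c k)) ->
  (a%:E * elog (w (c j)) + logpot nu (c j) <= \int[nu]_z elog (wmax w c z))%E.
Proof.
move=> cT nuT nua Ec; have mT := measurable_compact_plane cT.
have a0 : 0 <= a by exact: (concentrated_mass_ge0 nua).
have w0 := weight_ge0 adm (Ec j).
move: a0; rewrite le_eqVlt => /orP[/eqP a0|a0].
  rewrite -a0 in nua *; rewrite mul0e add0e /logpot !null_set_integral //.
    exact: (measurable_elog_wmax cE adm Ec).
  exact: measurable_elog_cdist.
move: w0; rewrite le_eqVlt => /orP[/eqP wj|wj].
  by rewrite -wj [elog 0]/elog lexx gt0_muleNy ?lte_fin // addNye leNye.
have [B B0 hB] := compact_bounded_plane (c j) cT.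
have -> : (a%:E * elog (w (c j)) + logpot nu (c j) =
    \int[nu]_z ((ln (w (c j)))%:E + elog (cdist (c j) z)))%E.
  rewrite (integralD_ub mT nuT nua (B := ln (w (c j))) (B' := ln B)) //.
  - by rewrite integral_cst // nua -EFinM mulrC /elog ifF ?EFinM // leNgt wj.
  - exact: measurable_elog_cdist.
  - by move=> t St; apply: (le_trans (elog_le (hB _ St))); rewrite /elog ifF // leNgt B0.
apply: measurable_le_integral => //.
- by apply: emeasurable_funD => //; exact: measurable_elog_cdist.
- exact: (measurable_elog_wmax cE adm Ec).
- by move=> z _; rewrite -elogM //; apply: elog_le; rewrite cdistC; exact: wmax_ge.
Qed.

Theorem lhs_sum_le m (nu : 'I_m -> {measure set (R * R) -> \bar R}) (alpha : 'I_m -> R) :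
  admissible_family nu alpha ->
  (lhs_sum E w nu alpha <= CEwm E w mu F m + sup_prod E w nu)%E.
Proof.
move=> fam; have [_ hal sal] := fam; have E0 := weight_domain_nonempty.
have m0 : (0 < m)%N.
  by case: m nu alpha fam hal sal => // nu alpha _ _; rewrite big_ord0 => /eqP; rewrite eq_sym oner_eq0.
have [T cT [fT T0]] := family_sum_support fam.
have f1 := family_sum_mass fam.
have [S [cS SE S0 S'0 hS]] := equilibrium_support.
have [W W0 hW] := weight_bounded cE adm.
(* The supremum may be -oo, so the argument is run with an arbitrary real upper bound [t] of it. *)
have bound (t : R) : (sup_prod E w nu <= t%:E)%E -> (lhs_sum E w nu alpha <= CEwm E w mu F m + t%:E)%E.
  move=> ht.
  have logpotE z : (logpot (family_sum nu) z = \sum_(j < m) logpot (nu j) z)%E.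
    have [B B0 hB] := compact_bounded_plane z cT.
    apply: (integral_family_sum fam (T := T) (B := ln B)) => //; first exact: measurable_elog_cdist.
    by move=> s Ts; apply: (le_trans (elog_le (hB _ Ts))); rewrite /elog ifF // leNgt B0.
  have dom : forall z, (logpot (family_sum nu) z <= logpot mu z + (t + F)%:E)%E.
    (* On S the potential of [mu] is at least - ln w - F, and [W] bounds [w]: this is the uniform
       lower bound that the domination principle requires. *)
    apply: (domination_principle (C0 := ln W + F) cS S0 equilibrium_mass cT fT f1).
      move=> z Sz; have [w0 _ h] := hS _ Sz; apply: le_trans h.
      rewrite -EFinN lee_fin lerN2 lerD2r ler_ln ?posrE //.
      by apply: hW; exact: SE.
    move=> z Sz; have [w0 fz h] := hS _ Sz.
    have : (elog (w z) + \sum_(j < m) logpot (nu j) z <= t%:E)%E.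
      apply: le_trans ht; apply: ereal_sup_ubound; exists z => //.
      exact: SE.
    rewrite logpotE {1}/elog ifF; last by rewrite leNgt w0.
    move: h fz; case: (logpot mu z) => [r| |] // h _.
    case: (\sum_(_ < _) _)%E => [x| |] //; last by move=> _; exact: leNye.
    by move: h; rewrite -EFinN -!EFinD !lee_fin; lra.
  rewrite -[lhs_sum _ _ _ _]adde0; apply: sum_ereal_sup_le => c Ec; rewrite adde0.
  apply: (@le_trans _ _ (\int[family_sum nu]_z elog (wmax w c z))%E).
    have [B hB] := elog_fdist_bounded cE adm E0 cT.
    rewrite (integral_family_sum fam (T := T) (B := B)) //.
    - apply: lee_sum => j _; exact: (weighted_term_le j cT (T0 j) (hal j) Ec).
    - exact: (measurable_elog_wmax cE adm Ec).
    - move=> z Tz; apply: le_trans (hB _ Tz); apply: elog_le; exact: (wmax_le_fdist cE adm E0).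
  have wc0 k : 0 <= w (c k) by exact: (weight_ge0 adm).
  apply: (le_trans (integral_log_max_le cS S0 equilibrium_mass cT fT f1 c wc0 dom)).
  rewrite (addrC t F) EFinD addeA; apply: leeD => //; apply: leeD => //.
  by apply: ereal_sup_ubound; exists c.
(* For a supremum equal to -oo, arbitrarily negative [t] force the left side to be -oo; for +oo the
   right side is +oo because the constant is finite. *)
have := CEwm_gtNy m0; have := le_lt_trans (CEwm_le_CEw m) CEw_lty.
move: bound; case: (sup_prod E w nu) => [r| |] bound.
- by move=> _ _; exact: bound.
- by case: (CEwm _ _ _ _ _) => [r| |] // _ _; rewrite leey.
- case: (CEwm _ _ _ _ _) bound => [r| |] // bound _ _.
  rewrite addeNy; move: bound; case: (lhs_sum _ _ _ _) => [x| |] bound //.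
    by exfalso; have := bound (x - 1 - r) (leNye _); rewrite -EFinD lee_fin; lra.
  by have := bound 0 (leNye _).
Qed.

End inequalities.

(** * Compact sets of capacity zero *)

Section separating_bits.
Context {R : realType}.
Variable B : R.

(* The half planes [x.1 < q] and [x.2 < q], for rational offsets from [- B], enumerated. *)
Definition sbit (i : nat) (x : R * R) : bool :=
  if (unpickle i : option (nat * nat * bool)) is Some (n, j, b) then
    (if b then x.1 else x.2) < - B + j%:R / n.+1%:R
  else false.

Lemma sbit_separates (e : R) : 0 < e -> exists k, forall x y : R * R,
  cdist (0, 0) x <= B -> cdist (0, 0) y <= B ->
  (forall i, (i < k)%N -> sbit i x = sbit i y) -> cdist x y < e.
Proof.
move=> e0; have [n] := ltr_add_invr (divr_gt0 e0 (ltr0Sn R 1)); rewrite add0r => hn.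
pose J := Num.truncn (2 * B * n.+1%:R).
pose k := (\max_(j < J.+1) \max_(b : bool) pickle (n, nat_of_ord j, b)).+1.
have N0 : 0 < n.+1%:R :> R by [].
have aux (fx fy u v b : R) : v < fy - fx -> fy + b < u + v -> fx < - b + u by lra.
have step (b : bool) (x y : R * R) :
    let f (z : R * R) := if b then z.1 else z.2 in
    f x <= B -> - B <= f x -> f y <= B -> - B <= f y ->
    (forall i, (i < k)%N -> sbit i x = sbit i y) -> f y - f x <= n.+1%:R^-1.
  move=> f fx1 fx2 fy1 fy2 h; rewrite leNgt; apply/negP => lt.
  pose j := Num.truncn ((f y + B) * n.+1%:R).
  have y0 : 0 <= (f y + B) * n.+1%:R by apply: mulr_ge0 => //; lra.
  have j1 : j%:R <= (f y + B) * n.+1%:R by rewrite truncn_le.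
  have j2 : (f y + B) * n.+1%:R < j.+1%:R by exact: truncnS_gt.
  have jJ : (j < J.+1)%N.
    rewrite ltnS; apply: le_truncn; apply: ler_wpM2r => //; lra.
  have jk : (pickle (n, j, b) < k)%N.
    rewrite ltnS; apply: leq_trans (leq_bigmax (Ordinal jJ)).
    exact: (leq_bigmax (F := fun b => pickle (n, j, b)) b).
  have := h _ jk; rewrite /sbit pickleK -/(f x) -/(f y).
  have -> : f y < - B + j%:R / n.+1%:R = false.
    apply/negbTE; rewrite -leNgt.
    have : j%:R / n.+1%:R <= f y + B by rewrite ler_pdivrMr.
    by move: (f y) (_ / _) => u v; lra.
  have -> // : f x < - B + j%:R / n.+1%:R.
  have : f y + B < j.+1%:R / n.+1%:R by rewrite ltr_pdivlMr.
  have -> : j.+1%:R / n.+1%:R = j%:R / n.+1%:R + n.+1%:R^-1 :> R.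
    by rewrite -(natr1 j) mulrDl mul1r.
  exact: aux lt.
exists k => x y hx hy h.
have /ler_normlP[] := le_trans (fst_le_cdist (0, 0) x) hx => /= x1 x2.
have /ler_normlP[] := le_trans (snd_le_cdist (0, 0) x) hx => /= x3 x4.
have /ler_normlP[] := le_trans (fst_le_cdist (0, 0) y) hy => /= y1 y2.
have /ler_normlP[] := le_trans (snd_le_cdist (0, 0) y) hy => /= y3 y4.
have h' i : (i < k)%N -> sbit i y = sbit i x by move=> /h.
apply: (le_lt_trans (cdist_le_sum x y)); rewrite (splitr e); apply: ltrD; apply: le_lt_trans hn.
  apply/ler_normlP; split.
    by rewrite opprB; apply: (step true x y) => //=; lra.
  by apply: (step true y x) => //=; lra.
apply/ler_normlP; split.
  by rewrite opprB; apply: (step false x y) => //=; lra.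
by apply: (step false y x) => //=; lra.
Qed.

(** The newest bit is the head, so the two refinements of a word [v] are [true :: v] and
    [false :: v]. *)
Fixpoint scode (k : nat) (x : R * R) : seq bool :=
  if k is k'.+1 then sbit k' x :: scode k' x else [::].

Lemma size_scode k x : size (scode k x) = k.
Proof. by elim: k => //= k ->. Qed.

Lemma scode_sbit k x y : scode k x = scode k y -> forall i, (i < k)%N -> sbit i x = sbit i y.
Proof.
elim: k => //= k IH [h1 h2] i; rewrite ltnS leq_eqVlt => /orP[/eqP ->//|]; exact: IH.
Qed.

Lemma scode_le k l x y : (k <= l)%N -> scode l x = scode l y -> scode k x = scode k y.
Proof.
elim: l => [|l IH]; first by rewrite leqn0 => /eqP ->.
rewrite leq_eqVlt => /orP[/eqP -> //|]; rewrite ltnS => kl /= [_]; exact: IH.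
Qed.

End separating_bits.

(** * Realising consistent masses of binary words by intervals *)

Section nested_masses.
Context {R : realType}.
Variable p : seq bool -> R.
Hypotheses (p_ge0 : forall v, 0 <= p v) (p_nil : p [::] = 1).
Hypothesis p_split : forall v, p v = p (true :: v) + p (false :: v).

Fixpoint start (v : seq bool) : R :=
  if v is b :: v' then start v' + (if b then p (false :: v') else 0) else 0.

(* [start v, start v + p v[ are nested intervals partitioning [0, 1[ at each length, and
   [sword s k] is the word of length [k] whose interval contains [s]. *)
Fixpoint sword (s : R) (k : nat) : seq bool :=
  if k is k'.+1 then
    let v := sword s k' in (start v + p (false :: v) <= s) :: v
  else [::].

Lemma size_sword s k : size (sword s k) = k.
Proof. by elim: k => //= k ->. Qed.

Lemma sword_itv s k : 0 <= s < 1 -> start (sword s k) <= s < start (sword s k) + p (sword s k).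
Proof.
move=> s01; elim: k => [|k] /=; first by rewrite p_nil add0r.
set v := sword s k => /andP[h1 h2]; have := p_split v.
have [h|h] := leP (start v + p (false :: v)) s => hs.
  by rewrite h /=; move: h2; rewrite hs; lra.
by rewrite addr0 h1 h.
Qed.

Lemma sword_gt0 s k : 0 <= s < 1 -> 0 < p (sword s k).
Proof. by move=> /(sword_itv k)/andP[]; lra. Qed.

Lemma start_ge0 v : 0 <= start v /\ start v + p v <= 1.
Proof.
elim: v => [|b v [h1 h2]] /=; first by rewrite p_nil add0r.
have := p_split v; have := p_ge0 (true :: v); have := p_ge0 (false :: v).
by case: b => ? ? ?; split; lra.
Qed.

Lemma sword_unique s v : start v <= s < start v + p v -> sword s (size v) = v.
Proof.
elim: v => //= b v IH; have := p_split v; have pt := p_ge0 (true :: v).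
have pf := p_ge0 (false :: v) => hv /andP[h1 h2].
have -> : sword s (size v) = v by apply: IH; apply/andP; case: b h1 h2 => *; split; lra.
by congr (_ :: _); case: b h1 h2 => h1 h2; [apply/idP; lra|apply/negbTE; rewrite -ltNge; lra].
Qed.

(** Quantifying over all [g] lets the induction hypothesis also serve the threshold
    [start v + p (false :: v)], itself a function of the word. *)
Lemma measurable_sword (g : seq bool -> R) k : measurable_fun setT (fun s => g (sword s k)).
Proof.
elim: k g => [|k IH] g /=; first exact: measurable_cst.
rewrite [X in measurable_fun _ X](_ : _ = fun s =>
  if start (sword s k) + p (false :: sword s k) <= s then g (true :: sword s k)
  else g (false :: sword s k)); last by apply/funext => s; case: ifP.
apply: measurable_fun_if => //.
- apply: measurable_fun_ler => //; exact: (IH (fun v => start v + p (false :: v))).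
- by apply: measurable_funTS; exact: (IH (fun v => g (true :: v))).
- by apply: measurable_funTS; exact: (IH (fun v => g (false :: v))).
Qed.

(** The numbers s with word [v] form the interval from [start v] to [start v + p v]: under Lebesgue
    measure the random word has law [p]. *)
Lemma integral_sword (g : seq bool -> R) k :
  (\int[lebesgue_measure]_(s in `[0%R, 1%R[) (g (sword s k))%:E =
   (\sum_(v : k.-tuple bool) p v * g v)%:E)%E.
Proof.
pose I (v : k.-tuple bool) : set R := `[start v, start v + p v[%classic.
have step (s : R) : s \in `[0%R, 1%R[%classic -> (g (sword s k))%:E =
   (\sum_(v : k.-tuple bool) (g v)%:E * (\1_(I v) s)%:E)%E.
  move=> /set_mem /=; rewrite in_itv /= => s01.
  have sz : size (sword s k) == k by rewrite size_sword.
  under eq_bigr do rewrite -EFinM.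
  rewrite sumEFin (bigD1 (Tuple sz)) //= indicE mem_set ?mulr1; last first.
    by rewrite /I /= in_itv /=; exact: sword_itv.
  rewrite big1 ?addr0 // => v nv; rewrite indicE memNset ?mulr0 // /I /= in_itv /=.
  move=> /sword_unique; rewrite size_tuple => h; move/eqP: nv; apply.
  by apply: val_inj.
have iI v : lebesgue_measure.-integrable `[0%R, 1%R[%classic (EFin \o \1_(I v)).
  apply: (@integrableS _ _ _ _ setT) => //.
  exact: (integrable_indic_itv (start v) (start v + p v) true true).
transitivity (\int[lebesgue_measure]_(s in `[0%R, 1%R[)
    (\sum_(v : k.-tuple bool) (g v)%:E * (\1_(I v) s)%:E))%E; first exact: eq_integral.
rewrite integral_sum //; last by move=> v; apply: (integrableZl _ _ (iI v)).
rewrite -sumEFin; apply: eq_bigr => v _.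
rewrite (integralZl _ (iI v)) //.
have -> : (\int[lebesgue_measure]_(s in `[0%R, 1%R[) (EFin \o \1_(I v)) s =
    lebesgue_measure (I v `&` `[0%R, 1%R[))%E.
  by apply: integral_indic => //; exact: measurable_itv.
have -> : I v `&` `[0%R, 1%R[ = I v.
  apply/setIidPl => s; rewrite /I /= !in_itv /= => /andP[h1 h2].
  by have [h3 h4] := start_ge0 v; apply/andP; split; lra.
rewrite lebesgue_measure_itv /= lte_fin ltrDl.
have := p_ge0 v; rewrite le_eqVlt => /orP[/eqP <-|pv].
  by rewrite ltxx mule0 mul0r.
by rewrite pv -EFinB -EFinM; congr (_%:E); ring.
Qed.

End nested_masses.

Lemma integral_mrestr d (T : measurableType d) {R : realType} (mu : {measure set T -> \bar R})
    (D : set T) (mD : measurable D) (f : T -> \bar R) : measurable_fun setT f ->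
  (\int[mrestr mu mD]_t f t = \int[mu]_(t in D) f t)%E.
Proof.
move=> mf; rewrite (@integral_setI_conull _ _ _ (mrestr mu mD) setT D) //; last first.
  by rewrite /= /mrestr setICl measure0.
rewrite setTI; apply: eq_measure_integral => A mA AD.
rewrite /= /mrestr; congr (mu _); exact/setIidPl.
Qed.

(** * Limit frequencies of a sequence of points *)

Section empirical_limit.
Context {R : realType}.
Variables (B : R) (z : nat -> R * R).

(** The empirical measure of the first [n] points, seen on the cells of the codes. *)
Definition emp n (v : seq bool) : R := (\sum_(i < n) (scode B (size v) (z i) == v)%:R) / n%:R.

Lemma emp_ge0 n v : 0 <= emp n v.
Proof. by rewrite divr_ge0 // sumr_ge0. Qed.

Lemma emp_le1 n v : emp n v <= 1.
Proof.
rewrite /emp; case: n => [|n]; first by rewrite big_ord0 mul0r.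
rewrite ler_pdivrMr // mul1r; apply: (@le_trans _ _ (\sum_(i < n.+1) 1)).
  by apply: ler_sum => i _; rewrite lern1; case: eqP.
by rewrite sumr_const card_ord.
Qed.

Lemma emp_split n v : emp n v = emp n (true :: v) + emp n (false :: v).
Proof.
rewrite /emp -mulrDl -big_split /=; congr (_ / _); apply: eq_bigr => i _.
rewrite !eqseq_cons; case: (sbit _ _ _) => /=; by rewrite ?addr0 ?add0r.
Qed.

Lemma emp_nil n : (0 < n)%N -> emp n [::] = 1.
Proof.
move=> n0; rewrite /emp /= (eq_bigr (fun=> 1)) // sumr_const card_ord divff //.
by rewrite pnatr_eq0 -lt0n.
Qed.

Lemma sum_emp n k (g : seq bool -> R) : (0 < n)%N ->
  \sum_(v : k.-tuple bool) emp n v * g v = (\sum_(i < n) g (scode B k (z i))) / n%:R.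
Proof.
move=> n0; under eq_bigr do rewrite /emp size_tuple mulrAC mulr_suml.
rewrite -mulr_suml exchange_big /=; congr (_ / _); apply: eq_bigr => i _.
have sz : size (scode B k (z i)) == k by rewrite size_scode.
rewrite (bigD1 (Tuple sz)) //= eqxx mul1r big1 ?addr0 // => v nv.
suff -> : scode B k (z i) == v = false by rewrite mul0r.
by apply/negbTE; apply: contra nv => /eqP h; apply/eqP; apply: val_inj.
Qed.

(** The frequencies live in a product of copies of [0, 1], compact by Tychonoff. A cluster point in
    the product topology is approached on finitely many words at a time, for arbitrarily large n; no
    subsequence is extracted. *)
Lemma emp_cluster : exists p : seq bool -> R, forall (vs : seq (seq bool)) (e : R) (N : nat),
  0 < e -> exists2 n, (N < n)%N & forall v, v \in vs -> `|emp n v - p v| < e.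
Proof.
have cpt := @tychonoff (seq bool) (fun=> R) (fun=> `[0, 1]%classic) (fun=> @segment_compact R 0 1).
pose Fl : set_system (prod_topology (fun _ : seq bool => R)) := fmap emp \oo.
have PF : ProperFilter Fl by exact: fmap_proper_filter.
have [|p [_ pcl]] := cpt Fl PF.
  by exists 0%N => // n _ v /=; rewrite in_itv /= emp_ge0 emp_le1.
exists p => vs e N e0.
have nb : nbhs (p : prod_topology (fun _ : seq bool => R))
    [set f : prod_topology (fun _ : seq bool => R) | forall v, v \in vs -> `|f v - p v| < e].
  elim: vs => [|v vs IH]; first by apply: filterE => f v; rewrite in_nil.
  have nv : nbhs (p : prod_topology (fun _ : seq bool => R))
      [set f : prod_topology (fun _ : seq bool => R) | `|f v - p v| < e].
    have := @proj_continuous (seq bool) (fun=> R) v p [set x : R | `|x - p v| < e].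
    apply; apply/nbhs_ballP; exists e => //= x; rewrite /ball /= distrC //.
  apply: filterS (filterI nv IH) => f /= [h1 h2] u; rewrite inE => /orP[/eqP -> //|].
  exact: h2.
have FN : Fl [set emp n | n in [set n | (N < n)%N]].
  by exists N.+1 => // n /= Nn; exists n.
by have [_ [[n /= Nn <-] h]] := pcl _ _ FN nb; exists n.
Qed.

End empirical_limit.

Section limit_measure.
Context {R : realType}.
Variables (K : set (R * R)) (z : nat -> R * R).
Hypotheses (cK : compact K) (zK : forall n, K (z n)).

(* Weak compactness by hand: Tychonoff gives limit frequencies [p] for the codes of the points
   [z i], and [rho] is the image of Lebesgue measure on [0, 1[ under the map sending [s] to the
   point of [K] coded by the words [sword p s k]. *)
Lemma exists_limit_measure : exists rho : {measure set (R * R) -> \bar R},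
  [/\ rho setT = 1%E, rho (~` K) = 0%E &
   forall (d : R) N, 0 < d -> d <= 1 -> exists2 n, (N < n)%N &
     (\sum_(i < n) \sum_(j < n) lk d (z i) (z j)) / n%:R ^+ 2 - 5
       <= \int[rho]_x Upot rho setT d x].
Proof.
have [B B0 hB] := compact_bounded_plane (0, 0) cK.
have [p hp] := emp_cluster B z.
(* Nonnegativity, total mass and consistency each involve finitely many words, hence pass from the
   frequencies to [p]. *)
have p0 v : 0 <= p v.
  rewrite leNgt; apply/negP => pv; have [|n _] := hp [:: v] (- p v) 0%N; first lra.
  move=> /(_ v); rewrite inE eqxx => /(_ isT) /ltr_normlP[_].
  by have := emp_ge0 B z n v; lra.
have pnil : p [::] = 1.
  apply/eqP; rewrite -subr_eq0 -normr_le0 leNgt; apply/negP => h.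
  have [n n0] := hp [:: [::]] _ 0%N h; move=> /(_ [::]); rewrite inE eqxx => /(_ isT).
  by rewrite emp_nil // distrC ltxx.
have psplit v : p v = p (true :: v) + p (false :: v).
  apply/eqP; rewrite -subr_eq0 -normr_le0 leNgt; apply/negP => h.
  set e := `|_| in h; have [|n _ hn] := hp [:: v; true :: v; false :: v] (e / 3) 0%N.
    by rewrite divr_gt0.
  have h1 := hn v; rewrite inE eqxx in h1; have /ltr_normlP[h1a h1b] := h1 isT.
  have h2 := hn (true :: v); rewrite !inE eqxx orbT in h2; have /ltr_normlP[h2a h2b] := h2 isT.
  have h3 := hn (false :: v); rewrite !inE eqxx !orbT in h3; have /ltr_normlP[h3a h3b] := h3 isT.
  have := emp_split B z n v; rewrite -/e => hs.
  have : e <= e by []; rewrite {2}/e ler_normr => /orP[]; lra.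
have pcell v : 0 < p v -> exists i, scode B (size v) (z i) = v.
  move=> pv; have [n _] := hp [:: v] _ 0%N pv; move=> /(_ v); rewrite inE eqxx => /(_ isT) h.
  apply: contrapT => nex; move: h; rewrite /emp big1 ?mul0r ?sub0r ?normrN ?gtr0_norm ?ltxx // => i _.
  by case: eqP => // h; case: nex; exists i.
(* A representative in K for each cell that meets K. By [pcell] this covers every word of positive
   mass, the only ones that [sword] produces on [0, 1[. *)
have /choice[rep hrep] : forall v, exists x, K x /\
    ((exists2 y, K y & scode B (size v) y = v) -> scode B (size v) x = v).
  move=> v; have [[y Ky hy]|ney] := pselect (exists2 y, K y & scode B (size v) y = v).
    by exists y.
  by exists (z 0%N).
pose sep k e := forall x y, K x -> K y -> scode B k x = scode B k y -> cdist x y < e.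
have sepE (e : R) : 0 < e -> exists k, sep k e.
  move=> e0; have [k hk] := sbit_separates B e0; exists k => x y Kx Ky hxy.
  by apply: hk; [exact: (hB _ Kx)|exact: (hB _ Ky)|exact: (scode_sbit hxy)].
pose Xk k s := rep (sword p s k).
have XkK k s : K (Xk k s) by have [] := hrep (sword p s k).
have Xcode k l s : 0 <= s < 1 -> (k <= l)%N -> scode B k (Xk l s) = sword p s k.
  move=> s01 kl.
  have hl : scode B l (Xk l s) = sword p s l.
    have [_] := hrep (sword p s l); rewrite size_sword; apply.
    have [j] := pcell _ (sword_gt0 pnil psplit l s01); rewrite size_sword => hi.
    by exists (z j).
  elim: l kl (Xk l s) hl => [|l IH]; first by rewrite leqn0 => /eqP ->.
  rewrite leq_eqVlt => /orP[/eqP -> //|]; rewrite ltnS => kl x /= [_]; exact: IH.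
(* A cluster point of the representatives, by compactness of K. As [Xk l s] keeps the code
   [sword p s k] for all l >= k, the separation of codes turns it into a limit with a rate. *)
have /choice[X hX] : forall s, exists x, K x /\ (0 <= s < 1 -> forall k (e : R), sep k e -> cdist (Xk k s) x <= e).
  move=> s; have [s01|ns] := pselect (is_true (0 <= s < 1)); last by exists (z 0%N).
  pose Fl := fmap (fun k => Xk k s) \oo.
  have PF : ProperFilter Fl by exact: fmap_proper_filter.
  have [|x [Kx xcl]] := cK PF; first by exists 0%N => // k _ /=; exact: XkK.
  exists x; split => // _ k e ke; apply/ler_addgt0Pr => r r0.
  have FA : Fl [set Xk l s | l in [set l | (k <= l)%N]] by exists k => // l /= kl; exists l.
  have nb : nbhs x [set t | cdist t x < r] by apply/nbhs_cdistP; exists r.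
  have [_ [[l /= kl <-] lx]] := xcl _ _ FA nb.
  apply: (le_trans (cdist_triangle _ (Xk l s) _)); apply: lerD; last exact: ltW.
  by apply: ltW; apply: ke => //; rewrite !Xcode.
pose inD (s : R) := 0 <= s < 1.
have minD : measurable_fun setT inD.
  apply: (measurable_fun_bool true); rewrite setTI.
  rewrite [X in measurable X](_ : _ = `[0, 1[%classic); last by apply/seteqP; split => s /=; rewrite in_itv.
  exact: measurable_itv.
(* The default [z 0%N] outside [0, 1[ keeps all values in K. *)
pose X' (s : measurableTypeR R) : R * R := if inD s then X s else z 0%N.
have X'K s : K (X' s) by rewrite /X'; case: ifP => // _; have [] := hX s.
(* Pointwise limits of step functions of the word are measurable; this is used for the two
   coordinates. *)
have mlim (c : R * R -> R) : (forall x y, `|c x - c y| <= cdist x y) ->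
    measurable_fun setT (fun s => c (X' s)).
  move=> hc; pose h k (s : measurableTypeR R) := if inD s then c (rep (sword p s k)) else c (z 0%N).
  apply: (@measurable_fun_cvg _ _ _ setT h).
    move=> k; apply: measurable_fun_if => //.
    by apply: measurable_funTS; exact: (measurable_sword p (fun v => c (rep v))).
  move=> s _; apply/cvgrPdist_le => e e0; have [k hk] := sepE _ e0.
  exists k => // l /= kl; rewrite /h /X'; case: ifPn => s01; last by rewrite subrr normr0 ltW.
  apply: (le_trans (hc _ _)); rewrite cdistC; have [_ hXs] := hX s; apply: (hXs s01 l).
  by move=> x y Kx Ky xy; apply: hk => //; exact: (scode_le kl xy).
have mX : measurable_fun setT X'.
  apply/measurable_fun_pairP; split.
    by apply: mlim => x y; exact: fst_le_cdist.
  by apply: mlim => x y; exact: snd_le_cdist.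
pose leb : {measure set (measurableTypeR R) -> \bar R} :=
  mrestr (@lebesgue_measure R) (measurable_itv `[0%R, 1%R[).
pose rho : {measure set (R * R) -> \bar R} :=
  measure_function_pushforward__canonical__measure_function_Measure leb mX.
have leb1 : leb setT = 1%E.
  rewrite /leb /= /mrestr setTI lebesgue_measure_itv /= lte_fin ltr01.
  by rewrite oppr0 adde0.
pose D01 : set (measurableTypeR R) := `[0%R, 1%R[%classic.
have mD01 : measurable D01 by exact: measurable_itv.
have lebC : leb (~` D01) = 0%E by rewrite /leb /= /mrestr setICl measure0.
have D01E s : D01 s -> 0 <= s < 1 by rewrite /D01 /= in_itv.
have rho1 : rho setT = 1%E by rewrite /rho /= /pushforward preimage_setT.
have rhoK : rho (~` K) = 0%E.
  rewrite /rho /= /pushforward (_ : X' @^-1` (~` K) = set0) ?measure0 //.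
  by apply/seteqP; split => // s /=; apply; exact: X'K.
exists rho; split => // d N d0 d1.
have lebint (h : measurableTypeR R -> R) (H : R) : measurable_fun setT h ->
    (forall s, D01 s -> `|h s| <= H) -> leb.-integrable setT (EFin \o h).
  by move=> mh hH; exact: (integrable_concentrated mD01 lebC leb1 measurableT mh hH).
have pushI (h : R * R -> R) (H : R) : measurable_fun setT h -> (forall x, K x -> `|h x| <= H) ->
    \int[rho]_x h x = \int[leb]_s h (X' s).
  move=> mh hH; rewrite /Rintegral; congr fine.
  rewrite /rho /= integral_pushforward //.
    exact/measurable_EFinP.
  by apply: (lebint (h \o X') H); [exact: (measurableT_comp mh mX)|move=> s _; exact: hH].
(* Points of K with equal codes of length k are less than d apart, so replacing one by its
   representative changes [lk d] by at most 1. The loss 5 is made of two replacements for the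
   empirical sum, two for [rho], and twice 1 / 2 for replacing frequencies by [p]. *)
have [k hk] := sepE _ d0.
have swordI (g : seq bool -> R) : \int[leb]_s g (sword p s k) = \sum_(v : k.-tuple bool) p v * g v.
  rewrite /Rintegral /leb integral_mrestr; last first.
    by apply/measurable_EFinP; exact: measurable_sword.
  by rewrite (integral_sword p0 pnil psplit).
pose H := `|ln d| + ln (2 * B + 1) + 1.
have lB : 0 <= ln (2 * B + 1) by apply: ln_ge0; lra.
have H1 : 1 <= H by rewrite /H; have := normr_ge0 (ln d); lra.
have hH x y : K x -> K y -> `|lk d x y| <= H.
  move=> Kx Ky; have xy : cdist x y <= 2 * B.
    have := cdist_triangle x (0, 0) y; rewrite (cdistC x (0, 0)); have := hB _ Kx; have := hB _ Ky; lra.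
  have := lk_ge x y d0; have := lk_le d0 d1 xy; have := ler_norm (- ln d); rewrite normrN => h1 h2 h3.
  have := normr_ge0 (ln d) => h4; apply/ler_normlP; rewrite /H; split; lra.
have UE x : Upot rho setT d x = \int[leb]_s lk d x (X' s).
  have [Bx Bx0 hBx] := compact_bounded_plane x cK.
  apply: (pushI _ (`|ln d| + ln (Bx + 1))); first exact: measurable_lk.
  move=> y Ky; have := lk_ge x y d0; have := lk_le d0 d1 (hBx _ Ky).
  have := ler_norm (- ln d); rewrite normrN => h1 h2 h3.
  have h4 := normr_ge0 (ln d); have h5 : 0 <= ln (Bx + 1) by apply: ln_ge0; lra.
  by apply/ler_normlP; split; lra.
have close s : D01 s -> cdist (Xk k s) (X' s) <= d.
  move=> /D01E s01; rewrite /X' /inD s01; have [_ h] := hX s; exact: h.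
have intcst (c : R) : leb.-integrable setT (EFin \o (fun=> c)) by apply: (lebint _ `|c|).
have cstI (c : R) : \int[leb]_s c = c by rewrite Rintegral_cst // leb1 mulr1.
have intsw (g : seq bool -> R) (c : R) : leb.-integrable setT (EFin \o (fun s => g (sword p s k) - c)).
  have [G hG] : exists G, forall v : k.-tuple bool, `|g v| <= G.
    exists (\sum_(v : k.-tuple bool) `|g v|) => v.
    by rewrite (bigD1 v) //= lerDl sumr_ge0.
  apply: (lebint _ (G + `|c|)).
    by apply: measurable_funB => //; exact: measurable_sword.
  move=> s _; apply: (le_trans (ler_normB _ _)); rewrite lerD2r.
  have sz : size (sword p s k) == k by rewrite size_sword.
  exact: (hG (Tuple sz)).
have swordIB (g : seq bool -> R) (c : R) :
    \int[leb]_s (g (sword p s k) - c) = \sum_(v : k.-tuple bool) p v * g v - c.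
  rewrite RintegralB //; first by rewrite swordI cstI.
  by have := intsw g 0; apply: eq_integrable => // s _ /=; rewrite subr0.
have U1 x : K x -> \sum_(v : k.-tuple bool) p v * lk d x (rep v) - 1 <= Upot rho setT d x.
  move=> Kx; rewrite UE -(swordIB (fun v => lk d x (rep v))).
  apply: (le_Rintegral_concentrated mD01 lebC) => //.
  - exact: (intsw (fun v => lk d x (rep v))).
  - apply: (lebint _ H); last by move=> s _; exact: hH.
    exact: (measurableT_comp (measurable_lk d x) mX).
  - move=> s Ds _; have := lk_lipschitz (Xk k s) (X' s) x d0.
    have : cdist (Xk k s) (X' s) / d <= 1 by rewrite ler_pdivrMr // mul1r close.
    by rewrite /Xk !(lkC d x); lra.
pose h u v := lk d (rep u) (rep v).
have repK v : K (rep v) by have [] := hrep v.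
have U2 : \sum_(u : k.-tuple bool) p u * (\sum_(v : k.-tuple bool) p v * h u v) - 2 <=
    \int[rho]_x Upot rho setT d x.
  have cU : continuous (Upot rho setT d).
    by apply: (@lipschitz_cdist_continuous _ _ (1 / d)) => x y; exact: (Upot_lipschitz cK rhoK rho1).
  have bU x : K x -> `|Upot rho setT d x| <= H.
    move=> Kx; have e1 : Upot rho setT d x <= H * fine (rho setT).
      apply: (Rintegral_concentrated_le (measurable_compact_plane cK) rhoK rho1) => //.
        exact: (integrable_lk cK rhoK rho1).
      by move=> t Kt _; have /ler_normlP[] := hH _ _ Kx Kt.
    have e2 : - H * fine (rho setT) <= Upot rho setT d x.
      apply: (Rintegral_concentrated_ge (measurable_compact_plane cK) rhoK rho1) => //.
        exact: (integrable_lk cK rhoK rho1).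
      by move=> t Kt _; have /ler_normlP[] := hH _ _ Kx Kt; lra.
    by rewrite rho1 !mulr1 in e1 e2; apply/ler_normlP; split; lra.
  rewrite (pushI _ H) //; last exact: measurable_continuous_plane.
  rewrite -(swordIB (fun u => \sum_(v : k.-tuple bool) p v * h u v)).
  apply: (le_Rintegral_concentrated mD01 lebC) => //.
  - exact: (intsw (fun u => \sum_(v : k.-tuple bool) p v * h u v)).
  - apply: (lebint _ H); last by move=> s _; exact: bU.
    exact: (measurableT_comp (measurable_continuous_plane cU) mX).
  - move=> s Ds _; have := U1 _ (XkK k s); rewrite -/(h _ _).
    have := Upot_lipschitz cK rhoK rho1 (Xk k s) (X' s) measurableT d0 d1.
    have : 1 / d * cdist (Xk k s) (X' s) <= 1.
      by rewrite mul1r mulrC ler_pdivrMr // mul1r close.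
    by rewrite /h /Xk; lra.
have psum : \sum_(v : k.-tuple bool) p v = 1.
  have := swordI (fun=> 1); rewrite cstI => ->; apply: eq_bigr => v _; by rewrite mulr1.
pose W := [seq tval v | v <- enum {: k.-tuple bool}].
(* There are 2^k words and the kernel is bounded by [H], so frequencies within [eta] of [p] change a
   sum by at most 1 / 2. *)
pose eta := (2 * H * (2 ^ k)%:R)^-1.
have k0 : 0 < (2 ^ k)%:R :> R by rewrite ltr0n expn_gt0.
have eta0 : 0 < eta by rewrite invr_gt0 !mulr_gt0 //; lra.
have [n Nn hn] := hp W eta N eta0; exists n => //.
have n0 : (0 < n)%N by exact: leq_ltn_trans Nn.
have nR : 0 < n%:R :> R by rewrite ltr0n.
pose Del := \sum_(v : k.-tuple bool) `|emp B z n v - p v|.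
have DelH : Del * H <= 1 / 2.
  have : Del <= \sum_(v : k.-tuple bool) eta.
    apply: ler_sum => v _; apply: ltW; apply: hn; apply/mapP; exists v => //.
    by rewrite mem_enum.
  rewrite sumr_const card_tuple card_bool => hD.
  have -> : 1 / 2 = (eta *+ 2 ^ k) * H :> R.
    rewrite -mulr_natr /eta; field; rewrite !gt_eqF //; lra.
  by apply: ler_wpM2r => //; lra.
have cmp (g : seq bool -> R) : (forall v, `|g v| <= H) ->
    \sum_(v : k.-tuple bool) emp B z n v * g v - 1 / 2 <= \sum_(v : k.-tuple bool) p v * g v.
  move=> gH; rewrite lerBlDr -lerBlDl -sumrB; apply: le_trans DelH.
  rewrite mulr_suml; apply: ler_sum => v _; rewrite -mulrBl.
  by apply: (le_trans (ler_norm _)); rewrite normrM; apply: ler_wpM2l.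
have empsum : \sum_(v : k.-tuple bool) emp B z n v = 1.
  have := sum_emp B z k (fun=> 1) n0; rewrite sumr_const card_ord divff ?gt_eqF // => <-.
  by apply: eq_bigr => v _; rewrite mulr1.
have hHh u v : `|h u v| <= H by exact: hH.
have step1 : \sum_(u : k.-tuple bool) p u * (\sum_(v : k.-tuple bool) emp B z n v * h u v) - 1 / 2
    <= \sum_(u : k.-tuple bool) p u * (\sum_(v : k.-tuple bool) p v * h u v).
  have e12 : 1 / 2 = \sum_(u : k.-tuple bool) p u * (1 / 2) :> R by rewrite -mulr_suml psum; lra.
  rewrite [X in _ - X]e12 -sumrB; apply: ler_sum => u _.
  by rewrite -mulrBr; apply: ler_wpM2l => //; exact: (cmp (h u) (hHh u)).
have step2 : \sum_(u : k.-tuple bool) emp B z n u * (\sum_(v : k.-tuple bool) emp B z n v * h u v) - 1 / 2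
    <= \sum_(u : k.-tuple bool) p u * (\sum_(v : k.-tuple bool) emp B z n v * h u v).
  apply: (cmp (fun u => \sum_(v : k.-tuple bool) emp B z n v * h u v)) => u.
  apply: (le_trans (ler_norm_sum _ _ _)).
  apply: (@le_trans _ _ (\sum_(v : k.-tuple bool) emp B z n v * H)).
    apply: ler_sum => v _; rewrite normrM (ger0_norm (emp_ge0 _ _ _ _)).
    by apply: ler_wpM2l => //; exact: emp_ge0.
  by rewrite -mulr_suml empsum mul1r.
have step3 : (\sum_(i < n) \sum_(j < n) lk d (z i) (z j)) / n%:R ^+ 2 - 2 <=
   \sum_(u : k.-tuple bool) emp B z n u * (\sum_(v : k.-tuple bool) emp B z n v * h u v).
  rewrite (sum_emp B z k (fun u => \sum_(v : k.-tuple bool) emp B z n v * h u v) n0).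
  under [X in _ <= X / _]eq_bigr do rewrite (sum_emp B z k _ n0).
  rewrite -mulr_suml -mulrA -invfM -expr2.
  rewrite lerBlDr -lerBlDl -mulrBl ler_pdivrMr ?exprn_gt0 // -sumrB.
  have -> : 2 * n%:R ^+ 2 = \sum_(i < n) \sum_(j < n) 2 :> R.
    by rewrite !(sumr_const, card_ord) -[RHS]mulr_natr -[2 *+ n]mulr_natr expr2 mulrA.
  apply: ler_sum => i _; rewrite -sumrB; apply: ler_sum => j _.
  have cl l : cdist (z l) (rep (scode B k (z l))) <= d.
    apply: ltW; apply: hk => //; have [_ hr] := hrep (scode B k (z l)).
    by rewrite size_scode in hr; rewrite hr //; exists (z l).
  have q1 : cdist (z i) (rep (scode B k (z i))) / d <= 1 by rewrite ler_pdivrMr // mul1r cl.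
  have q2 : cdist (z j) (rep (scode B k (z j))) / d <= 1 by rewrite ler_pdivrMr // mul1r cl.
  have := lk_lipschitz (z i) (rep (scode B k (z i))) (z j) d0.
  have := lk_lipschitz (z j) (rep (scode B k (z j))) (rep (scode B k (z i))) d0.
  by rewrite /h !(lkC d _ (rep (scode B k (z i)))); lra.
lra.
Qed.

End limit_measure.

(** * Bounded smoothed energy implies finite energy *)

Section finite_energy.
Context {R : realType}.
Variables (rho : {measure set (R * R) -> \bar R}) (K : set (R * R)) (C : R).
Hypotheses (cK : compact K) (rhoK : rho (~` K) = 0%E) (rho1 : rho setT = 1%E).
Hypothesis energy_ge : forall d, 0 < d -> d <= 1 -> - C <= \int[rho]_x Upot rho setT d x.

Let dn n : R := n.+1%:R^-1.

Let dn_gt0 n : 0 < dn n. Proof. by rewrite invr_gt0. Qed.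

Let dn_le1 n : dn n <= 1. Proof. by rewrite invf_le1 // ler1n. Qed.

Let G n x : \bar R := (Upot rho setT 1 x - Upot rho setT (dn n) x)%:E.

Let G_ge0 n x : (0 <= G n x)%E.
Proof. by rewrite lee_fin subr_ge0; apply: (Upot_mono cK rhoK rho1). Qed.

Let G_nd x : {homo G ^~ x : n m / (n <= m)%N >-> (n <= m)%E}.
Proof.
move=> n m nm; rewrite lee_fin lerB //; apply: (Upot_mono cK rhoK rho1) => //.
by rewrite lef_pV2 ?posrE // ler_nat ltnS.
Qed.

Let limG x : limn (G ^~ x) = ereal_sup (range (G ^~ x)).
Proof. by apply/cvg_lim => //; apply: ereal_nondecreasing_cvgn; exact: G_nd. Qed.

Let continuous_Upot d : 0 < d -> d <= 1 -> continuous (Upot rho setT d).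
Proof.
move=> d0 d1; apply: (@lipschitz_cdist_continuous _ _ (1 / d)) => x y.
exact: (Upot_lipschitz cK rhoK rho1).
Qed.

Let measurable_Upot d : 0 < d -> d <= 1 -> measurable_fun setT (Upot rho setT d).
Proof. by move=> d0 d1; apply: measurable_continuous_plane; exact: continuous_Upot. Qed.

Let measurable_G n : measurable_fun setT (G n).
Proof.
apply/measurable_EFinP; apply: measurable_funB; exact: measurable_Upot.
Qed.

Let opp_logpot x : (\int[rho]_t (- elog (cdist x t)) = - logpot rho x)%E.
Proof.
rewrite /logpot; apply: integralN.
have [B B0 hB] := compact_bounded_plane x cK.
have mf := measurable_elog_cdist x.
have : (\int[rho]_t (fun t => elog (cdist x t))^\+ t < +oo)%E.
  have mK := measurable_compact_plane cK.
  have h : forall t, K t -> ((fun t => elog (cdist x t))^\+ t <= `|ln B|%:E)%E.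
    move=> t Kt; rewrite funeposE ge_max lee_fin normr_ge0 andbT.
    apply: (le_trans (elog_le (hB _ Kt))); rewrite /elog ifF ?lee_fin ?ler_norm //.
    by rewrite leNgt B0.
  have := integral_ub_le mK rhoK rho1 (measurable_funepos mf) h.
  by move=> /le_lt_trans; apply; exact: ltry.
move=> fin; apply/fin_num_adde_defr.
by rewrite ge0_fin_numE // integral_ge0.
Qed.

Let logpot_lim x : (- logpot rho x + (Upot rho setT 1 x)%:E = limn (G ^~ x))%E.
Proof.
rewrite limG; apply/eqP; rewrite eq_le; apply/andP; split; last first.
  apply: ge_ereal_sup => _ [n _ <-]; rewrite /G EFinB addeC.
  apply: leeD => //; rewrite leeN2.
  exact: (logpot_le_Upot cK rhoK rho1).
have ub n : (G n x <= ereal_sup (range (G ^~ x)))%E by apply: ereal_sup_ubound; exists n.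
have := ub 0%N; have := G_ge0 0%N x => h0 h1; have s0 := le_trans h0 h1.
case E : (ereal_sup _) ub s0 => [s| |] ub // _; last by rewrite leey.
have : ((Upot rho setT 1 x - s)%:E <= logpot rho x)%E.
  apply: (le_logpot cK rhoK rho1) => d d0 d1.
  have [n] := ltr_add_invr d0; rewrite add0r => /ltW hn.
  have h2 : Upot rho setT (dn n) x <= Upot rho setT d x by apply: (Upot_mono cK rhoK rho1).
  by have := ub n; rewrite lee_fin; lra.
case: (logpot rho x) => [r| |] //=; rewrite ?lee_fin -?EFinN -?EFinD ?lee_fin ?leNye //; lra.
Qed.

(** The functions [G n] are nonnegative and increase to [Upot rho setT 1] minus the potential. As
    [Upot rho setT 1] is nonnegative, the energy is at most the limit of their integrals, each
    bounded by the integral of [Upot rho setT 1] plus C. *)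
Lemma log_energy_finite : (log_energy rho < +oo)%E.
Proof.
have mK := measurable_compact_plane cK.
have innerE x : (\int[rho]_t (- elog (cdist x t)) = limn (G ^~ x) - (Upot rho setT 1 x)%:E)%E.
  by rewrite opp_logpot -logpot_lim addeK.
have U10 x : 0 <= Upot rho setT 1 x.
  by have := Upot_ge cK rhoK rho1 x measurableT ltr01 (lexx _); rewrite ln1 mul0r.
have mL : measurable_fun setT (fun x => limn (G ^~ x)).
  rewrite [X in measurable_fun _ X](_ : _ = fun x => limn_esup (G ^~ x)); last first.
    apply/funext => x; rewrite is_cvg_limn_esupE //; apply: ereal_nondecreasing_is_cvgn.
    exact: G_nd.
  exact: measurable_fun_limn_esup.
have mi : measurable_fun setT (fun x => \int[rho]_t (- elog (cdist x t)))%E.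
  rewrite [X in measurable_fun _ X](_ : _ = fun x => (limn (G ^~ x) - (Upot rho setT 1 x)%:E)%E); last first.
    by apply/funext => x; rewrite innerE.
  by apply: emeasurable_funB => //; apply/measurable_EFinP; exact: measurable_Upot.
apply: (@le_lt_trans _ _ (\int[rho]_x limn (G ^~ x))%E).
  apply: measurable_le_integral => // x _; rewrite innerE.
  by rewrite leeBlDr // leeDl // lee_fin.
have cvg := @cvg_monotone_convergence _ _ _ rho setT measurableT G measurable_G (fun n t _ => G_ge0 n t) (fun t _ => @G_nd t).
have [H hH] : exists H : R, forall x, K x -> Upot rho setT 1 x <= H.
  have [B B0 hB] := compact_bounded_plane (0, 0) cK; exists (ln (2 * B + 1)) => x Kx.
  have := Upot_le cK rhoK rho1 (z := x) (B := 2 * B) measurableT ltr01 (lexx _).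
  rewrite rho1 mulr1; apply => t Kt.
  have := cdist_triangle x (0, 0) t; rewrite (cdistC x (0, 0)); have := hB _ Kx; have := hB _ Kt; lra.
have intU d : 0 < d -> d <= 1 -> rho.-integrable setT (EFin \o Upot rho setT d).
  move=> d0 d1; apply: (integrable_concentrated mK rhoK rho1 (B := `|ln d| + `|H|)) => //.
    exact: measurable_Upot.
  move=> x Kx; have := Upot_ge cK rhoK rho1 x measurableT d0 d1; rewrite rho1 mulr1 => h1.
  have h2 := Upot_mono cK rhoK rho1 x measurableT d0 d1 (lexx _); have h3 := hH _ Kx.
  have := ler_norm (- ln d); have := ler_norm H; rewrite normrN => h4 h5.
  have h6 := normr_ge0 (ln d); have h7 := normr_ge0 H.
  by apply/ler_normlP; split; lra.
apply: (@le_lt_trans _ _ (\int[rho]_x Upot rho setT 1 x + C)%:E); last exact: ltry.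
apply: (cvge_le _ cvg); apply: nearW => n.
have -> : (\int[rho]_x G n x)%E = (\int[rho]_x Upot rho setT 1 x - \int[rho]_x Upot rho setT (dn n) x)%:E.
  have i1 := intU _ ltr01 (lexx _); have i2 := intU _ (dn_gt0 n) (dn_le1 n).
  rewrite -RintegralB // /Rintegral fineK //; apply: integrable_fin_num => //.
  by have := integrableB measurableT i1 i2; apply: eq_integrable.
by rewrite lee_fin; have := energy_ge (dn_gt0 n) (dn_le1 n); lra.
Qed.

End finite_energy.

(** * Leja points in a compact set of capacity zero *)

Section chebyshev.
Context {R : realType}.
Variables (K : set (R * R)).
Hypotheses (cK : compact K) (K0 : K !=set0) (zK : zero_log_cap K).

(* Otherwise a Leja sequence can be built, each point of which keeps the mean of the
   logarithmic distances to its predecessors above [-L]; its empirical measures then have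
   bounded energy and so does their limit. *)
Lemma small_potential_zero_cap (L : R) : 0 <= L ->
  exists2 s : seq (R * R), s != [::] /\ (forall t, t \in s -> K t) &
    forall x, K x -> (\sum_(t <- s) elog (cdist x t) <= (- L * (size s)%:R)%:E)%E.
Proof.
move=> L0; apply: contrapT => nex; apply: zK.
have [x0 Kx0] := K0.
(* The negated conclusion supplies a point of K whose mean logarithmic distance to the list exceeds
   - L. The condition is void for lists not contained in K, which makes [next] total. *)
have /choice[next hnext] : forall s : seq (R * R), exists x, (forall t, t \in s -> K t) ->
    K x /\ (s != [::] -> ((- L * (size s)%:R)%:E < \sum_(t <- s) elog (cdist x t))%E).
  move=> s; apply: contrapT => ns; apply: nex; exists s.
    split; first by apply/eqP => s0; apply: ns; exists x0; rewrite s0.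
    by move=> t ts; apply: contrapT => nKt; apply: ns; exists x0 => /(_ t ts).
  move=> x Kx; rewrite leNgt; apply/negP => lt; apply: ns; exists x => _; split => //.
pose l n := iter n (fun s => rcons s (next s)) [::].
pose z n := next (l n).
have lE n : l n = mkseq z n by elim: n => //= n IH; rewrite mkseqS -IH.
have lK n t : t \in l n -> K t.
  elim: n t => //= n IH t; rewrite mem_rcons inE => /orP[/eqP ->|]; last exact: IH.
  by have [] := hnext (l n) IH.
have zKn n : K (z n) by have [] := hnext (l n) (lK n).
have leja n (d : R) : 0 < d -> - L * n%:R <= \sum_(i < n) lk d (z n) (z i).
  move=> d0; case: n => [|n]; first by rewrite big_ord0 mulr0.
  have [_] := hnext (l n.+1) (lK n.+1); rewrite lE size_mkseq -size_eq0 size_mkseq => /(_ isT) /ltW h.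
  rewrite -lee_fin; apply: (le_trans h); rewrite big_map -/(index_iota 0 n.+1) big_mkord -sumEFin.
  by rewrite -lE -/(z n.+1); apply: lee_sum => i _; exact: elog_le_lk.
(* Each pair off the diagonal counts twice, which gives at least - L n (n - 1); each of the n
   diagonal terms is at least ln d. *)
have dbl n (d : R) : 0 < d -> - L * n%:R ^+ 2 + n%:R * ln d <= \sum_(i < n) \sum_(j < n) lk d (z i) (z j).
  move=> d0; elim: n => [|n IH]; first by rewrite big_ord0 expr0n mulr0 mul0r addr0.
  rewrite big_ord_recr /=; under eq_bigr do rewrite big_ord_recr /=.
  rewrite big_split /= big_ord_recr /=.
  under [X in _ + X + _]eq_bigr do rewrite lkC.
  have := leja n d d0; have := lk_ge (z n) (z n) d0; rewrite -natr1.
  have := ler0n R n; move: IH; rewrite expr2; nra.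
have [rho [rho1 rhoK hrho]] := exists_limit_measure cK zKn.
exists K; split => //; exists rho; split => //.
(* For n >= |ln d| the mean of the double sum is at least - (L + 1), and passing to [rho] costs
   5. *)
apply: (@log_energy_finite _ rho K (L + 6)) => // d d0 d1.
pose N := Num.truncn `|ln d|.
have [n Nn] := hrho d N d0 d1; apply: le_trans.
have n0 : 0 < n%:R :> R by rewrite ltr0n (leq_ltn_trans _ Nn).
have lnn : `|ln d| <= n%:R.
  by apply: ltW; apply: (lt_le_trans (truncnS_gt _)); rewrite ler_nat.
suff : - (L + 1) <= (\sum_(i < n) \sum_(j < n) lk d (z i) (z j)) / n%:R ^+ 2 by lra.
rewrite ler_pdivlMr ?exprn_gt0 //; apply: le_trans (dbl n d d0).
have := ler_norm (- ln d); rewrite normrN expr2; nra.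
Qed.

End chebyshev.

(** * Sharpness *)

Lemma exists_mixture {R : realType} d (X : measurableType d)
    (m1 m2 : {measure set X -> \bar R}) (T : set X)
    (a1 a2 : R) (b k : {nonneg R}) :
  measurable T -> m1 (~` T) = 0%E -> m2 (~` T) = 0%E ->
  m1 setT = a1%:E -> m2 setT = a2%:E ->
  exists la : {measure set X -> \bar R},
    [/\ la (~` T) = 0%E, la setT = (b%:num * a1 + k%:num * a2)%:E &
      forall f (B : R), measurable_fun setT f -> (forall t, T t -> (f t <= B%:E)%E) ->
        (\int[la]_t f t = b%:num%:E * \int[m1]_t f t + k%:num%:E * \int[m2]_t f t)%E].
Proof.
move=> mT m1T m2T m1a m2a.
pose la : {measure set X -> \bar R} := measure_add (mscale b m1) (mscale k m2).
have laE A : la A = (b%:num%:E * m1 A + k%:num%:E * m2 A)%E.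
  exact: (measure_addE (mscale b m1) (mscale k m2) A).
have laT : la (~` T) = 0%E by rewrite laE m1T m2T !mule0 adde0.
have la1 : la setT = (b%:num * a1 + k%:num * a2)%:E by rewrite laE m1a m2a.
exists la; split => // f B mf fB.
have mg : measurable_fun T (fun t => B%:E - f t)%E.
  by apply: emeasurable_funB => //; exact: measurable_funTS.
have g0 t : T t -> (0 <= B%:E - f t)%E.
  move=> Tt; have := fB _ Tt; case: (f t) => [r| |] //; last by rewrite /= leey.
  by rewrite -EFinB !lee_fin subr_ge0.
have massT (m : {measure set X -> \bar R}) a : m (~` T) = 0%E -> m setT = a%:E -> m T = a%:E.
  move=> h0 ha; rewrite -ha -(setUv T) measureU ?setICr //; last exact: measurableC.
  by rewrite -[LHS]adde0; congr (_ + _)%E; exact: esym.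
rewrite (integral_ubE mT laT la1 mf fB) (integral_ubE mT m1T m1a mf fB) (integral_ubE mT m2T m2a mf fB).
rewrite !Rintegral_cst // (massT _ _ laT la1) (massT _ _ m1T m1a) (massT _ _ m2T m2a) /=.
have -> : (\int[la]_(t in T) (B%:E - f t) = b%:num%:E * \int[m1]_(t in T) (B%:E - f t)
    + k%:num%:E * \int[m2]_(t in T) (B%:E - f t))%E.
  by rewrite /la ge0_integral_measure_add // !ge0_integral_mscale.
have h1 : (0 <= \int[m1]_(t in T) (B%:E - f t))%E by exact: integral_ge0.
have h2 : (0 <= \int[m2]_(t in T) (B%:E - f t))%E by exact: integral_ge0.
have b0 : 0 <= b%:num by []. have k0 : 0 <= k%:num by [].
clear -b0 k0 h1 h2; move: b0 k0 h1 h2; move: (b%:num) (k%:num) (integral m1 _ _) (integral m2 _ _) => {}b {}k x y.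
rewrite le_eqVlt => /orP[/eqP <-|b0].
  rewrite !mul0e !add0e !mul0r !add0r => k0 _; move: k0; rewrite le_eqVlt => /orP[/eqP <-|k0].
    by rewrite !mul0e mul0r mulr0 sube0.
  case: y => [y| |] // _; last by rewrite gt0_muley ?lte_fin //= gt0_muleNy ?lte_fin.
  by rewrite -EFinM -!EFinB -EFinM; congr EFin; ring.
rewrite le_eqVlt => /orP[/eqP <-|k0].
  rewrite !mul0e !adde0 !mul0r !addr0 => + _.
  case: x => [x| |] // _; last by rewrite gt0_muley ?lte_fin //= gt0_muleNy ?lte_fin.
  by rewrite -EFinM -!EFinB -EFinM; congr EFin; ring.
case: x => [x| |] // _; case: y => [y| |] // _;
  rewrite ?gt0_muley ?lte_fin //= ?gt0_muleNy ?lte_fin //.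
by rewrite -!(EFinM,EFinD,EFinN); congr EFin; ring.
Qed.

(** The measure b mu + k (sum of the point masses of the list), built by adding one atom at a time;
    repeated entries count with multiplicity. *)
Lemma exists_atomic_mixture {R : realType} d (X : measurableType d)
    (mu : {measure set X -> \bar R}) (T : set X) (b k : {nonneg R}) (s : seq X) :
  measurable T -> mu (~` T) = 0%E -> mu setT = 1%E -> {in s, forall t, T t} ->
  exists la : {measure set X -> \bar R},
    [/\ la (~` T) = 0%E, la setT = (b%:num + k%:num * (size s)%:R)%:E &
      forall f (B : R), measurable_fun setT f -> (forall t, T t -> (f t <= B%:E)%E) ->
        (\int[la]_t f t = b%:num%:E * \int[mu]_t f t + k%:num%:E * \sum_(t <- s) f t)%E].
Proof.
move=> mT muT mu1; elim: s => [|x s IH] sT.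
  have [la [la0 la1 laf]] := exists_mixture b (0%R)%:nng mT muT muT mu1 mu1.
  exists la; split => //; first by rewrite la1 /= mulr1 mulr0 mul0r.
  by move=> f B mf fB; rewrite (laf _ _ mf fB) big_nil /= mul0e mule0.
have [|la [la0 la1 laf]] := IH; first by move=> t ts; apply: sT; rewrite inE ts orbT.
have xT : T x by apply: sT; rewrite inE eqxx.
have dT : \d_x (~` T) = 0%E :> \bar R by rewrite diracE memNset //=; exact.
have d1 : \d_x [set: X] = 1%E :> \bar R by rewrite diracT.
have [la' [la'0 la'1 la'f]] := exists_mixture (1%R)%:nng k mT la0 dT la1 d1.
exists la'; split => //; first by rewrite la'1 /= -natr1; congr EFin; ring.
move=> f B mf fB; rewrite (la'f _ _ mf fB) (laf _ _ mf fB) /= mul1e integral_dirac // diracT mul1e.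
rewrite big_cons -addeA; congr (_ + _)%E.
have fy t : T t -> (f t < +oo)%E by move=> Tt; exact: (le_lt_trans (fB _ Tt) (ltry _)).
rewrite muleDr //; first by rewrite addeC.
apply: ltpinfty_adde_def; rewrite inE; first exact: fy.
by rewrite big_seq; apply: lte_sum_pinfty => t ts; apply: fy; apply: sT; rewrite inE ts orbT.
Qed.

Lemma sume_seq_le {R : realType} (X : eqType) (s : seq X) (f : X -> \bar R) (B : R) :
  {in s, forall t, (f t <= B%:E)%E} -> (\sum_(t <- s) f t <= (B * (size s)%:R)%:E)%E.
Proof.
elim: s => [|x s IH] fB; first by rewrite big_nil mulr0.
rewrite big_cons /= -natr1 mulrDr mulr1 [B * _ + B]addrC EFinD; apply: leeD.
  by apply: fB; rewrite inE eqxx.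
by apply: IH => t ts; apply: fB; rewrite inE ts orbT.
Qed.

Lemma sume_seq_ge {R : realType} (X : eqType) (s : seq X) (f : X -> \bar R) (B : R) :
  {in s, forall t, (B%:E <= f t)%E} -> ((B * (size s)%:R)%:E <= \sum_(t <- s) f t)%E.
Proof.
elim: s => [|x s IH] fB; first by rewrite big_nil mulr0.
rewrite big_cons /= -natr1 mulrDr mulr1 [B * _ + B]addrC EFinD; apply: leeD.
  by apply: fB; rewrite inE eqxx.
by apply: IH => t ts; apply: fB; rewrite inE ts orbT.
Qed.

(** * Removing the exceptional set of the equilibrium inequality *)

Section exceptional_set.
Context {R : realType}.
Variables (E : set (R * R)) (w : R * R -> R).
Variables (mu : {measure set (R * R) -> \bar R}) (F : R).
Hypotheses (cE : closed E) (adm : admissible E w) (eqm : weighted_equilibrium E w mu F).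

(** [K] is defined by all smoothed potentials rather than by the potential: these are Lipschitz and
    [w] is upper semicontinuous, so [K] is closed. It is bounded because the decay of |z| w z beats
    the logarithmic growth of the potential, and of capacity zero because it lies in the exceptional
    set of the equilibrium inequality. *)
Lemma exceptional_compact (e : R) : 0 < e -> exists K : set (R * R),
  [/\ compact K, K `<=` E, zero_log_cap K &
    forall z, E z -> ~ K z -> (elog (w z) + logpot mu z <= (e - F)%:E)%E].
Proof.
move=> e0; have mu1 := equilibrium_mass eqm.
have [S [cS SE S0 _ _]] := equilibrium_support eqm.
have [_ [_ zc]] := eqm; have [_ usc _ gr] := adm.
pose K := [set z | [/\ E z, 0 < w z & forall d, 0 < d -> d <= 1 ->
  e <= Upot mu setT d z + ln (w z) + F]].
have lip d z u : 0 < d -> d <= 1 -> Upot mu setT d z - Upot mu setT d u <= d^-1 * cdist z u.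
  by move=> d0 d1; rewrite -[d^-1]mul1r; exact: (Upot_lipschitz cS S0 mu1).
have clK : closed K.
  apply/closed_cdistP => z hz.
  have Ez : E z.
    by move/closed_cdistP : cE; apply => r r0; have [t [Et _ _] tz] := hz r r0; exists t.
  have wz : 0 < w z.
    (* Scale 1 has Lipschitz constant 1, so points of K within distance 1 of z have weight at least
       q; upper semicontinuity then forces w z > 0 in the limit. *)
    pose q := expR (e - F - Upot mu setT 1 z - 1).
    have q0 : 0 < q by exact: expR_gt0.
    have [d d0 hd] := usc _ Ez (q / 2) (divr_gt0 q0 (ltr0Sn _ _)).
    have md : 0 < Num.min d 1 by rewrite lt_min d0 ltr01.
    have [t [Et wt ht] tz] := hz _ md.
    move: tz; rewrite lt_min => /andP[tzd tz1].
    have := hd _ Et tzd.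
    have h1 := ht 1 ltr01 (lexx _); have := lip 1 t z ltr01 (lexx _); rewrite invr1 mul1r => h2.
    have : q <= w t.
      rewrite -[w t]lnK ?posrE // ler_expR; lra.
    lra.
  split => // d d0 d1; apply/ler_addgt0Pr => r r0.
  have p0 : 0 < w z * (r / 2) by rewrite mulr_gt0 // divr_gt0.
  have [d' d'0 hd'] := usc _ Ez _ p0.
  have md : 0 < Num.min d' (d * (r / 2)) by rewrite lt_min d'0 mulr_gt0 // divr_gt0.
  have [t [Et wt ht] tz] := hz _ md.
  move: tz; rewrite lt_min => /andP[tzd tz1].
  have h1 := ht d d0 d1; have h2 := lip d t z d0 d1.
  have h3 : d^-1 * cdist t z <= r / 2 by rewrite ler_pdivrMl // ltW.
  have h4 : ln (w t) <= ln (w z) + r / 2.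
    have r1 : 0 < 1 + r / 2 by rewrite addr_gt0 // divr_gt0.
    have : w t <= w z * (1 + r / 2) by have := hd' _ Et tzd; lra.
    rewrite -ler_ln ?posrE ?mulr_gt0 // lnM ?posrE // => /le_trans; apply.
    rewrite lerD2l; apply: le_ln1Dx; lra.
  lra.
have bK : exists M : R, forall z, K z -> cabs z <= M.
  have [[M hM]|nb] := pselect (exists M : R, forall z, E z -> cabs z <= M).
    by exists M => z [Ez _ _]; exact: hM.
  have [B B0 hB] := compact_bounded_plane (0, 0) cS.
  (* Membership at scale 1 gives w z (|z| + B + 1) >= q, while |z| w z < q / 2 and |z| > B + 1 make
     it smaller than q. *)
  pose q := expR (e - F); have q0 : 0 < q by exact: expR_gt0.
  have [M hM] := gr nb (q / 2) (divr_gt0 q0 (ltr0Sn _ _)).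
  exists (Num.max M (B + 1)) => z [Ez wz hz]; rewrite leNgt; apply/negP.
  rewrite gt_max => /andP[Mz Bz].
  have c0 : 0 < cabs z + B + 1 by have := cabs_ge0 z; lra.
  have hU : Upot mu setT 1 z <= ln (cabs z + B + 1).
    rewrite -[leRHS]mulr1; apply: (le_trans (Upot_le (B := cabs z + B) cS S0 mu1 measurableT ltr01 (lexx _) _)).
      move=> t St; have := cdist_triangle z (0, 0) t; rewrite -cabsE; have := hB _ St; lra.
    by rewrite mu1.
  have : q <= w z * (cabs z + B + 1).
    rewrite -[leRHS]lnK ?posrE ?mulr_gt0 // ler_expR lnM ?posrE //.
    by have := hz 1 ltr01 (lexx _); lra.
  have := hM _ Ez Mz; nra.
exists K; split.
- have [M hM] := bK; apply: (@bounded_closed_compact_plane _ _ (0, 0) M) => // t Kt.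
  by rewrite cdistC -cabsE; exact: hM.
- by move=> z [].
- move=> [K' [cK' K'K h]]; apply: zc; exists K'; split => // z /K'K [Ez wz hz]; split => //.
  have : ((e - ln (w z) - F)%:E <= logpot mu z)%E.
    by apply: (le_logpot cS S0 mu1) => d d0 d1; have := hz d d0 d1; lra.
  rewrite /elog ifF; last by rewrite leNgt wz.
  case: (logpot mu z) => [x| |] //; last by rewrite /= ltry.
  by rewrite lee_fin -!EFinD lte_fin; lra.
- move=> z Ez nK; have := weight_ge0 adm Ez; rewrite le_eqVlt => /orP[/eqP wz|wz].
    by rewrite -wz /elog lexx addNye leNye.
  have [[d [d0 d1 hd]]|nd] := pselect (exists d, [/\ 0 < d, d <= 1 &
      Upot mu setT d z + ln (w z) + F < e]); last first.
    exfalso; apply: nK; split => // d d0 d1; rewrite leNgt; apply/negP => hd.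
    by apply: nd; exists d.
  have := logpot_le_Upot cS S0 mu1 z d0 d1.
  rewrite /elog ifF; last by rewrite leNgt wz.
  case: (logpot mu z) => [x| |] //; last by move=> _; rewrite addeNy leNye.
  by rewrite lee_fin -!EFinD lee_fin; lra.
Qed.

(** The measure is (1 - eta) mu plus eta times a uniform measure on a list in the exceptional
    compact set. Off that set, the terms in ln w cancel and the atoms raise the bound by at most e /
    2; on it, their very negative potential wins. The lower bound [l] of [f] limits the loss in the
    integral to eta (I - l), I being the integral of [f] against [mu]. *)
Lemma exists_near_equilibrium (f : R * R -> \bar R) (l e : R) :
  measurable_fun setT f -> (forall z, (l%:E <= f z)%E) ->
  (forall K, compact K -> exists B : R, forall z, K z -> (f z <= B%:E)%E) -> 0 < e ->
  exists (la : {measure set (R * R) -> \bar R}) (T : set (R * R)),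
    [/\ compact T, la (~` T) = 0%E, la setT = 1%E,
      (forall z, E z -> (elog (w z) + logpot la z <= (e - F)%:E)%E) &
      (\int[mu]_z f z <= \int[la]_z f z + e%:E)%E].
Proof.
move=> mf fl fK e0; have mu1 := equilibrium_mass eqm.
have [S [cS SE S0 [z0 Sz0] hS]] := equilibrium_support eqm.
have [K [cK KE zK hK]] := exceptional_compact (divr_gt0 e0 (ltr0Sn _ 1)).
have [Ke|/set0P K0] := eqVneq K set0.
  exists mu, S; split => //.
  - move=> z Ez; apply: (le_trans (hK _ Ez _)); first by rewrite Ke.
    by rewrite lee_fin; lra.
  - by rewrite leeDl // lee_fin ltW.
pose T := S `|` K.
have cT : compact T by exact: compactU.
have mT := measurable_compact_plane cT.
have muT : mu (~` T) = 0%E.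
  apply/eqP; rewrite -measure_le0 -S0 le_measure ?inE //.
  - exact: measurableC.
  - by apply: measurableC; exact: measurable_compact_plane.
  - by apply: subsetC; exact: subsetUl.
have [R0 R00 hR0] := compact_bounded_plane (0, 0) cT.
have [W W0 hW] := weight_growth cE adm (addr_ge0 (ltW R00) (@ler01 R)).
(* Thus any unit measure on T has potential at most ln W - ln (w z) at z, uniformly even if E is
   unbounded. *)
have Wbound z t : E z -> 0 < w z -> T t -> (elog (cdist z t) <= (ln W - ln (w z))%:E)%E.
  move=> Ez wz Tt; have /elog_le : w z * cdist z t <= W.
    apply: le_trans (hW _ Ez); apply: ler_wpM2l; first exact: ltW.
    by have := cdist_triangle z (0, 0) t; rewrite -cabsE; have := hR0 _ Tt; lra.
  rewrite elogM // [X in (_ <= X)%E]/elog ifF; last by rewrite leNgt W0.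
  case: (elog (cdist z t)) => [x| |] //; last by move=> _; exact: leNye.
  by rewrite -EFinD !lee_fin; lra.
have wW z : E z -> w z <= W.
  move=> Ez; have := hW _ Ez; have := weight_ge0 adm Ez; have := cabs_ge0 z; nra.
have [B hB] := fK _ cT.
have I_le : (\int[mu]_z f z <= B%:E)%E.
  by rewrite -[B]mulr1; exact: (integral_ub_le mT muT mu1).
have I_ge : (l%:E <= \int[mu]_z f z)%E.
  rewrite -[l%:E]mule1 -mu1 -(integral_cst mu measurableT); apply: measurable_le_integral => //.
have [I IE] : exists I : R, (\int[mu]_z f z = I%:E)%E.
  by move: I_le I_ge; case: (integral _ _ _) => [I| |] // _ _; exists I.
rewrite IE in I_le I_ge *; rewrite !lee_fin in I_le I_ge.
(* With [eta * M = e / 2], both eta (ln W + F) and eta (I - l) are at most e / 2, and eta < 1. *)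
pose M := `|ln W + F| + `|I - l| + e + 1.
have n1 := normr_ge0 (ln W + F); have n2 := normr_ge0 (I - l).
have M0 : 0 < M by rewrite /M; lra.
pose eta := e / (2 * M).
have eta0 : 0 < eta by rewrite divr_gt0 // mulr_gt0.
have etaM : eta * M = e / 2 by rewrite /eta; field; rewrite gt_eqF.
have eta1 : eta < 1 by rewrite ltr_pdivrMr ?mulr_gt0 // /M; lra.
have h1 : eta * (ln W + F) <= e / 2.
  rewrite -etaM; apply: ler_wpM2l; first exact: ltW.
  by have := ler_norm (ln W + F); rewrite /M; lra.
have h2 : eta * (I - l) <= e / 2.
  rewrite -etaM; apply: ler_wpM2l; first exact: ltW.
  by have := ler_norm (I - l); rewrite /M; lra.
(* On K the atoms contribute eta (- L) = - |ln W + F|, which lowers the remaining bound ln W to at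
   most - F. *)
pose L := (`|ln W + F|) / eta.
have L0 : 0 <= L by rewrite divr_ge0 // ltW.
have [s [s0 sK] hs] := small_potential_zero_cap cK K0 zK L0.
have n0 : 0 < (size s)%:R :> R by rewrite ltr0n; case: s s0 {sK hs}.
have b0 : 0 <= 1 - eta by lra.
have k0 : 0 <= eta / (size s)%:R by rewrite divr_ge0 // ltW.
have sT : {in s, forall t, T t} by move=> t ts; right; exact: sK.
have [la [la0 la1 laf]] := exists_atomic_mixture (NngNum b0) (NngNum k0) mT muT mu1 sT.
rewrite /= in la1 laf.
exists la, T; split => //.
- by rewrite la1 -mulrA mulVf ?gt_eqF // mulr1 subrK.
- move=> z Ez; have := weight_ge0 adm Ez; rewrite le_eqVlt => /orP[/eqP wz|wz].
    by rewrite -wz /elog lexx addNye leNye.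
  have [D D0 hD] := compact_bounded_plane z cT.
  have -> : (logpot la z = (1 - eta)%:E * logpot mu z
      + (eta / (size s)%:R)%:E * \sum_(t <- s) elog (cdist z t))%E.
    apply: (laf _ (ln D)); first exact: measurable_elog_cdist.
    by move=> t Tt; apply: (le_trans (elog_le (hD _ Tt))); rewrite /elog ifF // leNgt D0.
  have bound (X1 X2 : R) : (logpot mu z <= X1%:E)%E ->
      (\sum_(t <- s) elog (cdist z t) <= (X2 * (size s)%:R)%:E)%E ->
      ln (w z) + ((1 - eta) * X1 + eta * X2) <= e - F ->
      (elog (w z) + ((1 - eta)%:E * logpot mu z
        + (eta / (size s)%:R)%:E * \sum_(t <- s) elog (cdist z t)) <= (e - F)%:E)%E.
    move=> hX1 hX2 hX.
    apply: (@le_trans _ _ (ln (w z) + ((1 - eta) * X1 + eta * X2))%:E); last by rewrite lee_fin.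
    rewrite {1}/elog ifF; last by rewrite leNgt wz.
    rewrite !EFinD; apply: leeD => //; apply: leeD.
      by rewrite EFinM; apply: lee_wpmul2l.
    have -> : eta * X2 = eta / (size s)%:R * (X2 * (size s)%:R) by field; rewrite gt_eqF.
    by rewrite [X in (_ <= X)%E]EFinM; apply: lee_wpmul2l.
  have [Kz|nKz] := pselect (K z).
    apply: (bound (ln W - ln (w z)) (- L)); last 1 first.
    + have : eta * L = `|ln W + F| by rewrite /L mulrC mulfVK // gt_eqF.
      have := ler_norm (ln W + F).
      have : ln (w z) <= ln W by rewrite ler_ln ?posrE // wW.
      clear -eta0 eta1 e0; nra.
    + rewrite -[ln W - ln (w z)]mulr1; apply: (integral_ub_le mT muT mu1).
        exact: measurable_elog_cdist.
      by move=> t Tt; exact: Wbound.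
    + exact: hs.
  apply: (bound (e / 2 - F - ln (w z)) (ln W - ln (w z))); last 1 first.
  + clear -h1 eta0 eta1 e0; nra.
  + have := hK _ Ez nKz; rewrite {1}/elog ifF; last by rewrite leNgt wz.
    case: (logpot mu z) => [x| |] //; last by move=> _; exact: leNye.
    by rewrite -EFinD !lee_fin; lra.
  + by apply: sume_seq_le => t ts; apply: Wbound => //; exact: sT.
- rewrite (laf f B mf hB) IE.
  have ls : ((l * (size s)%:R)%:E <= \sum_(t <- s) f t)%E by apply: sume_seq_ge.
  apply: (@le_trans _ _ ((1 - eta) * I + eta / (size s)%:R * (l * (size s)%:R) + e)%:E).
    have -> : eta / (size s)%:R * (l * (size s)%:R) = eta * l by field; rewrite gt_eqF.
    by rewrite lee_fin; clear -h2 e0; lra.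
  rewrite !EFinD [X in (_ + X + _ <= _)%E]EFinM; apply: leeD => //; apply: leeD.
    by rewrite -EFinM.
  exact: lee_wpmul2l.
Qed.

End exceptional_set.

Lemma integral_seqDU {R : realType} d (X : measurableType d) (la : {measure set X -> \bar R})
    (C : nat -> set X) (f : X -> \bar R) n :
  (forall k, measurable (C k)) -> measurable_fun setT f ->
  (\int[la]_(t in \big[setU/set0]_(k < n) C k) f t =
   \sum_(k < n) \int[la]_(t in seqDU C k) f t)%E.
Proof.
move=> mC mf; elim: n => [|n IH]; first by rewrite !big_ord0 integral_set0.
have mU : measurable (\big[setU/set0]_(k < n) C k) by exact: bigsetU_measurable.
rewrite !big_ord_recr /= -IH /seqDU -integral_setU //.
- by congr integral; rewrite setUDr setDv setD0.
- exact: measurableD.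
- exact: measurable_funTS.
- by rewrite disj_set2E; apply/eqP; rewrite setDE setICA setICr setI0.
Qed.

Section two_points.
Context {R : realType}.
Variables (E : set (R * R)) (w : R * R -> R).

(** Every z is at distance at least half of |c_i - c_j| from one of the two points. *)
Lemma wmax_two_points m (c : 'I_m -> R * R) i j : 0 < w (c i) -> 0 < w (c j) -> c i <> c j ->
  exists2 b : R, 0 < b & forall z, b <= wmax w c z.
Proof.
move=> wi wj cij; have cd : 0 < cdist (c i) (c j).
  rewrite lt_neqAle cdist_ge0 andbT eq_sym; apply/eqP => /cdist_eq0; exact: cij.
pose u := Num.min (w (c i)) (w (c j)).
have u0 : 0 < u by rewrite lt_min wi.
have ui : u <= w (c i) by rewrite ge_min lexx.
have uj : u <= w (c j) by rewrite ge_min lexx orbT.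
exists (u * (cdist (c i) (c j) / 2)); first by rewrite mulr_gt0 // divr_gt0.
move=> z; have := cdist_triangle (c i) z (c j); rewrite (cdistC (c i) z) => tri.
have := wmax_ge w c z i; have := wmax_ge w c z j.
have := cdist_ge0 z (c i); have := cdist_ge0 z (c j).
have [h|h] := leP (cdist (c i) (c j) / 2) (cdist z (c i)).
  clear -h ui u0; nra.
have {}h : cdist (c i) (c j) / 2 <= cdist z (c j) by lra.
clear -h uj u0; nra.
Qed.

(** Enlarges the maximum so that its logarithm is bounded below. If no c_k has positive weight, all
    are replaced by [a] and [b]; if those of positive weight coincide, another index, available
    since m >= 2, is moved to a different point of positive weight. *)
Lemma wmax_spread m (c : 'I_m -> R * R) a b : (2 <= m)%N ->
  (forall z, E z -> 0 <= w z) -> E a -> E b -> a <> b -> 0 < w a -> 0 < w b ->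
  (forall k, E (c k)) ->
  exists c' : 'I_m -> R * R, [/\ forall k, E (c' k), forall z, wmax w c z <= wmax w c' z &
    exists2 b : R, 0 < b & forall z, b <= wmax w c' z].
Proof.
move=> m2 w0 Ea Eb ab wa wb Ec.
have i0 : 'I_m by exact: (Ordinal (ltnW m2)).
have ge0 (c' : 'I_m -> R * R) z : (forall k, E (c' k)) -> 0 <= wmax w c' z.
  move=> Ec'; apply: le_trans (wmax_ge w c' z i0).
  by rewrite mulr_ge0 ?cdist_ge0 // w0.
have other (k : 'I_m) : exists j : 'I_m, j != k.
  have [->|] := eqVneq k (Ordinal (ltnW m2)); first by exists (Ordinal m2).
  by rewrite eq_sym; exists (Ordinal (ltnW m2)).
have [[k wk]|nk] := pselect (exists k, 0 < w (c k)); last first.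
  have [j ji] := other i0.
  pose c' (k : 'I_m) := if k == i0 then a else b.
  have Ec' k : E (c' k) by rewrite /c'; case: ifP.
  exists c'; split => //.
    move=> z; apply: wmax_le; first exact: ge0.
    move=> k; apply: le_trans (ge0 c' z Ec'); rewrite mulr_le0_ge0 ?cdist_ge0 //.
    by rewrite leNgt; apply/negP => wk; apply: nk; exists k.
  by apply: (@wmax_two_points _ _ i0 j); rewrite /c' ?eqxx ?(negbTE ji).
have [[j wj cj]|nj] := pselect (exists2 j, 0 < w (c j) & c j <> c k).
  by exists c; split => //; exact: (wmax_two_points wj wk cj).
have [p [Ep wp pk]] : exists p, [/\ E p, 0 < w p & p <> c k].
  have [ak|ak] := pselect (a = c k); last by exists a.
  by exists b; split => // bk; apply: ab; rewrite bk.
have [j jk] := other k.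
pose c' (i : 'I_m) := if i == j then p else c i.
have c'k : c' k = c k by rewrite /c' eq_sym (negbTE jk).
have c'j : c' j = p by rewrite /c' eqxx.
have Ec' i : E (c' i) by rewrite /c'; case: ifP.
exists c'; split => //; last first.
  by apply: (@wmax_two_points _ _ j k); rewrite ?c'j ?c'k.
move=> z; apply: wmax_le; first exact: ge0.
move=> i; have [ij|ij] := eqVneq i j; last first.
  by have := wmax_ge w c' z i; rewrite /c' (negbTE ij).
have [wi|wi] := ltP 0 (w (c i)).
  have <- : c k = c i by apply: contrapT => ki; apply: nj; exists i => // /esym.
  by rewrite -c'k; exact: wmax_ge.
by apply: le_trans (ge0 c' z Ec'); rewrite mulr_le0_ge0 ?cdist_ge0.
Qed.

End two_points.

(** The filter [G] consists of the sets that contain every list extending some fixed list with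
    entries in [D]; near-covering compactness along it yields one list good for all points. *)
Lemma compact_seq_subcover {X : topologicalType} {I : eqType} (K : set X) (D : set I)
    (O : I -> set X) : compact K -> (forall i, D i -> open (O i)) ->
  (forall x, K x -> exists2 i, D i & O i x) ->
  exists2 s : seq I, {in s, forall i, D i} & forall x, K x -> exists2 i, i \in s & O i x.
Proof.
move=> /compact_near_coveringP ncK oO KO.
pose G := [set U : set (seq I) | exists2 s0 : seq I, {in s0, forall i, D i} &
  forall s : seq I, {subset s0 <= s} -> U s].
have FG : Filter G.
  split; first by exists [::].
  - move=> U V [s sD sU] [t tD tV]; exists (s ++ t).
      by move=> i; rewrite mem_cat => /orP[/sD|/tD].
    move=> u su; split; [apply: sU|apply: tV] => i hi; apply: su;
      by rewrite mem_cat hi ?orbT.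
  - by move=> U V UV [s sD sU]; exists s => // t /sU /UV.
have [x Kx|s sD sK] := ncK _ G (fun s x => exists2 i, i \in s & O i x) FG.
  have [i Di Oix] := KO _ Kx.
  exists (O i, [set s : seq I | i \in s]) => /=; last by move=> [y s] /= [Oy si]; exists i.
  split; first by apply: open_nbhs_nbhs; split => //; exact: oO.
  exists [:: i]; first by move=> j; rewrite inE => /eqP ->.
  by move=> s; apply; rewrite inE.
by exists s => //; exact: sK.
Qed.

Section sharpness.
Context {R : realType}.
Variables (E : set (R * R)) (w : R * R -> R).
Hypotheses (cE : closed E) (adm : admissible E w).

(* Each point is assigned to the first [k] that realises the maximum, and [nu k] is the
   restriction of [la] to the cell of [k]. *)
Lemma wmax_partition (la : {measure set (R * R) -> \bar R}) (T : set (R * R))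
    m (c : 'I_m -> R * R) (b : R) :
  compact T -> la (~` T) = 0%E -> la setT = 1%E -> (forall k, E (c k)) ->
  0 < b -> (forall z, b <= wmax w c z) ->
  exists (nu : 'I_m -> {measure set (R * R) -> \bar R}) (alpha : 'I_m -> R),
    [/\ admissible_family nu alpha,
      forall z, (\sum_(j < m) logpot (nu j) z = logpot la z)%E &
      (\int[la]_z elog (wmax w c z) <= lhs_sum E w nu alpha)%E].
Proof.
case: m c => [|m] c cT la0 la1 Ec b0 hb.
  by have := hb (0, 0); rewrite /wmax big_ord0 leNgt b0.
have mT := measurable_compact_plane cT.
(* Indexed by nat because [seqDU], which makes the cells disjoint, acts on sequences. *)
pose C (k : nat) := [set z | wmax w c z <= w (c (inord k)) * cdist z (c (inord k))].
have mwmax : measurable_fun setT (wmax w c).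
  by apply: measurable_continuous_plane; exact: (continuous_wmax cE adm Ec).
have mC k : measurable (C k).
  rewrite -[C k]setTI; apply: measurable_fun_le => //.
  apply: measurable_funM => //.
  have -> : (fun z => cdist z (c (inord k))) = cdist (c (inord k)).
    by apply/funext => z; exact: cdistC.
  exact: measurable_cdist.
have covC : \big[setU/set0]_(k < m.+1) C k = setT.
  apply/seteqP; split => // z _; rewrite -bigcup_mkord.
  have [k _ hk] := @eq_bigmax _ _ _ 0 ord0 xpredT (fun k => w (c k) * cdist z (c k)) isT
    (fun k _ => mulr_ge0 (weight_ge0 adm (Ec k)) (cdist_ge0 z (c k))).
  by exists k => //=; rewrite /C /= inord_val /wmax hk.
have mA k : measurable (seqDU C k) by apply: measurableD => //; exact: bigsetU_measurable.
have sumA f : measurable_fun setT f ->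
    (\sum_(k < m.+1) \int[la]_(t in seqDU C k) f t = \int[la]_t f t)%E.
  by move=> mf; rewrite -integral_seqDU // covC.
pose nu (k : 'I_m.+1) : {measure set (R * R) -> \bar R} := mrestr la (mA k).
pose alpha (k : 'I_m.+1) := fine (la (seqDU C k)).
have nuT k : nu k setT = (alpha k)%:E.
  by rewrite /nu /= /mrestr setTI /alpha fineK // (measure_fin la1).
have nu0 k : nu k (~` T) = 0%E.
  apply/eqP; rewrite -measure_le0 -la0 /= /mrestr le_measure ?inE //.
  - by apply: measurableI => //; exact: measurableC.
  - exact: measurableC.
exists nu, alpha; split.
- split => //; first by move=> k; exists T.
  apply: EFin_inj; rewrite -sumEFin.
  transitivity (\sum_(k < m.+1) \int[la]_(t in seqDU C k) (cst 1%E) t)%E.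
    by apply: eq_bigr => k _; rewrite integral_cst // mul1e -(nuT k) /= /mrestr setTI.
  by rewrite sumA // integral_cst // mul1e la1.
- move=> z; rewrite -[RHS]sumA; last exact: measurable_elog_cdist.
  apply: eq_bigr => k _; apply: integral_mrestr => //; exact: measurable_elog_cdist.
- rewrite -sumA; last exact: (measurable_elog_wmax cE adm Ec).
  apply: lee_sum => k _.
  apply: (@le_trans _ _ ((alpha k)%:E * elog (w (c k)) + logpot (nu k) (c k))%E); last first.
    by apply: ereal_sup_ubound; exists (c k).
  have mf : measurable_fun setT (fun t => elog (cdist (c k) t)) by exact: measurable_elog_cdist.
  rewrite /logpot (integral_mrestr la (mA k)) //.
  (* For w(c_k) = 0 the cell is empty, the maximum being at least b > 0, so the term vanishes in
     spite of the logarithm -oo. *)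
  have := weight_ge0 adm (Ec k); rewrite le_eqVlt => /orP[/eqP wk|wk].
    have A0 : seqDU C k = set0.
      apply/seteqP; split => // z [+ _]; rewrite /C /= inord_val -wk mul0r => h.
      by have := hb z; lra.
    by rewrite /alpha A0 measure0 !integral_set0 mul0e adde0.
  have [B B0 hB] := compact_bounded_plane (c k) cT.
  have -> : ((alpha k)%:E * elog (w (c k)) + \int[la]_(t in seqDU C k) elog (cdist (c k) t) =
      \int[nu k]_t ((ln (w (c k)))%:E + elog (cdist (c k) t)))%E.
    rewrite (integralD_ub mT (nu0 k) (nuT k) (B := ln (w (c k))) (B' := ln B)) //.
    + rewrite integral_cst // nuT -EFinM mulrC /elog ifF ?EFinM //; last by rewrite leNgt wk.
      by congr (_ + _)%E; rewrite -(integral_mrestr la (mA k)).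
    + by move=> t St; apply: (le_trans (elog_le (hB _ St))); rewrite /elog ifF // leNgt B0.
  rewrite (integral_mrestr la (mA k)) //; last exact: emeasurable_funD.
  apply: measurable_le_integral => //.
  + by apply: measurable_funTS; exact: (measurable_elog_wmax cE adm Ec).
  + by apply: measurable_funTS; exact: emeasurable_funD.
  + move=> z [+ _]; rewrite /C /= inord_val => h.
    by rewrite -elogM // cdistC; apply: elog_le.
Qed.

Variables (mu : {measure set (R * R) -> \bar R}) (F : R).
Hypothesis eqm : weighted_equilibrium E w mu F.

(** A unit mass concentrated at one point has potential -oo there, whereas the potential of [mu] is
    finite on S; hence S has two points, and [w] is positive on S. *)
Lemma equilibrium_two_points : exists a b,
  [/\ E a, E b, a <> b, 0 < w a & 0 < w b].
Proof.
have mu1 := equilibrium_mass eqm.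
have [S [cS SE S0 [a Sa] hS]] := equilibrium_support eqm.
have [wa fa _] := hS _ Sa.
have [[b Sb ab]|nb] := pselect (exists2 b, S b & a <> b).
  by exists a, b; have [wb _ _] := hS _ Sb; split => //; exact: SE.
exfalso; have Pa (B : R) : (logpot mu a <= (B * 1)%:E)%E.
  apply: (integral_ub_le (measurable_compact_plane cS) S0 mu1).
    exact: measurable_elog_cdist.
  move=> t St; have <- : a = t by apply: contrapT => ta; apply: nb; exists t.
  by rewrite cdistxx /elog lexx leNye.
move: fa Pa; case: (logpot mu a) => [x| |] // _ /(_ (x - 1)).
by rewrite lee_fin; lra.
Qed.

Lemma wmax_elog_bounded m (c : 'I_m -> R * R) K : (forall k, E (c k)) -> compact K ->
  exists B : R, forall z, K z -> (elog (wmax w c z) <= B%:E)%E.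
Proof.
move=> Ec cK; have E0 := weight_domain_nonempty eqm.
have [B hB] := elog_fdist_bounded cE adm E0 cK; exists B => z Kz.
by apply: le_trans (hB _ Kz); apply: elog_le; exact: (wmax_le_fdist cE adm E0).
Qed.

Lemma CEwm_sharp m (C : R) : (2 <= m)%N -> (C%:E < CEwm E w mu F m)%E ->
  exists (nu : 'I_m -> {measure set (R * R) -> \bar R}) (alpha : 'I_m -> R),
    admissible_family nu alpha /\ (C%:E + sup_prod E w nu < lhs_sum E w nu alpha)%E.
Proof.
move=> m2; rewrite /CEwm -lteBlDr // -EFinB => /ereal_sup_gt[_ [c0 /= Ec0 <-] hC].
have mu1 := equilibrium_mass eqm.
have [a [b' [Ea Eb ab wa wb]]] := equilibrium_two_points.
have [c [Ec c0c [b b0 hb]]] := wmax_spread m2 (fun z => weight_ge0 adm (z := z)) Ea Eb ab wa wb Ec0.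
have mw := measurable_elog_wmax cE adm Ec.
have lb z : ((ln b)%:E <= elog (wmax w c z))%E.
  apply: le_trans (elog_le (hb z)); rewrite /elog ifF // leNgt b0 //.
have {hC} : ((C - F)%:E < \int[mu]_z elog (wmax w c z))%E.
  apply: (lt_le_trans hC); apply: measurable_le_integral => //.
    exact: (measurable_elog_wmax cE adm Ec0).
  by move=> z _; apply: elog_le; exact: c0c.
have [S [cS _ S0 _ _]] := equilibrium_support eqm.
have : (\int[mu]_z elog (wmax w c z) < +oo)%E.
  have [B hB] := wmax_elog_bounded Ec cS; apply: le_lt_trans (ltry (B * 1)).
  exact: (integral_ub_le (measurable_compact_plane cS) S0 mu1).
have near e := exists_near_equilibrium cE adm eqm (e := e) mw lb (fun K => wmax_elog_bounded Ec).
case: (integral _ _ _) near => [I| |] // near _; rewrite lte_fin => hC.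
(* One third of the gap is lost in the supremum and one in the integral; the last third gives the
   strict inequality. *)
have [|la [T [cT la0 la1 sup_le I_le]]] := near ((I + F - C) / 3); first lra.
have [nu [alpha [fam sumE lhs_ge]]] := wmax_partition cT la0 la1 Ec b0 hb.
exists nu, alpha; split => //; apply: lt_le_trans lhs_ge.
apply: (@le_lt_trans _ _ (C%:E + ((I + F - C) / 3 - F)%:E)%E).
  apply: leeD => //; apply: ge_ereal_sup => _ [z Ez <-].
  by rewrite sumE; exact: sup_le.
move: I_le; case: (integral _ _ _) => [x| |] //; last by rewrite -EFinD ltry.
by rewrite -!EFinD lee_fin lte_fin; lra.
Qed.

(** For q < 1 the sets where w t |z - t| > q times the farthest distance are open and cover S. A
    finite subcover loses at most - ln q = eps, half of the gap between the two constants; the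
    farthest distance is positive since two points have positive weight. *)
Lemma exists_CEwm_gt (C : R) : (C%:E < CEw E w mu F)%E ->
  exists2 m, (2 <= m)%N & (C%:E < CEwm E w mu F m)%E.
Proof.
have := CEw_lty cE adm eqm.
case XE : (CEw E w mu F) => [X| |] // _; rewrite lte_fin => CX.
have E0 := weight_domain_nonempty eqm; have mu1 := equilibrium_mass eqm.
have [S [cS _ S0 _ _]] := equilibrium_support eqm.
have mS := measurable_compact_plane cS.
have [a [b' [Ea Eb ab wa wb]]] := equilibrium_two_points.
have fdist_gt0 z : 0 < fdist E w z.
  pose c2 (k : 'I_2) := if k == ord0 then a else b'.
  have [b b0 hb] : exists2 b : R, 0 < b & forall z, b <= wmax w c2 z.
    exact: (@wmax_two_points _ _ _ c2 ord0 ord_max).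
  apply: (lt_le_trans b0); apply: (le_trans (hb z)); apply: (wmax_le_fdist cE adm E0).
  by move=> k; rewrite /c2; case: ifP.
pose eps := (X - C) / 2; have eps0 : 0 < eps by rewrite /eps; lra.
pose q := expR (- eps); have q0 : 0 < q by exact: expR_gt0.
have q1 : q < 1 by rewrite expR_lt1 oppr_lt0.
pose O t := [set z | q * fdist E w z < w t * cdist z t].
have cfd := continuous_fdist cE adm E0.
have oO t : E t -> open (O t).
  move=> Et; rewrite (_ : O t = (fun z => w t * cdist z t - q * fdist E w z) @^-1` [set x | 0 < x]);
    last by apply/seteqP; split => z /=; rewrite subr_gt0.
  apply: open_comp; last exact: open_gt.
  move=> z _; apply: cvgB.
    apply: cvgM; first exact: cvg_cst.
    have -> : cdist ^~ t = cdist t by apply/funext => u; exact: cdistC.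
    by rewrite (cdistC z t); exact: continuous_cdist.
  by apply: cvgM; [exact: cvg_cst|exact: cfd].
have [z _|s sE SO] := compact_seq_subcover cS oO.
  apply: contrapT => nz.
  have : fdist E w z <= q * fdist E w z.
    apply: (fdist_le cE adm E0) => t Et; rewrite leNgt; apply/negP => h.
    by apply: nz; exists t.
  by rewrite ler_pMl // leNgt q1.
(* Padding with the point [a] of E guarantees at least two points, as sharpness for fixed m
   requires. *)
pose c (k : 'I_(size s).+2) := nth a s k.
have Ec k : E (c k).
  rewrite /c; have [ks|ks] := ltnP k (size s); last by rewrite nth_default.
  by apply: sE; exact: mem_nth.
have wmax_gt z : S z -> q * fdist E w z < wmax w c z.
  move=> /SO [t ts Ot]; apply: (lt_le_trans Ot).
  have tS : (index t s < size s)%N by rewrite index_mem.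
  have := wmax_ge w c z (inord (index t s)).
  rewrite /c inordK; last by rewrite ltnS (leq_trans (ltnW tS)).
  by rewrite nth_index.
exists (size s).+2 => //.
have mw := measurable_elog_wmax cE adm Ec.
have [B hB] := wmax_elog_bounded Ec cS.
have : (CEw E w mu F <= eps%:E + CEwm E w mu F (size s).+2)%E.
  rewrite /CEw /CEwm addeA; apply: leeD => //.
  apply: (@le_trans _ _ (\int[mu]_z (eps%:E + elog (wmax w c z)))%E).
    under eq_integral do rewrite eelog_farthest //.
    have mfd := measurable_elog_fdist cE adm E0.
    have mew : measurable_fun setT (fun z => eps%:E + elog (wmax w c z))%E.
      exact: emeasurable_funD.
    rewrite (integral_setI_conull measurableT mS S0 mfd).
    rewrite (integral_setI_conull measurableT mS S0 mew).
    apply: measurable_le_integral; rewrite ?setTI //; try exact: measurable_funTS.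
    move=> z Sz; have h := wmax_gt _ Sz; have f0 := fdist_gt0 z.
    have wm0 : 0 < wmax w c z by apply: lt_trans h; rewrite mulr_gt0.
    rewrite /elog ifF; last by rewrite leNgt f0.
    rewrite ifF; last by rewrite leNgt wm0.
    rewrite -EFinD lee_fin.
    move: h; rewrite -ltr_ln ?posrE ?mulr_gt0 // lnM ?posrE // /q expRK; lra.
  rewrite (integralD_ub mS S0 mu1 (B := eps) (B' := B)) // integral_cst // mu1 mule1.
  by apply: leeD => //; apply: ereal_sup_ubound; exists c.
rewrite XE; case: (CEwm _ _ _ _ _) => [x| |] //; last by rewrite ltry.
by rewrite -EFinD lee_fin lte_fin /eps; lra.
Qed.

End sharpness.

Theorem theorem3p2 (R : realType) (E : set (R * R)) (w : R * R -> R)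
    (mu : {measure set (R * R) -> \bar R}) (F : R) :
  closed E -> admissible E w -> weighted_equilibrium E w mu F ->
  [/\
   (* the two inequalities *)
   (forall (m : nat) (nu : 'I_m -> {measure set (R * R) -> \bar R})
           (alpha : 'I_m -> R),
      admissible_family nu alpha ->
      (lhs_sum E w nu alpha <= CEwm E w mu F m + sup_prod E w nu)%E /\
      (CEwm E w mu F m + sup_prod E w nu <= CEw E w mu F + sup_prod E w nu)%E),
   (* sharpness of C_E^w(m) for each fixed m >= 2 *)
   (forall (m : nat), (2 <= m)%N -> forall C : R, (C%:E < CEwm E w mu F m)%E ->
      exists (nu : 'I_m -> {measure set (R * R) -> \bar R}) (alpha : 'I_m -> R),
        admissible_family nu alpha /\
        (C%:E + sup_prod E w nu < lhs_sum E w nu alpha)%E) &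
   (* sharpness of C_E^w among constants independent of m *)
   (forall C : R, (C%:E < CEw E w mu F)%E ->
      exists (m : nat) (nu : 'I_m -> {measure set (R * R) -> \bar R})
             (alpha : 'I_m -> R),
        admissible_family nu alpha /\
        (C%:E + sup_prod E w nu < lhs_sum E w nu alpha)%E)].
Proof.
move=> cE adm eqm; split.
- move=> m nu alpha fam; split; first exact: lhs_sum_le.
  by apply: leeD => //; exact: CEwm_le_CEw.
- by move=> m m2 C hC; exact: (CEwm_sharp cE adm eqm m2 hC).
- move=> C /(exists_CEwm_gt cE adm eqm)[m m2 hC].
  by exists m; exact: (CEwm_sharp cE adm eqm m2 hC).
Qed.
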